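(* Let $k$ be a field. Let $(A,\{\Delta(\lambda)_{\lambda\in\Lambda}\})$ be a split quasi-hereditary $k$-algebra with a characteristic tilting module $T$, and let $R(A)=\operatorname{End}_A(T)^{op}$ be its Ringel dual. Let $Q\in\operatorname{add}T$ be a (partial) tilting module of $A$ and let $n\geq 2$ be a natural number. Then $Q\text{-}\operatorname{codomdim}_{A}T\geq n$ if and only if $(R(A),\operatorname{Hom}_A(T,Q))$ is an $(n-2)$-$\mathcal F(\tilde\Delta_{R(A)})$ split quasi-hereditary cover of $\operatorname{End}_A(Q)^{op}$.
   Context: All definitions are over the ground field $k$ (a case of the general definitions over a commutative Noetherian ring $R$). $A\text{-mod}$: finitely generated left $A$-modules; $A\text{-proj}$: finitely generated projectives; $D=\operatorname{Hom}_k(-,k)$; $\operatorname{add}M$: direct summands of finite direct sums of copies of $M$. $\mathcal F(\Theta)$: modules with a finite filtration with factors in $\Theta$. Split quasi-hereditary $k$-algebra: a finite-dimensional $k$-algebra $A$ with modules $\Delta(\lambda)\in A\text{-mod}$ (standard modules) indexed by a finite poset $\Lambda$ such that: $\operatorname{Hom}_A(\Delta(\lambda),\Delta(\mu))\neq 0$ implies $\lambda\leq\mu$; $\operatorname{End}_A(\Delta(\lambda))\simeq k$; for each $\lambda$ there are $P(\lambda)\in A\text{-proj}$ and an exact sequence $0\to C(\lambda)\to P(\lambda)\to\Delta(\lambda)\to 0$ with $C(\lambda)$ finitely filtered by modules $\Delta(\mu)\otimes_k U_\mu$ with $U_\mu$ finite-dimensional and $\mu>\lambda$; $\bigoplus_\lambda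 P(\lambda)$ is a progenerator of $A\text{-mod}$. $\tilde\Delta_A=\{\Delta(\lambda)\otimes_k U\colon\lambda\in\Lambda, U\text{ a finite-dimensional vector space}\}$; $\tilde\nabla$ is defined likewise from the costandard modules. Costandard modules $\nabla(\lambda)$: the modules, unique up to isomorphism, such that $(A^{op},\{D\nabla(\lambda)\})$ is split quasi-hereditary, $\mathcal F(\tilde\nabla)=\{X\in A\text{-mod}\colon\operatorname{Ext}^1_A(M,X)=0\ \forall M\in\mathcal F(\tilde\Delta)\}$, $\operatorname{Hom}_A(\Delta(\lambda),\nabla(\lambda))\simeq k$ and $\operatorname{Hom}_A(\Delta(\mu),\nabla(\lambda))=0$ for $\mu\neq\lambda$. A tilting module is a module $T$ of finite projective dimension with $\operatorname{Ext}_A^{i>0}(T,T)=0$ such that $A$ has a finite coresolution by modules in $\operatorname{add}T$; it is a characteristic tilting module if $\operatorname{add}T=\mathcal F(\tilde\Delta)\cap\mathcal F(\tilde\nabla)$. Modules in $\operatorname{add}T$ are called (partial) tilting. $R(A)$ is split quasi-hereditary with standard modules $\operatorname{Hom}_A(T,\nabla(\lambda))$, $\lambda\in\Lambda^{op}$. Relative codominant dimension: for $Q,X\in A\text{-mod}$, if there is no surjection $Y\to X$ with $Y\in\operatorname{add}Q$ and $\operatorname{Hom}_A(Q,Y)\to\operatorname{Hom}_A(Q,X)$ surjective, then $Q\text{-}\operatorname{codomdim}_{A}X=0$; otherwise it is the supremum in $\mathbb N\cup\{+\infty\}$ of all $n$ such that there is an exact sequence $Q_n\to\cdots\to Q_1\to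 X\to0$ with $Q_i\in\operatorname{add}Q$ such that $\operatorname{Hom}_A(Q,Q_n)\to\cdots\to\operatorname{Hom}_A(Q,X)\to0$ is exact (infinite if some $Q_i=0$). Covers: for a finite-dimensional algebra $C$ and $P\in C\text{-proj}$ with $E=\operatorname{End}_C(P)^{op}$, $(C,P)$ is a cover of $E$ if $F_P=\operatorname{Hom}_C(P,-)\colon C\text{-mod}\to E\text{-mod}$ is fully faithful on $C\text{-proj}$; it is a split quasi-hereditary cover if moreover $C$ is split quasi-hereditary. For a resolving subcategory $\mathcal A$ of $C\text{-mod}$ and $i\geq0$, $(C,P)$ is an $i$-$\mathcal A$ cover of $E$ if $F_P$ induces isomorphisms $\operatorname{Ext}_C^j(M,N)\to\operatorname{Ext}_E^j(F_PM,F_PN)$ for all $M,N\in\mathcal A$, $0\leq j\leq i$. *)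

(* Defs.v *)
From HB Require Import structures.
From mathcomp Require Import all_boot all_order all_algebra.

Set Implicit Arguments.
Unset Strict Implicit.
Unset Printing Implicit Defensive.

Import GRing.Theory.
Local Open Scope ring_scope.

(* The library's algType and falgType exclude the zero algebra, which occurs
   here as the endomorphism algebra of the zero module. *)
Record fdalg (k : fieldType) := FDAlg {
  alg_vect :> vectType k;
  aone : alg_vect;
  amul : alg_vect -> alg_vect -> alg_vect;
  amulA : associative amul;
  amul1l : left_id aone amul;
  amul1r : right_id aone amul;
  amul_linear_r : forall a, linear (amul a);
  amul_linear_l : forall b, linear (amul^~ b)
}.

Definition alg_iso (k : fieldType) (A B : fdalg k) : Prop :=
  exists f : 'Hom(A, B),
    [/\ bijective f, f (aone A) = aone B
      & forall a b, f (amul a b) = amul (f a) (f b)].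

Definition ground_alg (k : fieldType) : fdalg k.
Proof.
refine (@FDAlg k k^o 1 *%R (@mulrA k) (@mul1r k) (@mulr1 k) _ _).
- by move=> a c x y; rewrite mulrDr -[c *: x]/(c * x) mulrCA.
- by move=> b c x y; rewrite /= mulrDl -[c *: x]/(c * x) -mulrA.
Defined.

Definition opp_alg (k : fieldType) (A : fdalg k) : fdalg k :=
  @FDAlg k A (aone A) (fun a b => amul b a)
    (fun a b c => esym (amulA c b a)) (@amul1r k A) (@amul1l k A)
    (@amul_linear_l k A) (@amul_linear_r k A).

(* As A is finite-dimensional over k, its finitely generated left modules are
   the left modules that are finite-dimensional over k. *)
Record fdmod (k : fieldType) (A : fdalg k) := FDMod {
  mod_vect :> vectType k;
  mact : A -> mod_vect -> mod_vect;
  mact1 : forall x, mact (aone A) x = x;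
  mactM : forall a b x, mact (amul a b) x = mact a (mact b x);
  mact_linear_r : forall a, linear (mact a);
  mact_linear_l : forall x, linear (mact^~ x)
}.

Section HomSpaces.
Variables (k : fieldType) (A : fdalg k).
Implicit Types M N X : fdmod A.

HB.instance Definition _ M a := GRing.isSemilinear.Build k M M _ (@mact k A M a)
  (GRing.semilinear_linear (@mact_linear_r k A M a)).

Definition orbit_map M (x : M) : A -> M := fun a => mact a x.
HB.instance Definition _ M x := GRing.isSemilinear.Build k A M _ (@orbit_map M x)
  (GRing.semilinear_linear (@mact_linear_l k A M x)).

Definition act_defect M N (a : A) (f : 'Hom(M, N)) : 'Hom(M, N) :=
  ((f \o linfun (mact a)) - (linfun (mact a) \o f))%VF.

Fact act_defectE M N a f x :
  @act_defect M N a f x = f (mact a x) - mact a (f x).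
Proof. by rewrite add_lfunE opp_lfunE !comp_lfunE !lfunE. Qed.

Fact act_defect_is_linear M N a : linear (@act_defect M N a).
Proof.
move=> c f g; apply/lfunP=> x; rewrite !(act_defectE, add_lfunE, scale_lfunE).
by rewrite linearP scalerBr opprD addrACA.
Qed.
HB.instance Definition _ M N a :=
  GRing.isSemilinear.Build k 'Hom(M, N) 'Hom(M, N) _ (@act_defect M N a)
    (GRing.semilinear_linear (@act_defect_is_linear M N a)).

(* The space Hom_A(M, N) of A-linear maps, see mem_HomA *)
Definition HomA M N : {vspace 'Hom(M, N)} :=
  (\bigcap_(a <- vbasis (fullv : {vspace A}))
     lker (linfun (@act_defect M N a)))%VS.

Lemma mem_HomA M N (f : 'Hom(M, N)) :
  (f \in HomA M N) <-> (forall a x, f (mact a x) = mact a (f x)).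
Proof.
set bA := vbasis (fullv : {vspace A}).
have kerE a : (f \in lker (linfun (@act_defect M N a))) = (act_defect a f == 0).
  by rewrite memv_ker lfunE.
split=> [Hf a x|Hf]; last first.
  rewrite /HomA; elim: (tval _) => [|a s IHs]; first by rewrite big_nil memvf.
  rewrite big_cons memv_cap IHs andbT kerE; apply/eqP/lfunP=> x.
  by rewrite act_defectE Hf subrr lfunE.
have {}Hf b : b \in bA -> act_defect b f = 0.
  move: Hf; rewrite /HomA -/bA -[b \in bA]/(b \in tval bA).
  elim: (tval _) => //= a' s IHs; rewrite big_cons memv_cap inE => /andP[fa fs].
  by case/predU1P=> [->|/(IHs fs)//]; apply/eqP; rewrite -kerE.
have sum_actM (L : fdmod A) (y : L) :
    mact a y = \sum_i coord bA i a *: mact bA`_i y.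
  rewrite -[LHS]/(orbit_map y a) {1}(coord_vbasis (memvf a)) linear_sum.
  by apply: eq_bigr => i _; rewrite linearZ.
rewrite !sum_actM linear_sum; apply: eq_bigr => i _; rewrite linearZ /=.
have /Hf/lfunP/(_ x) : bA`_i \in bA by rewrite mem_nth // size_tuple.
by rewrite act_defectE lfunE => /subr0_eq ->.
Qed.

Lemma HomA1 M : \1%VF \in HomA M M.
Proof. by apply/mem_HomA => a x; rewrite !id_lfunE. Qed.

Lemma HomA_comp M N X (g : 'Hom(N, X)) (f : 'Hom(M, N)) :
  g \in HomA N X -> f \in HomA M N -> (g \o f)%VF \in HomA M X.
Proof.
by move=> /mem_HomA Hg /mem_HomA Hf; apply/mem_HomA => a x;
   rewrite !comp_lfunE Hf Hg.
Qed.

End HomSpaces.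

Section Constructions.
Variables (k : fieldType) (A : fdalg k).
Implicit Types M N X T : fdmod A.

Definition reg_mod : fdmod A :=
  @FDMod k A A (@amul k A) (@amul1l k A) (fun a b c => esym (amulA a b c))
    (@amul_linear_r k A) (@amul_linear_l k A).

Definition zero_mod : fdmod A.
Proof.
refine (@FDMod k A 'rV[k]_0 (fun _ x => x) _ _ _ _) => // x c a b.
by apply/rowP=> -[].
Defined.

Definition sum_mod M N : fdmod A.
Proof.
refine (@FDMod k A (M * N)%type (fun a u => (mact a u.1, mact a u.2)) _ _ _ _).
- by case=> x y; rewrite !mact1.
- by move=> a b [x y]; rewrite !mactM.
- by move=> a c [x y] [x' y']; rewrite /= !mact_linear_r.
- by case=> x y c a b; rewrite /= !mact_linear_l.
Defined.

Definition bigsum_mod (s : seq (fdmod A)) : fdmod A := foldr sum_mod zero_mod s.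

Definition pow_mod M n : fdmod A := bigsum_mod (nseq n M).

(* Below, vsproj only repackages a composite of A-linear maps, which lies in
   HomA, as an element of the type subvs_of (HomA _ _). *)
Lemma hom_comp_linear_l M N X (f : 'Hom(M, N)) :
  linear (fun g : subvs_of (HomA N X) =>
    vsproj (HomA M X) (vsval g \o f)%VF).
Proof. by move=> c g h; rewrite linearP /= comp_lfunDl -comp_lfunZl linearP. Qed.

Lemma hom_comp_linear_r M N X (g : 'Hom(N, X)) :
  linear (fun f : subvs_of (HomA M N) =>
    vsproj (HomA M X) (g \o vsval f)%VF).
Proof. by move=> c f h; rewrite linearP /= comp_lfunDr -comp_lfunZr linearP. Qed.

Definition hom_comp M N X (g : subvs_of (HomA N X)) (f : subvs_of (HomA M N)) :
  subvs_of (HomA M X) := vsproj _ (vsval g \o vsval f)%VF.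

Lemma hom_compE M N X (g : subvs_of (HomA N X)) (f : subvs_of (HomA M N)) :
  vsval (hom_comp g f) = (vsval g \o vsval f)%VF.
Proof. by rewrite vsprojK // HomA_comp ?subvsP. Qed.

Lemma hom_compA M N X T (h : subvs_of (HomA X T)) (g : subvs_of (HomA N X))
    (f : subvs_of (HomA M N)) :
  hom_comp h (hom_comp g f) = hom_comp (hom_comp h g) f.
Proof. by apply: subvs_inj; rewrite !hom_compE comp_lfunA. Qed.

Definition hom_id M : subvs_of (HomA M M) := vsproj _ \1%VF.

Lemma hom_idl M N (f : subvs_of (HomA M N)) : hom_comp (hom_id N) f = f.
Proof.
by apply: subvs_inj; rewrite hom_compE vsprojK ?HomA1 // comp_lfun1l.
Qed.

Lemma hom_idr M N (f : subvs_of (HomA M N)) : hom_comp f (hom_id M) = f.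
Proof.
by apply: subvs_inj; rewrite hom_compE vsprojK ?HomA1 // comp_lfun1r.
Qed.

Definition end_alg M : fdalg k :=
  @FDAlg k (subvs_of (HomA M M)) (hom_id M) (@hom_comp M M M)
    (@hom_compA M M M M) (@hom_idl M M) (@hom_idr M M)
    (fun g => @hom_comp_linear_r M M M (vsval g))
    (fun f => @hom_comp_linear_l M M M (vsval f)).

(* Hom_A(P, X) as a left module over End_A(P)^op *)
Definition hom_mod P X : fdmod (opp_alg (end_alg P)) :=
  @FDMod k (opp_alg (end_alg P)) (subvs_of (HomA P X))
    (fun e f => hom_comp f e) (@hom_idr P X)
    (fun a b f => hom_compA f b a)
    (fun e => @hom_comp_linear_l P P X (vsval e))
    (fun f => @hom_comp_linear_r P P X (vsval f)).

(* The action of Hom_A(P, -) on morphisms; it is only meaningful for f in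
   HomA M N, see hom_mapE. *)
Definition hom_map P M N (f : 'Hom(M, N)) : 'Hom(hom_mod P M, hom_mod P N) :=
  linfun (fun g : subvs_of (HomA P M) => vsproj (HomA P N) (f \o vsval g)%VF).

Definition dual_mod M : fdmod (opp_alg A).
Proof.
refine (@FDMod k (opp_alg A) 'Hom(M, k^o)
  (fun (a : A) f => (f \o linfun (@mact k A M a))%VF) _ _ _ _).
- by move=> f; apply/lfunP=> x; rewrite comp_lfunE lfunE /= mact1.
- by move=> a b f; apply/lfunP=> x; rewrite !comp_lfunE !lfunE /= mactM.
- by move=> a c f g; rewrite comp_lfunDl -comp_lfunZl.
- move=> f c a b; apply/lfunP=> x; rewrite add_lfunE scale_lfunE !comp_lfunE.
  by rewrite !lfunE /= mact_linear_l linearP.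
Defined.

End Constructions.

Section Modules.
Variables (k : fieldType) (A : fdalg k).
Implicit Types M N X Q T : fdmod A.

Definition mod_iso M N : Prop := exists2 f, f \in HomA M N & bijective f.

Definition is_zero_mod M : Prop := forall x : M, x = 0.

Definition short_exact X M N (f : 'Hom(X, M)) (g : 'Hom(M, N)) : Prop :=
  [/\ f \in HomA X M, g \in HomA M N, lker f = 0%VS, limg f = lker g
    & limg g = fullv].

Definition in_add Q M : Prop :=
  exists n (i : 'Hom(M, pow_mod Q n)) (p : 'Hom(pow_mod Q n, M)),
    [/\ i \in HomA M (pow_mod Q n), p \in HomA (pow_mod Q n) M
      & (p \o i)%VF = \1%VF].

Definition projective M : Prop := in_add (reg_mod A) M.

Definition progenerator X : Prop :=
  projective X /\
  forall M, exists n, exists2 p, p \in HomA (pow_mod X n) M & limg p = fullv.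

Inductive filtered (Theta : fdmod A -> Prop) : fdmod A -> Prop :=
| filtered_zero M : is_zero_mod M -> filtered Theta M
| filtered_step M' M X (f : 'Hom(M', M)) (g : 'Hom(M, X)) :
    filtered Theta M' -> Theta X -> short_exact f g -> filtered Theta M.

(* Up to isomorphism, the modules S(l) (x) U with P l and U a finite-dimensional
   vector space: S(l) (x) k^n is the direct sum of n copies of S(l). *)
Definition tensor_class (I : Type) (S : I -> fdmod A) (P : I -> bool) :
    fdmod A -> Prop :=
  fun X => exists l n, P l /\ mod_iso X (pow_mod (S l) n).

(* F(Delta~), for the family S = Delta *)
Definition filt_class (I : Type) (S : I -> fdmod A) : fdmod A -> Prop :=
  filtered (tensor_class S xpredT).

(* The sequence X, Y_0, Y_1, ... *)
Definition augment X (Y : nat -> fdmod A) (i : nat) : fdmod A :=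
  if i is j.+1 then Y j else X.

(* ... -> Y_1 -> Y_0 -> X, with ch_map 0 : Y_0 -> X *)
Record chain X := Chain {
  ch_obj : nat -> fdmod A;
  ch_map : forall i, 'Hom(augment X ch_obj i.+1, augment X ch_obj i);
  ch_mapP : forall i, ch_map i \in HomA _ _
}.

(* X -> Y_0 -> Y_1 -> ..., with co_map 0 : X -> Y_0 *)
Record cochain X := Cochain {
  co_obj : nat -> fdmod A;
  co_map : forall i, 'Hom(augment X co_obj i, augment X co_obj i.+1);
  co_mapP : forall i, co_map i \in HomA _ _
}.

End Modules.

(* Exactness of V_n -> ... -> V_1 -> V_0 -> 0 *)
Definition exact_upto (k : fieldType) (V : nat -> vectType k)
    (d : forall i, 'Hom(V i.+1, V i)) (n : nat) : Prop :=
  ((0 < n)%N -> limg (d 0) = fullv) /\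
  forall i, (i.+1 < n)%N -> limg (d i.+1) = lker (d i).

Section Homological.
Variables (k : fieldType) (A : fdalg k).
Implicit Types M N X Q T P : fdmod A.

Definition proj_resolution M (c : chain M) : Prop :=
  (forall i, projective (ch_obj c i)) /\ forall n, exact_upto (ch_map c) n.

(* Ext^j_A(M, N) is the j-th cohomology of Hom_A(-, N) on a projective
   resolution of M; cocycle and coboundary describe its degree j part. *)
Definition cocycle M (c : chain M) N j (f : 'Hom(ch_obj c j, N)) : Prop :=
  f \in HomA (ch_obj c j) N /\ (f \o ch_map c j.+1)%VF = 0.

Definition coboundary M (c : chain M) N j : 'Hom(ch_obj c j, N) -> Prop :=
  match j return 'Hom(ch_obj c j, N) -> Prop with
  | 0 => fun f => f = 0
  | i.+1 => fun f => exists2 g, g \in HomA (ch_obj c i) N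
                              & f = (g \o ch_map c i.+1)%VF
  end.

Definition ext_zero j M N : Prop :=
  forall c : chain M, proj_resolution c ->
  forall f : 'Hom(ch_obj c j, N), cocycle f -> coboundary f.

End Homological.

Section RelativeHomological.
Variables (k : fieldType) (A : fdalg k).
Implicit Types M N X Q T P : fdmod A.

(* A comparison map from d to Hom_A(P, c) over the identity of Hom_A(P, M) *)
Definition comparison P M (c : chain M) (d : chain (hom_mod P M))
    (phi : forall i, 'Hom(ch_obj d i, hom_mod P (ch_obj c i))) : Prop :=
  [/\ forall i, phi i \in HomA (ch_obj d i) (hom_mod P (ch_obj c i)),
      (hom_map P (ch_map c 0) \o phi 0)%VF = ch_map d 0
    & forall i, (hom_map P (ch_map c i.+1) \o phi i.+1)%VF
                = (phi i \o ch_map d i.+1)%VF].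

(* For P projective, F = Hom_A(P, -) is exact and E = End_A(P)^op, so that for
   projective resolutions c of M and d of F M, and a comparison map phi, the map
   Ext^j_A(M, N) -> Ext^j_E(F M, F N) induced by F is [f] |-> [F f \o phi_j].
   ext_bij states that it is injective and surjective. *)
Definition ext_bij P j M N : Prop :=
  forall (c : chain M) (d : chain (hom_mod P M))
         (phi : forall i, 'Hom(ch_obj d i, hom_mod P (ch_obj c i))),
  proj_resolution c -> proj_resolution d -> comparison phi ->
  let F_ext (f : 'Hom(ch_obj c j, N)) : 'Hom(ch_obj d j, hom_mod P N) :=
    (hom_map P f \o phi j)%VF in
  (forall f, cocycle f -> coboundary (F_ext f) -> coboundary f) /\
  (forall g, cocycle g -> exists2 f, cocycle f & coboundary (g - F_ext f)).

Definition hom_bij P M N : Prop :=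
  forall h, h \in HomA (hom_mod P M) (hom_mod P N) ->
  exists! f, f \in HomA M N /\ hom_map P f = h.

(* E is only required to be isomorphic to End_A(P)^op, so that modules over
   E are the same as modules over End_A(P)^op. *)
Definition is_cover P (E : fdalg k) : Prop :=
  [/\ projective P, alg_iso E (opp_alg (end_alg P))
    & forall M N, projective M -> projective N -> hom_bij P M N].

Definition is_ext_cover (i : nat) (C : fdmod A -> Prop) P : Prop :=
  forall j M N, (j <= i)%N -> C M -> C N -> ext_bij P j M N.

Definition finite_projdim M : Prop :=
  exists2 c : chain M, proj_resolution c
    & exists n, forall i, (n <= i)%N -> is_zero_mod (ch_obj c i).

Definition has_finite_add_coresolution T X : Prop :=
  exists c : cochain X,
    [/\ forall i, in_add T (co_obj c i),
        exists n, forall i, (n <= i)%N -> is_zero_mod (co_obj c i),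
        lker (co_map c 0) = 0%VS
      & forall i, limg (co_map c i) = lker (co_map c i.+1)].

Definition tilting T : Prop :=
  [/\ finite_projdim T, forall i, (0 < i)%N -> ext_zero i T T
    & has_finite_add_coresolution T (reg_mod A)].

(* There is an exact sequence Q_n -> ... -> Q_1 -> X -> 0, with Q_i in add Q,
   that remains exact under Hom_A(Q, -); void for n = 0. *)
Definition has_add_presentation Q X (n : nat) : Prop :=
  exists c : chain X,
    [/\ forall i, (i < n)%N -> in_add Q (ch_obj c i),
        exact_upto (ch_map c) n
      & exact_upto (fun i => hom_map Q (ch_map c i)) n].

(* Q-codomdim X is the supremum of the m with has_add_presentation Q X m; when
   some Q_i is zero, continuing with zero modules makes it infinite. *)
Definition codomdim_ge Q X (n : nat) : Prop :=
  exists2 m, (n <= m)%N & has_add_presentation Q X m.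

Definition split_quasi_hereditary (d : Order.disp_t) (L : finPOrderType d)
    (Delta : L -> fdmod A) : Prop :=
  [/\ forall l m, HomA (Delta l) (Delta m) != 0%VS -> (l <= m)%O,
      forall l, alg_iso (end_alg (Delta l)) (ground_alg k)
    & exists Pr : L -> fdmod A,
      [/\ forall l, projective (Pr l),
          forall l, exists (C : fdmod A) (f : 'Hom(C, Pr l))
                           (g : 'Hom(Pr l, Delta l)),
            short_exact f g /\
            filtered (tensor_class Delta (fun m => (l < m)%O)) C
        & progenerator (bigsum_mod [seq Pr l | l <- enum L])]].

End RelativeHomological.

Section Tilting.
Variables (k : fieldType) (A : fdalg k).
Variables (d : Order.disp_t) (L : finPOrderType d).
Variables Delta Nabla : L -> fdmod A.

Definition costandard : Prop :=
  [/\ split_quasi_hereditary (fun l => dual_mod (Nabla l)),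
      forall X, filt_class Nabla X <->
        (forall M, filt_class Delta M -> ext_zero 1 M X),
      forall l, \dim (HomA (Delta l) (Nabla l)) = 1%N
    & forall l m, m != l -> HomA (Delta m) (Nabla l) = 0%VS].

Definition characteristic_tilting (T : fdmod A) : Prop :=
  tilting T /\
  forall X, in_add T X <-> filt_class Delta X /\ filt_class Nabla X.

End Tilting.

(* (C, P) is an i-F(Delta~) split quasi-hereditary cover of E. *)
Definition split_qh_ext_cover (k : fieldType) (C : fdalg k) (d : Order.disp_t)
    (L : finPOrderType d) (Delta : L -> fdmod C) (i : nat) (P : fdmod C)
    (E : fdalg k) : Prop :=
  [/\ split_quasi_hereditary Delta, is_cover P E
    & is_ext_cover i (filt_class Delta) P].

Definition ringel_dual (k : fieldType) (A : fdalg k) (T : fdmod A) : fdalg k :=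
  opp_alg (end_alg T).

(* Projective resolutions and comparison maps exist, so the quantifications over
   them in ext_zero and ext_bij are not vacuous. *)

Lemma linfun_linearE (k : fieldType) (U V : vectType k) (g : U -> V) :
  linear g -> linfun g =1 g.
Proof.
move=> lg x; pose G : {linear U -> V} := HB.pack g
  (GRing.isSemilinear.Build k U V *:%R g (GRing.semilinear_linear lg)).
exact: (lfunE G x).
Qed.

Section Resolutions.
Variables (k : fieldType) (A : fdalg k).
Implicit Types M N X Q T P : fdmod A.

Fact ker_mod_stable M N (f : 'Hom(M, N)) (a : A) (x : subvs_of (lker f)) :
  f \in HomA M N -> mact a (vsval x) \in lker f.
Proof.
have /eqP fx : f (vsval x) == 0 by rewrite -memv_ker subvsP.
by move=> /mem_HomA fA; rewrite memv_ker fA fx linear0.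
Qed.

Definition ker_mod M N (f : 'Hom(M, N)) (fA : f \in HomA M N) : fdmod A.
Proof.
refine (@FDMod k A (subvs_of (lker f))
  (fun a x => vsproj _ (mact a (vsval x))) _ _ _ _).
- by move=> x; rewrite mact1 vsvalK.
- by move=> a b x; rewrite mactM vsprojK ?ker_mod_stable.
- by move=> a c x y; rewrite !linearP.
- by move=> x c a b; rewrite mact_linear_l linearP.
Defined.

Lemma ker_mod_incl M N (f : 'Hom(M, N)) (fA : f \in HomA M N) :
  exists2 i : 'Hom(ker_mod fA, M), i \in HomA _ M
    & lker i = 0%VS /\ limg i = lker f.
Proof.
pose i : 'Hom(ker_mod fA, M) := linfun (fun x : ker_mod fA => vsval x : M).
have iE x : i x = vsval x by apply: linfun_linearE => c y z; rewrite linearP.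
exists i; first apply/mem_HomA => a x.
  rewrite !iE /= vsprojK // memv_ker ((mem_HomA f).1 fA).
  have /eqP -> : f (vsval x) == 0 by rewrite -memv_ker subvsP.
  by rewrite linear0.
split.
  by apply/eqP/lker0P => x y; rewrite !iE => /subvs_inj.
apply/vspaceP => x; apply/memv_imgP/idP => [[y _ ->]|xf].
  by rewrite iE subvsP.
by exists (vsproj _ x); rewrite ?memvf // iE vsprojK.
Qed.

Lemma projective_lift P M N (g : 'Hom(M, N)) (f : 'Hom(P, N)) :
  projective P -> g \in HomA M N -> f \in HomA P N -> (limg f <= limg g)%VS ->
  exists2 h, h \in HomA P M & (g \o h)%VF = f.
Proof.
case=> n [i [p [iA pA pi]]] gA fA fg.
suff [h hA hE] : exists2 h, h \in HomA (pow_mod (reg_mod A) n) M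
    & (g \o h)%VF = (f \o p)%VF.
  exists (h \o i)%VF; first exact: HomA_comp iA.
  by rewrite comp_lfunA hE -comp_lfunA pi comp_lfun1r.
have: (limg (f \o p) <= limg g)%VS.
  by rewrite limg_comp (subv_trans _ fg) // limgS ?subvf.
have: (f \o p)%VF \in HomA (pow_mod (reg_mod A) n) N by apply: HomA_comp pA.
move: (f \o p)%VF; elim: n {i p iA pA pi} => [|n IHn] u uA ug.
  exists 0; first exact: mem0v.
  apply/lfunP=> x; have -> : x = 0 by apply/rowP=> -[].
  by rewrite !linear0.
have inlL : linear (fun a : reg_mod A => (a, 0) : pow_mod (reg_mod A) n.+1).
  by move=> c a b; congr pair; rewrite /= ?scaler0 ?addr0.
have inrL : linear (fun y : pow_mod (reg_mod A) n =>
    (0, y) : pow_mod (reg_mod A) n.+1).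
  by move=> c a b; congr pair; rewrite /= ?scaler0 ?addr0.
have [h hA hE] : exists2 h, h \in HomA (pow_mod (reg_mod A) n) M
    & (g \o h)%VF = (u \o linfun (fun y : pow_mod (reg_mod A) n =>
    (0, y) : pow_mod (reg_mod A) n.+1))%VF.
  apply: IHn; last by rewrite limg_comp (subv_trans _ ug) // limgS ?subvf.
  apply: HomA_comp uA _; apply/mem_HomA => a y.
  by rewrite !(linfun_linearE inrL); congr pair; rewrite linear0.
have /memv_imgP[x _ ux] : u (aone A, 0) \in limg g.
  by apply: (subvP ug); rewrite memv_img ?memvf.
have wL : linear (fun z : pow_mod (reg_mod A) n.+1 => mact z.1 x + h z.2).
  move=> c z z'; rewrite /= mact_linear_l linearP scalerDr.
  by rewrite addrACA.
exists (linfun (fun z : pow_mod (reg_mod A) n.+1 => mact z.1 x + h z.2)).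
  apply/mem_HomA => a [b y]; rewrite !(linfun_linearE wL) /= mactM.
  by rewrite ((mem_HomA h).1 hA) linearD.
apply/lfunP => -[a y]; rewrite comp_lfunE (linfun_linearE wL) /=.
have -> : u (a, y) = mact a (u (aone A, 0)) + u (0, y).
  rewrite -((mem_HomA u).1 uA) -linearD; congr (u _).
  by congr pair; rewrite /= ?amul1r ?linear0 ?addr0 ?add0r.
have /lfunP/(_ y) := hE; rewrite !comp_lfunE (linfun_linearE inrL) => <-.
by rewrite linearD /= ((mem_HomA g).1 gA) ux.
Qed.

Lemma projective_pow n : projective (pow_mod (reg_mod A) n).
Proof.
by exists n, \1%VF, \1%VF; split; rewrite ?HomA1 // comp_lfun1l.
Qed.

Lemma free_cover M :
  exists2 p : 'Hom(pow_mod (reg_mod A) (size (vbasis (fullv : {vspace M}))), M),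
    p \in HomA _ M & limg p = fullv.
Proof.
suff /(_ (vbasis (fullv : {vspace M})))[p pA ps] : forall s : seq M,
    exists2 p, p \in HomA (pow_mod (reg_mod A) (size s)) M
             & {subset s <= limg p}.
  exists p => //; apply/eqP.
  rewrite eqEsubv subvf /= -{1}(span_basis (vbasisP fullv)); exact/span_subvP.
elim=> [|x s [p pA ps]]; first by exists 0; rewrite ?mem0v.
have wL : linear (fun z : pow_mod (reg_mod A) (size s).+1 => mact z.1 x + p z.2).
  by move=> c z z'; rewrite /= mact_linear_l linearP scalerDr addrACA.
exists (linfun (fun z : pow_mod (reg_mod A) (size s).+1 => mact z.1 x + p z.2)).
  apply/mem_HomA => a [b y]; rewrite !(linfun_linearE wL) /= mactM.
  by rewrite ((mem_HomA p).1 pA) linearD.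
move=> y; rewrite inE => /predU1P[->|/ps/memv_imgP[z _ ->]]; apply/memv_imgP.
  by exists (aone A, 0); rewrite ?memvf // (linfun_linearE wL) /= mact1 linear0 addr0.
exists (0, z); rewrite ?memvf // (linfun_linearE wL) /=.
by rewrite -[mact 0 x]/(orbit_map x 0) linear0 add0r.
Qed.

Lemma has_proj_resolution M : exists c : chain M, proj_resolution c.
Proof.
have sigE X : {Y : fdmod A & {p : 'Hom(Y, X) | p \in HomA Y X &
    projective Y /\ limg p = fullv}}.
  pose Y := pow_mod (reg_mod A) (size (vbasis (fullv : {vspace X}))).
  have /sigW[p /andP[pA /eqP ps]] : exists p : 'Hom(Y, X),
      (p \in HomA Y X) && (limg p == fullv).
    by have [p pA ps] := free_cover X; exists p; rewrite pA ps eqxx.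
  exists Y.
  by exists p => //; split => //; apply: projective_pow.
pose cov X := tag (sigE X).
pose cmap X : 'Hom(cov X, X) := s2val (tagged (sigE X)).
have cmapA X : cmap X \in HomA _ _ by rewrite /cmap; case: (tagged _).
pose syz X := ker_mod (cmapA X).
have sigI X : {i : 'Hom(syz X, cov X) | i \in HomA (syz X) (cov X) &
    lker i = 0%VS /\ limg i = lker (cmap X)}.
  have /sigW[i /and3P[iA /eqP ik /eqP im]] :
      exists i : 'Hom(syz X, cov X), [&& i \in HomA (syz X) (cov X), lker i == 0%VS
        & limg i == lker (cmap X)].
    by have [i iA [ik im]] := ker_mod_incl (cmapA X); exists i; rewrite iA ik im !eqxx.
  by exists i.
pose S i := iter i syz M.
pose Y i := cov (S i).
pose d i : 'Hom(augment M Y i.+1, augment M Y i) :=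
  match i return 'Hom(augment M Y i.+1, augment M Y i) with
  | 0 => cmap M
  | j.+1 => (s2val (sigI (S j)) \o cmap (S j.+1))%VF
  end.
have dA i : d i \in HomA _ _.
  by case: i => [|i]; [apply: cmapA | apply: HomA_comp (cmapA _); case: (sigI _)].
have cims X : limg (cmap X) = fullv by rewrite /cmap; case: (tagged _) => ? ? [].
exists (Chain dA); split=> [i|n] /=.
  by rewrite /Y /cov; case: (sigE _) => ? [? ? []].
have lk i : limg (s2val (sigI (S i))) = lker (cmap (S i)) by case: (sigI _) => ? ? [].
have ik i : lker (s2val (sigI (S i))) = 0%VS by case: (sigI _) => ? ? [].
split=> [_|i _]; first exact: cims.
rewrite [LHS]limg_comp cims lk; case: i => [//|i].
apply/vspaceP => x; rewrite !memv_ker /= comp_lfunE -[RHS]memv_ker ik memv0.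
by [].
Qed.

End Resolutions.

Section Comparison.
Variables (k : fieldType) (A : fdalg k).
Implicit Types M N P X : fdmod A.

Lemma hom_mapE P M N (f : 'Hom(M, N)) (g : hom_mod P M) :
  f \in HomA M N -> vsval (hom_map P f g) = (f \o vsval g)%VF.
Proof.
move=> fA; rewrite (linfun_linearE (@hom_comp_linear_r _ _ P M N f)).
by rewrite vsprojK // HomA_comp ?subvsP.
Qed.

Lemma hom_mapP P M N (f : 'Hom(M, N)) :
  f \in HomA M N -> hom_map P f \in HomA (hom_mod P M) (hom_mod P N).
Proof.
move=> fA; apply/mem_HomA => e g; apply: subvs_inj.
by rewrite hom_mapE // !hom_compE hom_mapE // comp_lfunA.
Qed.

Lemma hom_map_exact P X M N (f : 'Hom(X, M)) (g : 'Hom(M, N)) :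
  projective P -> f \in HomA X M -> g \in HomA M N ->
  (lker g <= limg f)%VS -> (lker (hom_map P g) <= limg (hom_map P f))%VS.
Proof.
move=> Pproj fA gA gf; apply/subvP => u; rewrite memv_ker => /eqP gu0.
have gu : (g \o vsval u)%VF = 0 by rewrite -hom_mapE // gu0.
have [|h hA hE] := projective_lift Pproj fA (subvsP u).
  apply/subvP => _ /memv_imgP[x _ ->]; apply: (subvP gf).
  by rewrite memv_ker -comp_lfunE gu lfunE.
apply/memv_imgP; exists (vsproj _ h); rewrite ?memvf //.
by apply: subvs_inj; rewrite hom_mapE // vsprojK.
Qed.

Lemma hom_map_surj P M N (g : 'Hom(M, N)) :
  projective P -> g \in HomA M N -> limg g = fullv ->
  limg (hom_map P g) = fullv.
Proof.
move=> Pproj gA gs; apply/eqP; rewrite eqEsubv subvf; apply/subvP => u _.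
have [|h hA hE] := projective_lift Pproj gA (subvsP u); first by rewrite gs subvf.
apply/memv_imgP; exists (vsproj _ h); rewrite ?memvf //.
by apply: subvs_inj; rewrite hom_mapE // vsprojK.
Qed.

Lemma has_comparison P M (c : chain M) (d : chain (hom_mod P M)) :
  projective P -> proj_resolution c -> proj_resolution d ->
  exists phi : forall i, 'Hom(ch_obj d i, hom_mod P (ch_obj c i)),
    comparison phi.
Proof.
move=> Pproj [cproj cex] [dproj dex].
pose C := augment M (ch_obj c); pose D := augment (hom_mod P M) (ch_obj d).
pose inv i : 'Hom(D i, hom_mod P (C i)) -> bool :=
  match i return 'Hom(D i, hom_mod P (C i)) -> bool with
  | 0 => fun u => u \in HomA _ _
  | j.+1 => fun u => (u \in HomA _ _) &&
      ((hom_map P (ch_map c j) \o u \o ch_map d j.+1)%VF == 0)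
  end.
have invA i u : inv i u -> u \in HomA _ _ by case: i u => [//|i] u /andP[].
have dd0 i : (ch_map d i \o ch_map d i.+1)%VF = 0.
  apply/lfunP=> x; rewrite comp_lfunE lfunE; apply/eqP.
  by rewrite -memv_ker -((dex i.+2).2 i (leqnn _)) memv_img ?memvf.
have step i (u : 'Hom(D i, hom_mod P (C i))) : inv i u ->
    {v : 'Hom(D i.+1, hom_mod P (C i.+1)) | inv i.+1 v
      & (hom_map P (ch_map c i) \o v)%VF = (u \o ch_map d i)%VF}.
  move=> iu; have uA := invA _ _ iu.
  have cA := ch_mapP c i; have dA := ch_mapP d i.
  have udA := HomA_comp uA dA.
  have : exists v, (v \in HomA (D i.+1) (hom_mod P (C i.+1))) &&
      ((hom_map P (ch_map c i) \o v)%VF == (u \o ch_map d i)%VF).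
    have [|v vA vE] := projective_lift (dproj i) (hom_mapP P cA) udA; last first.
      by exists v; rewrite vA vE eqxx.
    case: i u iu {uA cA dA udA} => [|i] u iu.
      by rewrite hom_map_surj ?subvf ?ch_mapP //; apply: (cex 1).1.
    have cx := (cex i.+2).2 i (leqnn _).
    apply: subv_trans (hom_map_exact Pproj (ch_mapP c i.+1) (ch_mapP c i) _).
      apply/subvP=> _ /memv_imgP[x _ ->]; case/andP: iu => _ /eqP/lfunP/(_ x) E.
      by rewrite memv_ker -comp_lfunE comp_lfunA E lfunE.
    by rewrite cx subvv.
  case/sigW=> v /andP[vA /eqP vE]; exists v => //=.
  by rewrite vA vE -comp_lfunA dd0 comp_lfun0r eqxx.
pose st := nat_rect (fun i => {u | inv i u}) (exist _ \1%VF (HomA1 _))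
  (fun i s => let t := step i (sval s) (svalP s) in exist _ (s2val t) (s2valP t)).
have stE i : (hom_map P (ch_map c i) \o sval (st i.+1))%VF =
    (sval (st i) \o ch_map d i)%VF := s2valP' (step i _ (svalP (st i))).
exists (fun i => sval (st i.+1)); split=> [i||i]; last exact: stE.
  exact: invA (svalP (st i.+1)).
by rewrite stE /= comp_lfun1l.
Qed.

End Comparison.

(* Main.v *)
(* Write H = Hom_A(T, -), R = R(A), E = End_A(Q)^op and F = Hom_R(HQ, -). As H
   is fully faithful on add T, a complex Q_n -> ... -> Q_1 -> T -> 0 with Q_i in
   add Q that is exact under Hom_A(Q, -) becomes under F H the beginning of a
   projective resolution of F(HT), and Hom_E(F H Q_i, F N) = Hom_R(H Q_i, N).
   For N = HX with X in F(Nabla~), the latter is Hom_A(Q_i, X); if the complex is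
   exact, then so is Hom_A(Q_., X), because Ext^j_A(M, X) = 0 for j > 0 and M in
   F(Delta~). Exactness of Hom_R(H Q_., N) then passes to extensions, hence to
   all N in F(Delta~_R), and says that Hom_R(HT, N) = Hom_E(F(HT), F N) and
   Ext^j_E(F(HT), F N) = 0 for 0 < j <= n - 2, which gives the cover property.
   Conversely, form the complex by taking add Q-approximations of T and of the
   successive kernels; the cover property for N = HX with X injective shows that
   Hom_A(-, X) makes it exact, so it is exact.

   That R is split quasi-hereditary rests on surjections from tilting modules
   onto Nabla(l) with kernel filtered by the Nabla(m), m < l. They are dual to
   universal extensions of D Nabla(l) by the D Nabla(m) over A^op. Their middle
   terms Y are tilting, since 0 -> X -> W -> Y -> 0 with W in F(Delta~) and X in
   F(Nabla~) splits. *)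
From HB Require Import structures.
From mathcomp Require Import all_boot all_order all_algebra.
Require Import Defs.

Set Implicit Arguments.
Unset Strict Implicit.
Unset Printing Implicit Defensive.

Import GRing.Theory.
Local Open Scope ring_scope.

(** * Modules, factorisations and cokernels *)

(** The obstacle is to handle Ext without derived functors: [ext_zero] and [ext_bij] quantify over
    all projective resolutions, whereas extensions must be built and degrees shifted. Ext^1(U, Y) is
    therefore measured by lifting maps along one fixed coresolution of Y, starting with the
    coinduced module Hom_k(A, Y), and higher Ext by iterating its cokernel; [acyclic_hom_exact] and
    [hom_exact_acyclic] translate between this and exactness of Hom complexes. The passage from HT
    to an arbitrary M in F(Delta~_R) uses a mapping cone: R lies in add HT, so F carries a
    projective resolution of M to a resolution of F M by modules that are acyclic for F N, and such
    a resolution computes Ext_E(F M, F N). The shift by 2 comes from the augmented indexing: degrees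
    0 and 1 of Hom_R(H Q_., N) account for Hom, degrees 2, ..., n - 1 for Ext^1, ..., Ext^{n-2}, and
    exactness at Q_n is not demanded. Indecomposable summands are never split off: belonging to an
    additive closure means that the identity factors through the class. *)

Section LinearMaps.
Variables (k : fieldType) (U V W : vectType k).
Implicit Types (f : 'Hom(U, V)) (g : 'Hom(V, W)).

Lemma lfun_appD f x y : f (x + y) = f x + f y.
Proof. exact: linearD. Qed.

Lemma lker_eq0P f : lker f = 0%VS <-> forall x, f x = 0 -> x = 0.
Proof.
split=> [f0 x fx|f0].
  by apply/eqP; rewrite -memv0 -f0 memv_ker fx.
by apply/eqP/lker0P => x y fxy; apply/subr0_eq/f0; rewrite linearB /= fxy subrr.
Qed.

Lemma limg_fullP f : limg f = fullv <-> forall y, exists x, f x = y.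
Proof.
split=> [ff y|fs].
  have /memv_imgP[x _ ->] : y \in limg f by rewrite ff memvf.
  by exists x.
apply/vspaceP => y; rewrite memvf; have [x <-] := fs y.
by rewrite memv_img ?memvf.
Qed.

Lemma comp_eq0P f g : (g \o f)%VF = 0 <-> forall x, g (f x) = 0.
Proof.
split=> [/lfunP gf x|gf]; first by move: (gf x); rewrite comp_lfunE lfunE.
by apply/lfunP => x; rewrite comp_lfunE gf lfunE.
Qed.

Lemma limg_lkerP f g :
  limg f = lker g <->
  (g \o f)%VF = 0 /\ forall y, g y = 0 -> exists x, f x = y.
Proof.
split=> [fg|[/comp_eq0P gf fs]].
  split=> [|y gy].
    by apply/comp_eq0P=> x; apply/eqP; rewrite -memv_ker -fg memv_img ?memvf.
  have /memv_imgP[x _ ->] : y \in limg f by rewrite fg memv_ker gy.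
  by exists x.
apply/vspaceP => y; rewrite memv_ker; apply/idP/eqP => [/memv_imgP[x _ ->]//|].
by case/fs => x <-; rewrite memv_img ?memvf.
Qed.

End LinearMaps.

Section Morphisms.
Variables (k : fieldType) (A : fdalg k).
Implicit Types M N X Y : fdmod A.

Lemma HomA_act M N (f : 'Hom(M, N)) a x :
  f \in HomA M N -> f (mact a x) = mact a (f x).
Proof. by move=> /mem_HomA ->. Qed.

Lemma HomA_linfun M N (g : M -> N) :
  linear g -> (forall a x, g (mact a x) = mact a (g x)) ->
  linfun g \in HomA M N.
Proof. by move=> gL gA; apply/mem_HomA => a x; rewrite !linfun_linearE. Qed.

Lemma short_exactP X M N (f : 'Hom(X, M)) (g : 'Hom(M, N)) :
  short_exact f g <->
  [/\ f \in HomA X M, g \in HomA M N, forall x, f x = 0 -> x = 0,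
      (g \o f)%VF = 0 /\ (forall y, g y = 0 -> exists x, f x = y)
    & forall z, exists y, g y = z].
Proof.
by split=> -[fA gA f0 fg gs]; split=> //; try exact/lker_eq0P;
  try exact/limg_lkerP; try exact/limg_fullP.
Qed.

Lemma factor_surj M N X (g : 'Hom(M, N)) (f : 'Hom(M, X)) :
  g \in HomA M N -> f \in HomA M X -> (forall y, exists x, g x = y) ->
  (forall x, g x = 0 -> f x = 0) ->
  exists2 h, h \in HomA N X & (h \o g)%VF = f.
Proof.
(* [g^-1] is only a k-linear section of [g]; A-linearity of [h] follows from [hE], as [g] is
   onto. *)
move=> gA fA gs gf; pose h := (f \o g^-1)%VF.
have hE x : h (g x) = f x.
  rewrite comp_lfunE; apply/subr0_eq; rewrite -linearB; apply: gf.
  by rewrite linearB /= limg_lfunVK ?subrr // memv_img ?memvf.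
exists h; last by apply/lfunP => x; rewrite comp_lfunE hE.
apply/mem_HomA => a y; have [x <-] := gs y.
by rewrite -HomA_act // !hE HomA_act.
Qed.

Lemma factor_inj M N X (g : 'Hom(M, N)) (f : 'Hom(X, N)) :
  g \in HomA M N -> f \in HomA X N -> (forall x, g x = 0 -> x = 0) ->
  (forall x, exists y, g y = f x) ->
  exists2 h, h \in HomA X M & (g \o h)%VF = f.
Proof.
move=> gA fA g0 fg; pose h := (g^-1 \o f)%VF.
have hE x : g (h x) = f x.
  rewrite comp_lfunE limg_lfunVK //; have [y <-] := fg x.
  by rewrite memv_img ?memvf.
exists h; last by apply/lfunP => x; rewrite comp_lfunE hE.
apply/mem_HomA => a x; apply/subr0_eq/g0.
by rewrite linearB /= (HomA_act _ _ gA) !hE (HomA_act _ _ fA) subrr.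
Qed.

Lemma factor_ker M N X Y (i : 'Hom(M, N)) (q : 'Hom(N, X)) (f : 'Hom(Y, N)) :
  short_exact i q -> f \in HomA Y N -> (q \o f)%VF = 0 ->
  exists2 h, h \in HomA Y M & (i \o h)%VF = f.
Proof.
move=> /short_exactP[iA _ i0 [_ iq] _] fA /comp_eq0P qf.
by apply: factor_inj => // x; apply: iq.
Qed.

Lemma factor_coker M N X Y (i : 'Hom(M, N)) (q : 'Hom(N, X)) (f : 'Hom(N, Y)) :
  short_exact i q -> f \in HomA N Y -> (f \o i)%VF = 0 ->
  exists2 h, h \in HomA X Y & (h \o q)%VF = f.
Proof.
move=> /short_exactP[_ qA _ [_ iq] qs] fA /comp_eq0P fi.
by apply: factor_surj => // x /iq[y <-].
Qed.

Lemma ker_ses M N (g : 'Hom(M, N)) :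
  g \in HomA M N -> (forall y, exists x, g x = y) ->
  exists (K : fdmod A) (i : 'Hom(K, M)), short_exact i g.
Proof.
move=> gA gs; have [i iA [i0 ig]] := ker_mod_incl gA.
by exists (ker_mod gA), i; split=> //; apply/limg_fullP.
Qed.

Section Cokernel.
Variables (M N : fdmod A) (f : 'Hom(M, N)) (fA : f \in HomA M N).

Let S := limg f.

(** The quotient of N by the image of [f] is modelled on a complement of the image: [coker_mod] lets
    A act on the representative in [S^C] and projects back. *)
Definition coker_map : N -> subvs_of (S^C)%VS :=
  fun x => vsproj (S^C)%VS (daddv_pi (S^C)%VS S x).

Lemma coker_map_linear : linear coker_map.
Proof. by move=> c x y; rewrite /coker_map !linearP. Qed.
HB.instance Definition _ := GRing.isSemilinear.Build k N (subvs_of (S^C)%VS) _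
  coker_map (GRing.semilinear_linear coker_map_linear).

Let SC0 : (S^C :&: S)%VS = 0%VS.
Proof. by rewrite capvC capv_compl. Qed.

Lemma coker_map_val x : vsval (coker_map x) = daddv_pi (S^C)%VS S x.
Proof. by rewrite vsprojK // memv_pi. Qed.

Lemma coker_mapK (x : subvs_of (S^C)%VS) : coker_map (vsval x) = x.
Proof.
by apply: subvs_inj; rewrite coker_map_val daddv_pi_id // subvsP.
Qed.

Lemma coker_map_ker x : (coker_map x == 0) = (x \in S).
Proof.
have xE : x = daddv_pi (S^C)%VS S x + daddv_pi S (S^C)%VS x.
  by rewrite daddv_pi_add // addvC addv_complf memvf.
rewrite -(inj_eq subvs_inj) coker_map_val linear0; apply/eqP/idP => [x0|xS].
  by rewrite xE x0 add0r memv_pi.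
apply: (addIr (daddv_pi S (S^C)%VS x)); rewrite -xE add0r.
by rewrite daddv_pi_id // capv_compl.
Qed.

Lemma coker_map_act a x :
  coker_map (mact a (vsval (coker_map x))) = coker_map (mact a x).
Proof.
apply/subr0_eq/eqP; rewrite -linearB /= coker_map_ker -linearB.
have : vsval (coker_map x) - x \in S.
  by rewrite -coker_map_ker linearB /= coker_mapK subrr.
case/memv_imgP=> y _ ->; by rewrite /= -(HomA_act _ _ fA) memv_img ?memvf.
Qed.

Definition coker_mod : fdmod A.
Proof.
refine (@FDMod k A (subvs_of (S^C)%VS)
  (fun a x => coker_map (mact a (vsval x))) _ _ _ _).
- by move=> x; rewrite mact1 coker_mapK.
- by move=> a b x; rewrite mactM coker_map_act.
- by move=> a c x y; rewrite !linearP.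
- by move=> x c a b; rewrite mact_linear_l linearP.
Defined.

Definition coker_proj : 'Hom(N, coker_mod) := linfun (coker_map : N -> coker_mod).

Lemma coker_projE x : coker_proj x = coker_map x.
Proof. exact: linfun_linearE coker_map_linear x. Qed.

Lemma coker_projP : coker_proj \in HomA N coker_mod.
Proof.
by apply: HomA_linfun => [|a x]; [apply: coker_map_linear|rewrite /= coker_map_act].
Qed.

Lemma coker_proj_surj y : exists x, coker_proj x = y.
Proof. by exists (vsval y); rewrite coker_projE coker_mapK. Qed.

Lemma coker_proj_ker x : coker_proj x = 0 -> exists y, f y = x.
Proof.
rewrite coker_projE => /eqP; rewrite coker_map_ker => /memv_imgP[y _ ->].
by exists y.
Qed.

Lemma coker_proj_comp : (coker_proj \o f)%VF = 0.
Proof.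
apply/comp_eq0P => x; rewrite coker_projE; apply/eqP.
by rewrite coker_map_ker memv_img ?memvf.
Qed.

End Cokernel.

Lemma coker_ses M N (f : 'Hom(M, N)) (fA : f \in HomA M N) :
  (forall x, f x = 0 -> x = 0) -> short_exact f (coker_proj fA).
Proof.
move=> f0; apply/short_exactP; split=> //; first exact: coker_projP.
  by split; [apply: coker_proj_comp | apply: coker_proj_ker].
exact: coker_proj_surj.
Qed.

End Morphisms.

(** * Direct sums and additive closures *)

Section Biproducts.
Variables (k : fieldType) (A : fdalg k).
Implicit Types M N X Y Q I Z : fdmod A.

Lemma HomA0 M N : 0 \in HomA M N. Proof. exact: mem0v. Qed.

Fact sum_inl_linear M N : linear (fun x : M => (x, 0) : sum_mod M N).
Proof. by move=> c x y; congr pair; rewrite /= ?scaler0 ?addr0 ?add0r. Qed.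
Fact sum_inr_linear M N : linear (fun y : N => (0, y) : sum_mod M N).
Proof. by move=> c x y; congr pair; rewrite /= ?scaler0 ?addr0 ?add0r. Qed.
Fact sum_fst_linear M N : linear (fun z : sum_mod M N => z.1).
Proof. by []. Qed.
Fact sum_snd_linear M N : linear (fun z : sum_mod M N => z.2).
Proof. by []. Qed.

Definition sum_inl M N : 'Hom(M, sum_mod M N) :=
  linfun (fun x : M => (x, 0) : sum_mod M N).
Definition sum_inr M N : 'Hom(N, sum_mod M N) :=
  linfun (fun y : N => (0, y) : sum_mod M N).
Definition sum_fst M N : 'Hom(sum_mod M N, M) :=
  linfun (fun z : sum_mod M N => z.1).
Definition sum_snd M N : 'Hom(sum_mod M N, N) :=
  linfun (fun z : sum_mod M N => z.2).

Lemma sum_inlE M N x : sum_inl M N x = (x, 0).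
Proof. exact: (linfun_linearE (@sum_inl_linear M N)). Qed.
Lemma sum_inrE M N x : sum_inr M N x = (0, x).
Proof. exact: (linfun_linearE (@sum_inr_linear M N)). Qed.
Lemma sum_fstE M N z : sum_fst M N z = z.1.
Proof. exact: (linfun_linearE (@sum_fst_linear M N)). Qed.
Lemma sum_sndE M N z : sum_snd M N z = z.2.
Proof. exact: (linfun_linearE (@sum_snd_linear M N)). Qed.

Lemma sum_inlP M N : sum_inl M N \in HomA M (sum_mod M N).
Proof.
by apply/mem_HomA => a x; rewrite !sum_inlE; congr pair; rewrite linear0.
Qed.
Lemma sum_inrP M N : sum_inr M N \in HomA N (sum_mod M N).
Proof.
by apply/mem_HomA => a x; rewrite !sum_inrE; congr pair; rewrite linear0.
Qed.
Lemma sum_fstP M N : sum_fst M N \in HomA (sum_mod M N) M.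
Proof. by apply/mem_HomA => a x; rewrite !sum_fstE. Qed.
Lemma sum_sndP M N : sum_snd M N \in HomA (sum_mod M N) N.
Proof. by apply/mem_HomA => a x; rewrite !sum_sndE. Qed.

Lemma sum_decomp M N :
  ((sum_inl M N \o sum_fst M N) + (sum_inr M N \o sum_snd M N))%VF = \1%VF.
Proof.
apply/lfunP => -[x y]; rewrite add_lfunE !comp_lfunE sum_inlE sum_inrE.
by rewrite sum_fstE sum_sndE id_lfunE; congr pair; rewrite /= ?addr0 ?add0r.
Qed.

Lemma sum_ses M N : short_exact (sum_inl M N) (sum_snd M N).
Proof.
apply/short_exactP; split; [exact: sum_inlP | exact: sum_sndP | | | ].
- by move=> x; rewrite sum_inlE => -[].
- split; first by apply/comp_eq0P => x; rewrite sum_inlE sum_sndE.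
  by move=> [x y]; rewrite sum_sndE /= => ->; exists x; rewrite sum_inlE.
- by move=> y; exists (0, y); rewrite sum_sndE.
Qed.

Lemma sum_pair X M N (f : 'Hom(X, M)) (g : 'Hom(X, N)) :
  f \in HomA X M -> g \in HomA X N ->
  exists2 h, h \in HomA X (sum_mod M N) & forall x, h x = (f x, g x).
Proof.
move=> fA gA; exists ((sum_inl M N \o f) + (sum_inr M N \o g))%VF.
  by rewrite memvD ?HomA_comp ?sum_inlP ?sum_inrP.
move=> x; rewrite add_lfunE !comp_lfunE sum_inlE sum_inrE.
by congr pair; rewrite /= ?addr0 ?add0r.
Qed.

Lemma sum_copair X M N (f : 'Hom(M, X)) (g : 'Hom(N, X)) :
  f \in HomA M X -> g \in HomA N X ->
  exists2 h, h \in HomA (sum_mod M N) X & forall z, h z = f z.1 + g z.2.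
Proof.
move=> fA gA; exists ((f \o sum_fst M N) + (g \o sum_snd M N))%VF.
  by rewrite memvD ?HomA_comp ?sum_fstP ?sum_sndP.
by move=> z; rewrite add_lfunE !comp_lfunE sum_fstE sum_sndE.
Qed.

(* The maps which factor through finite direct sums of objects of S; thus M lies
   in add S when its identity does, see in_addP. *)
Inductive factors (S : fdmod A -> Prop) M N : 'Hom(M, N) -> Prop :=
| factors0 : factors S (0 : 'Hom(M, N))
| factorsD Y (i : 'Hom(M, Y)) (p : 'Hom(Y, N)) f :
    S Y -> i \in HomA M Y -> p \in HomA Y N -> factors S f ->
    factors S ((p \o i) + f)%VF.

Lemma factors_add S M N (f g : 'Hom(M, N)) :
  factors S f -> factors S g -> factors S (f + g).
Proof.
move=> Sf Sg; elim: Sf => [|Y i p f' SY iA pA _ IH]; first by rewrite add0r.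
by rewrite -addrA; apply: factorsD.
Qed.

Lemma factors_comp S M N X Y (f : 'Hom(M, N)) (g : 'Hom(N, X)) (h : 'Hom(Y, M)) :
  g \in HomA N X -> h \in HomA Y M ->
  factors S f -> factors S (g \o f \o h)%VF.
Proof.
move=> gA hA; elim=> [|Z i p f' SZ iA pA _ IH].
  by rewrite comp_lfun0r comp_lfun0l; apply: factors0.
rewrite comp_lfunDr comp_lfunDl -!comp_lfunA comp_lfunA.
by apply: factorsD; rewrite ?HomA_comp // comp_lfunA.
Qed.

Lemma factors_trans S S' M N (f : 'Hom(M, N)) :
  (forall Y, S Y -> factors S' (\1%VF : 'Hom(Y, Y))) ->
  factors S f -> factors S' f.
Proof.
move=> SS; elim=> [|Y i p f' SY iA pA _ IH]; first exact: factors0.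
apply: factors_add IH; rewrite -[p]comp_lfun1r.
by apply: factors_comp => //; apply: SS.
Qed.

Lemma factors_id S M : S M -> factors S (\1%VF : 'Hom(M, M)).
Proof.
move=> SM; rewrite -[\1%VF]addr0 -[X in X + 0]comp_lfun1l.
by apply: factorsD => //; rewrite ?HomA1 //; apply: factors0.
Qed.

Lemma factors_retract S M N (i : 'Hom(M, N)) (p : 'Hom(N, M)) :
  S N -> i \in HomA M N -> p \in HomA N M -> (p \o i)%VF = \1%VF ->
  factors S (\1%VF : 'Hom(M, M)).
Proof.
by move=> SN iA pA pi; rewrite -[\1%VF]addr0 -pi; apply: factorsD => //; apply: factors0.
Qed.

(** In the factorisation form, transitivity and closure under sums reduce to composing and adding
    maps, with no bookkeeping of powers. *)
Lemma in_addP Q M : in_add Q M <-> factors (eq Q) (\1%VF : 'Hom(M, M)).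
Proof.
split=> [[n [i [p [iA pA <-]]]]|].
  rewrite -[p]comp_lfun1r; apply: factors_comp => //.
  elim: n {i p iA pA} => [|n IHn].
    rewrite -[\1%VF](_ : 0 = _); first exact: factors0.
    by apply/lfunP => x; apply/rowP => -[].
  rewrite -[pow_mod Q n.+1]/(sum_mod Q (pow_mod Q n)) -sum_decomp.
  apply: factorsD; rewrite ?sum_inlP ?sum_fstP //.
  rewrite -[sum_inr _ _]comp_lfun1r.
  by apply: factors_comp; rewrite ?sum_inrP ?sum_sndP.
suff {M} H M N (f : 'Hom(M, N)) : factors (eq Q) f ->
    exists n (i : 'Hom(M, pow_mod Q n)) (p : 'Hom(pow_mod Q n, N)),
    [/\ i \in HomA M (pow_mod Q n), p \in HomA (pow_mod Q n) N
      & (p \o i)%VF = f] by apply: H.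
elim=> [|Y i p f' QY]; last first.
  case: _ / QY i p => i p iA pA _ [n [i' [p' [iA' pA' <-]]]].
  have [u uA uE] := sum_pair iA iA'; have [v vA vE] := sum_copair pA pA'.
  exists n.+1, u, v; split=> //.
  by apply/lfunP => x; rewrite comp_lfunE vE uE add_lfunE !comp_lfunE.
by exists 0%N, 0, 0; rewrite !HomA0 comp_lfun0l.
Qed.

Lemma in_add_refl Q : in_add Q Q.
Proof. exact/in_addP/factors_id. Qed.

Lemma in_add_trans Q X M : in_add Q X -> in_add X M -> in_add Q M.
Proof.
move=> /in_addP QX /in_addP XM; apply/in_addP.
by apply: factors_trans XM => _ <-.
Qed.

Lemma in_add_pow Q n : in_add Q (pow_mod Q n).
Proof. by exists n, \1%VF, \1%VF; rewrite !HomA1 comp_lfun1l. Qed.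

Lemma in_add_sum Q M N : in_add Q M -> in_add Q N -> in_add Q (sum_mod M N).
Proof.
move=> /in_addP QM /in_addP QN; apply/in_addP; rewrite -sum_decomp.
apply: factors_add.
  rewrite -[sum_inl _ _]comp_lfun1r.
  by apply: factors_comp; rewrite ?sum_inlP ?sum_fstP.
rewrite -[sum_inr _ _]comp_lfun1r.
by apply: factors_comp; rewrite ?sum_inrP ?sum_sndP.
Qed.

Lemma is_zero_mod_id M : is_zero_mod M -> \1%VF = 0 :> 'Hom(M, M).
Proof. by move=> M0; apply/lfunP => x; rewrite (M0 x) linear0 lfunE. Qed.

Lemma is_zero_mod_hom M N (f : 'Hom(M, N)) :
  is_zero_mod M \/ is_zero_mod N -> f = 0.
Proof.
case=> Z0; apply/lfunP => x; first by rewrite (Z0 x) !linear0.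
by rewrite (Z0 (f x)) (Z0 (_ x)).
Qed.

Lemma zero_mod_zero : is_zero_mod (zero_mod A).
Proof. by move=> x; apply/rowP => -[]. Qed.

Lemma in_add_zero Q M : is_zero_mod M -> in_add Q M.
Proof.
move=> M0; apply/in_addP; rewrite is_zero_mod_id //; exact: factors0.
Qed.

Lemma in_add_iso Q M N (f : 'Hom(M, N)) (g : 'Hom(N, M)) :
  f \in HomA M N -> g \in HomA N M -> (f \o g)%VF = \1%VF ->
  in_add Q M -> in_add Q N.
Proof.
move=> fA gA fg QM; apply: in_add_trans QM _; apply/in_addP.
exact: (@factors_retract _ N M g f).
Qed.

Lemma mod_isoP M N : mod_iso M N <->
  exists (f : 'Hom(M, N)) (g : 'Hom(N, M)),
    [/\ f \in HomA M N, g \in HomA N M, (f \o g)%VF = \1%VF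
      & (g \o f)%VF = \1%VF].
Proof.
split=> [[f fA [g fK gK]]|[f [g [fA gA fg gf]]]]; last first.
  exists f => //; exists g => x.
    by rewrite -comp_lfunE gf id_lfunE.
  by rewrite -comp_lfunE fg id_lfunE.
have gL : linear g.
  by move=> c x y; apply: (can_inj fK); rewrite linearP /= !gK.
exists f, (linfun g); split=> //.
- by apply: HomA_linfun => // a x; apply: (can_inj fK); rewrite HomA_act // !gK.
- by apply/lfunP => x; rewrite comp_lfunE linfun_linearE // gK id_lfunE.
- by apply/lfunP => x; rewrite comp_lfunE linfun_linearE // fK id_lfunE.
Qed.

Lemma mod_iso_ses M N Z (f : 'Hom(M, N)) :
  f \in HomA M N -> bijective f -> is_zero_mod Z ->
  short_exact f (0 : 'Hom(N, Z)).
Proof.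
move=> fA [g fK gK] Z0; apply/short_exactP; split=> //; rewrite ?HomA0 //.
- by move=> x fx; rewrite -(fK x) -(fK 0) fx linear0.
- by split=> [|y _]; [rewrite comp_lfun0l | exists (g y); rewrite gK].
- by move=> z; exists 0; rewrite linear0 (Z0 z).
Qed.

Lemma mod_iso_sym M N : mod_iso M N -> mod_iso N M.
Proof.
move=> /mod_isoP[f [g [fA gA fg gf]]]; apply/mod_isoP.
by exists g, f.
Qed.

Lemma mod_iso_refl M : mod_iso M M.
Proof. by apply/mod_isoP; exists \1%VF, \1%VF; rewrite !HomA1 comp_lfun1l. Qed.

(** A basis of Hom_A(Q, X) assembles into one map from a power of Q; a linear combination of the
    basis then factors through it. *)
Lemma add_approximation Q X :
  exists p : 'Hom(pow_mod Q (size (vbasis (HomA Q X))), X),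
    p \in HomA _ X /\ forall u, u \in HomA Q X ->
    exists2 v, v \in HomA Q (pow_mod Q (size (vbasis (HomA Q X))))
             & (p \o v)%VF = u.
Proof.
suff H (s : seq 'Hom(Q, X)) : {subset s <= HomA Q X} ->
    exists p : 'Hom(pow_mod Q (size s), X), p \in HomA _ X /\
    forall u, u \in <<s>>%VS ->
    exists2 v, v \in HomA Q (pow_mod Q (size s)) & (p \o v)%VF = u.
  have [|p [pA pE]] := H (vbasis (HomA Q X)); first by move=> y; apply: vbasis_mem.
  exists p; split=> // u uA; apply: pE.
  by rewrite (span_basis (vbasisP _)).
elim: s => [_|x s IHs xs].
  exists 0; split=> [|u]; first exact: HomA0.
  rewrite span_nil memv0 => /eqP ->.
  by exists 0; rewrite ?HomA0 ?comp_lfun0l.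
have [|p [pA pE]] := IHs; first by move=> y ys; rewrite xs ?inE ?ys ?orbT.
have xA : x \in HomA Q X by rewrite xs ?inE ?eqxx.
have [h hA hE] := sum_copair xA pA.
exists h; split=> // u; rewrite span_cons => /memv_addP[_ /vlineP[c ->]].
move=> [w /pE[v vA <-] ->].
have [t tA tE] := sum_pair (memvZ c (HomA1 Q)) vA.
exists t => //; apply/lfunP => y.
rewrite comp_lfunE hE tE add_lfunE !scale_lfunE id_lfunE linearZ.
by rewrite comp_lfunE.
Qed.

(** K is the kernel of (q, -p) on the direct sum of I and X. The last clause, its universal
    property, is how maps into the pulled-back extension are produced. *)
Lemma pullback_ses M I N X (i : 'Hom(M, I)) (q : 'Hom(I, N)) (p : 'Hom(X, N)) :
  short_exact i q -> p \in HomA X N ->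
  exists (K : fdmod A) (j : 'Hom(M, K)) (b : 'Hom(K, X)) (a : 'Hom(K, I)),
    [/\ short_exact j b, a \in HomA K I, (q \o a)%VF = (p \o b)%VF,
        (a \o j)%VF = i
      & forall Y (u : 'Hom(Y, I)) (v : 'Hom(Y, X)), u \in HomA Y I ->
        v \in HomA Y X -> (q \o u)%VF = (p \o v)%VF ->
        exists w, [/\ w \in HomA Y K, (a \o w)%VF = u & (b \o w)%VF = v]].
Proof.
move=> /short_exactP[iA qA i0 [/comp_eq0P qi iq] qs] pA.
have npA : - p \in HomA X N by rewrite memvN.
have [d dA dE] := sum_copair qA npA.
have [e eA [/lker_eq0P e0 /limg_lkerP[/comp_eq0P de ed]]] := ker_mod_incl dA.
pose a := (sum_fst I X \o e)%VF; pose b := (sum_snd I X \o e)%VF.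
have aA : a \in HomA _ _ by rewrite HomA_comp ?sum_fstP.
have bA : b \in HomA _ _ by rewrite HomA_comp ?sum_sndP.
have aE z : a z = (e z).1 by rewrite comp_lfunE sum_fstE.
have bE z : b z = (e z).2 by rewrite comp_lfunE sum_sndE.
have ab z : q (a z) = p (b z).
  by have := de z; rewrite dE opp_lfunE aE bE => /subr0_eq.
have lift Y (u : 'Hom(Y, I)) (v : 'Hom(Y, X)) : u \in HomA Y I ->
    v \in HomA Y X -> (q \o u)%VF = (p \o v)%VF ->
    exists w, [/\ w \in HomA Y (ker_mod dA), (a \o w)%VF = u & (b \o w)%VF = v].
  move=> uA vA /lfunP uv; have [t tA tE] := sum_pair uA vA.
  have [|w wA wE] := factor_inj eA tA e0.
    move=> y; apply: ed; rewrite dE tE opp_lfunE /=.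
    by have := uv y; rewrite !comp_lfunE => ->; rewrite subrr.
  exists w; split=> //; apply/lfunP => y; rewrite comp_lfunE ?aE ?bE.
    by rewrite -[e _]comp_lfunE wE tE.
  by rewrite -[e _]comp_lfunE wE tE.
have [|j [jA aj bj]] := lift M i 0 iA (HomA0 _ _).
  by rewrite comp_lfun0r; apply/comp_eq0P.
exists (ker_mod dA), j, b, a; split=> //; last first.
  by apply/lfunP => z; rewrite comp_lfunE ab comp_lfunE.
apply/short_exactP; split=> //.
- by move=> x jx; apply: i0; rewrite -aj comp_lfunE jx linear0.
- split=> // z bz; have [|x ix] := iq (a z); first by rewrite ab bz linear0.
  have eE t : e t = (a t, b t) by rewrite aE bE; case: (e t).
  exists x; apply/subr0_eq/e0; rewrite linearB /= !eE.
  by move/comp_eq0P: bj => ->; rewrite bz -[a (j x)]comp_lfunE aj ix subrr.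
- move=> x; have [y qy] := qs (p x).
  have [|z ez] := ed (y, x); last by exists z; rewrite bE ez.
  by rewrite dE /= opp_lfunE qy subrr.
Qed.

End Biproducts.

(** * Coinduced modules and vanishing of Ext^1 *)

Section Coinduced.
Variables (k : fieldType) (A : fdalg k).
Implicit Types M N X Y U V B W Z I P : fdmod A.

Fact amul_linfun_l (a b : A) : linfun (@amul k A ^~ a : A -> A) b = amul b a.
Proof. exact: (linfun_linearE (@amul_linear_l k A a)). Qed.

(** Hom_k(A, V) with (a h)(b) = h(b a): coinduction, the right adjoint of the forgetful functor to
    vector spaces, so its values are injective. *)
Definition coind_mod (V : vectType k) : fdmod A.
Proof.
refine (@FDMod k A 'Hom(A, V)
  (fun a (h : 'Hom(A, V)) => (h \o linfun (@amul k A ^~ a : A -> A))%VF) _ _ _ _).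
- by move=> h; apply/lfunP => b; rewrite comp_lfunE amul_linfun_l amul1r.
- by move=> a c h; apply/lfunP => b; rewrite !comp_lfunE !amul_linfun_l amulA.
- by move=> a c h h'; rewrite comp_lfunDl -comp_lfunZl.
- move=> h c a a'; apply/lfunP => b.
  rewrite add_lfunE scale_lfunE !comp_lfunE !amul_linfun_l.
  by rewrite amul_linear_r linearP.
Defined.

Lemma coind_actE (V : vectType k) a (h : coind_mod V) (b : A) :
  (mact a h : 'Hom(A, V)) b = (h : 'Hom(A, V)) (amul b a).
Proof. by rewrite /= comp_lfunE amul_linfun_l. Qed.

Fact orbit_linfunE M (x : M) (a : A) : linfun (orbit_map x) a = mact a x.
Proof. exact: (linfun_linearE (@mact_linear_l k A M x)). Qed.

Lemma coind_transpose (V : vectType k) M (g : 'Hom(M, V)) :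
  exists2 h, h \in HomA M (coind_mod V)
    & forall x (b : A), (h x : 'Hom(A, V)) b = g (mact b x).
Proof.
pose h (x : M) : coind_mod V := (g \o linfun (orbit_map x))%VF.
have hE x (b : A) : (h x : 'Hom(A, V)) b = g (mact b x).
  by rewrite comp_lfunE orbit_linfunE.
have hL : linear h.
  move=> c x y; apply/lfunP => b.
  by rewrite hE add_lfunE scale_lfunE !hE mact_linear_r linearP.
exists (linfun h); last by move=> x b; rewrite (linfun_linearE hL).
apply: HomA_linfun => // a x; apply/lfunP => b.
by rewrite coind_actE !hE mactM.
Qed.

(** The map [e] need not be injective: asking only that ker e lie in ker f allows extension along a
    differential without forming its image. *)
Definition injective_mod I := forall X Y (e : 'Hom(X, Y)) (f : 'Hom(X, I)),
  e \in HomA X Y -> f \in HomA X I -> (forall x, e x = 0 -> f x = 0) ->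
  exists2 g, g \in HomA Y I & (g \o e)%VF = f.

Lemma injective_extend I X Y (e : 'Hom(X, Y)) (f : 'Hom(X, I)) :
  injective_mod I -> e \in HomA X Y -> f \in HomA X I ->
  (forall x, e x = 0 -> x = 0) ->
  exists2 g, g \in HomA Y I & (g \o e)%VF = f.
Proof.
by move=> Iinj eA fA e0; apply: Iinj => // x /e0 ->; rewrite linear0.
Qed.

(** By adjunction only the k-linear map x |-> f(x)(1) has to be extended along [e], and a
    pseudo-inverse of [e] does that. *)
Lemma coind_injective (V : vectType k) : injective_mod (coind_mod V).
Proof.
move=> X Y e f eA fA ef.
pose f0 (x : X) : V := (f x : 'Hom(A, V)) (aone A).
have f0L : linear f0.
  by move=> c x y; rewrite /f0 linearP /= add_lfunE scale_lfunE.
have [g gA gE] := coind_transpose (linfun f0 \o e^-1)%VF.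
exists g => //; apply/lfunP => x; apply/lfunP => b; rewrite comp_lfunE gE.
have eK y : f0 ((e^-1)%VF (e y)) = f0 y.
  rewrite /f0; have -> // : f ((e^-1)%VF (e y)) = f y.
  apply/subr0_eq; rewrite -linearB /= ef // linearB /=.
  by rewrite limg_lfunVK ?subrr // memv_img ?memvf.
rewrite -HomA_act // comp_lfunE linfun_linearE // eK /f0 HomA_act //.
by rewrite coind_actE amul1l.
Qed.

Definition coind_unit_fun M (x : M) : coind_mod M := linfun (orbit_map x).
Definition coind_unit M : 'Hom(M, coind_mod M) := linfun (@coind_unit_fun M).

Lemma coind_unitE M x (a : A) : (coind_unit M x : 'Hom(A, M)) a = mact a x.
Proof.
rewrite linfun_linearE ?orbit_linfunE // => c y z; apply/lfunP => b.
by rewrite add_lfunE scale_lfunE !orbit_linfunE mact_linear_r.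
Qed.

Lemma coind_unitP M : coind_unit M \in HomA M (coind_mod M).
Proof.
apply/mem_HomA => a x; apply/lfunP => b.
by rewrite coind_actE !coind_unitE mactM.
Qed.

Lemma coind_unit_inj M x : coind_unit M x = 0 -> x = 0.
Proof.
by move=> /lfunP/(_ (aone A)); rewrite coind_unitE mact1 lfunE.
Qed.

Definition cosyz M : fdmod A := coker_mod (coind_unitP M).
Definition cosyz_proj M : 'Hom(coind_mod M, cosyz M) :=
  coker_proj (coind_unitP M).

Lemma cosyz_ses M : short_exact (coind_unit M) (cosyz_proj M).
Proof. exact/coker_ses/coind_unit_inj. Qed.

Lemma cosyz_projP M : cosyz_proj M \in HomA (coind_mod M) (cosyz M).
Proof. exact: coker_projP. Qed.

Lemma cosyz_lift P M (f : 'Hom(P, cosyz M)) :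
  projective P -> f \in HomA P (cosyz M) ->
  exists2 g, g \in HomA P (coind_mod M) & (cosyz_proj M \o g)%VF = f.
Proof.
move=> Pp fA; apply: projective_lift (cosyz_projP M) fA _ => //.
by case: (cosyz_ses M) => _ _ _ _ ->; apply: subvf.
Qed.

(* Vanishing of Ext^1(U, Y), computed by the coresolution 0 -> Y -> coind Y *)
Definition ext1_zero U Y := forall f, f \in HomA U (cosyz Y) ->
  exists2 g, g \in HomA U (coind_mod Y) & (cosyz_proj Y \o g)%VF = f.

Lemma ext1_zero_proj P Y : projective P -> ext1_zero P Y.
Proof. by move=> Pp f; apply: cosyz_lift. Qed.

Lemma ext1_zero_extend U Y B V (i : 'Hom(B, V)) (p : 'Hom(V, U)) f :
  ext1_zero U Y -> short_exact i p -> f \in HomA B Y ->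
  exists2 g, g \in HomA V Y & (g \o i)%VF = f.
Proof.
move=> UY ip fA; have [iA pA i0 [/comp_eq0P pi _] _] := (short_exactP i p).1 ip.
have uA := coind_unitP Y; have ufA := HomA_comp uA fA.
have [w wA wi] := injective_extend (coind_injective (V := Y)) iA ufA i0.
have qA := cosyz_projP Y.
have qu : (cosyz_proj Y \o coind_unit Y)%VF = 0 by apply: coker_proj_comp.
have [|h hA hp] := factor_coker ip (HomA_comp qA wA).
  by rewrite -comp_lfunA wi comp_lfunA qu comp_lfun0l.
have [t tA qt] := UY h hA.
have wtA : w - (t \o p)%VF \in HomA V (coind_mod Y).
  by rewrite memvB // HomA_comp.
have [|g gA ug] := factor_ker (cosyz_ses Y) wtA.
  by rewrite comp_lfunDr comp_lfunNr comp_lfunA qt hp subrr.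
exists g => //; apply/lfunP => x; apply/subr0_eq/(@coind_unit_inj Y).
move/lfunP: ug => /(_ (i x)); rewrite !comp_lfunE add_lfunE opp_lfunE comp_lfunE.
rewrite linearB /= => ->; rewrite pi linear0 subr0.
by rewrite -[w (i x)]comp_lfunE wi comp_lfunE subrr.
Qed.

(** Converse of [ext1_zero_extend] for projective V: vanishing of Ext^1(U, Y) may be tested on any
    projective presentation of U, as surjectivity of Hom(V, Y) -> Hom(B, Y). *)
Lemma ext1_zero_of_proj U Y B V (i : 'Hom(B, V)) (p : 'Hom(V, U)) :
  projective V -> short_exact i p ->
  (forall f, f \in HomA B Y -> exists2 g, g \in HomA V Y & (g \o i)%VF = f) ->
  ext1_zero U Y.
Proof.
move=> Vp ip ext f fA; have [iA pA i0 [pi _] ps] := (short_exactP i p).1 ip.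
have [w wA qw] := cosyz_lift Vp (HomA_comp fA pA).
have [|b bA ub] := factor_ker (cosyz_ses Y) (HomA_comp wA iA).
  by rewrite comp_lfunA qw -comp_lfunA pi comp_lfun0r.
have [g gA gi] := ext b bA.
have wgA : w - (coind_unit Y \o g)%VF \in HomA V (coind_mod Y).
  by rewrite memvB // HomA_comp ?coind_unitP.
have [|h hA hp] := factor_coker ip wgA.
  by rewrite comp_lfunDl comp_lfunNl -comp_lfunA gi ub subrr.
exists h => //; apply/lfunP => x; have [y <-] := ps x.
rewrite comp_lfunE -[h _]comp_lfunE hp add_lfunE opp_lfunE linearB /=.
rewrite -[_ (w y)]comp_lfunE qw [(coind_unit _ \o _)%VF y]comp_lfunE.
have /comp_eq0P -> := coker_proj_comp (coind_unitP Y).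
by rewrite subr0 comp_lfunE.
Qed.

Lemma free_ses U : exists (B V : fdmod A) (i : 'Hom(B, V)) (p : 'Hom(V, U)),
  projective V /\ short_exact i p.
Proof.
have [p pA /limg_fullP ps] := free_cover U.
have [K [i ip]] := ker_ses pA ps.
by eexists K, _, i, p; split=> //; apply: projective_pow.
Qed.

Lemma ses_projective_lift P B V U (i : 'Hom(B, V)) (p : 'Hom(V, U)) f :
  projective P -> short_exact i p -> f \in HomA P U ->
  exists2 g, g \in HomA P V & (p \o g)%VF = f.
Proof.
move=> Pp [_ pA _ _ ps] fA; apply: projective_lift => //.
by rewrite ps subvf.
Qed.

Lemma ext1_zero_lift U B V Z (i : 'Hom(B, V)) (p : 'Hom(V, Z)) f :
  ext1_zero U B -> short_exact i p -> f \in HomA U Z ->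
  exists2 g, g \in HomA U V & (p \o g)%VF = f.
Proof.
move=> UB ip fA; have [K [P [j [q [Pp jq]]]]] := free_ses U.
have [jA qA _ [qj _] qs] := (short_exactP j q).1 jq.
have [iA pA _ [pi _] _] := (short_exactP i p).1 ip.
have [w wA pw] := ses_projective_lift Pp ip (HomA_comp fA qA).
have [|b bA ib] := factor_ker ip (HomA_comp wA jA).
  by rewrite comp_lfunA pw -comp_lfunA qj comp_lfun0r.
have [c cA cj] := ext1_zero_extend UB jq bA.
have wcA : w - (i \o c)%VF \in HomA P V by rewrite memvB // HomA_comp.
have [|h hA hq] := factor_coker jq wcA.
  by rewrite comp_lfunDl comp_lfunNl -comp_lfunA cj ib subrr.
exists h => //; apply/lfunP => x; have [y <-] := qs x.
rewrite comp_lfunE -[h _]comp_lfunE hq add_lfunE opp_lfunE linearB /=.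
rewrite -[_ (w y)]comp_lfunE pw [(i \o _)%VF y]comp_lfunE.
by move/comp_eq0P: pi => ->; rewrite subr0 comp_lfunE.
Qed.

Lemma ext1_zero_extr U B V Z (i : 'Hom(B, V)) (p : 'Hom(V, Z)) :
  short_exact i p -> ext1_zero U B -> ext1_zero U Z -> ext1_zero U V.
Proof.
move=> ip UB UZ; have [K [P [j [q [Pp jq]]]]] := free_ses U.
apply: (ext1_zero_of_proj Pp jq) => f fA.
have [iA pA _ [pi _] _] := (short_exactP i p).1 ip.
have [jA qA _ _ _] := (short_exactP j q).1 jq.
have [z zA zj] := ext1_zero_extend UZ jq (HomA_comp pA fA).
have [v vA pv] := ses_projective_lift Pp ip zA.
have fvA : f - (v \o j)%VF \in HomA K V by rewrite memvB // HomA_comp.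
have [|b bA ib] := factor_ker ip fvA.
  by rewrite comp_lfunDr comp_lfunNr comp_lfunA pv zj subrr.
have [c cA cj] := ext1_zero_extend UB jq bA.
exists (v + (i \o c)%VF); first by rewrite memvD // HomA_comp.
by rewrite comp_lfunDl -comp_lfunA cj ib addrC subrK.
Qed.

Lemma ext1_zero_extl U B V Y (i : 'Hom(B, V)) (p : 'Hom(V, U)) :
  short_exact i p -> ext1_zero B Y -> ext1_zero U Y -> ext1_zero V Y.
Proof.
move=> ip BY UY f fA.
have [iA pA i0 [pi _] _] := (short_exactP i p).1 ip.
have [b bA qb] := BY _ (HomA_comp fA iA).
have [c cA ci] := injective_extend (coind_injective (V := Y)) iA bA i0.
have qA := cosyz_projP Y.
have fcA : f - (cosyz_proj Y \o c)%VF \in HomA V (cosyz Y).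
  by rewrite memvB // HomA_comp.
have [|h hA hp] := factor_coker ip fcA.
  by rewrite comp_lfunDl comp_lfunNl -comp_lfunA ci qb subrr.
have [t tA qt] := UY h hA.
exists (c + (t \o p)%VF); first by rewrite memvD // HomA_comp.
by rewrite comp_lfunDr comp_lfunA qt hp addrC subrK.
Qed.

Lemma ext1_zero_factors (S : fdmod A -> Prop) U Y :
  factors S (\1%VF : 'Hom(U, U)) -> (forall W, S W -> ext1_zero W Y) ->
  ext1_zero U Y.
Proof.
move=> SU SY f fA.
suff H X (e : 'Hom(X, U)) : factors S e ->
    exists2 g, g \in HomA X (coind_mod Y) & (cosyz_proj Y \o g)%VF = (f \o e)%VF.
  by have [g gA gE] := H _ _ SU; exists g; rewrite // gE comp_lfun1r.
elim=> [|W i p e' SW iA pA _ [g gA gE]].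
  by exists 0; rewrite ?HomA0 // !comp_lfun0r.
have [t tA tE] := SY _ SW _ (HomA_comp fA pA).
exists ((t \o i) + g)%VF; first by rewrite memvD // HomA_comp.
by rewrite !comp_lfunDr gE !comp_lfunA tE.
Qed.

Lemma ext1_zero_add W U Y : in_add W U -> ext1_zero W Y -> ext1_zero U Y.
Proof.
by move=> /in_addP WU WY; apply: ext1_zero_factors WU _ => _ <-.
Qed.

Lemma ext1_zero0r U Y : is_zero_mod Y -> ext1_zero U Y.
Proof.
move=> Y0; have [B [V [i [p [Vp ip]]]]] := free_ses U.
apply: (ext1_zero_of_proj Vp ip) => f fA; exists 0; rewrite ?HomA0 //.
by rewrite (is_zero_mod_hom f (or_intror Y0)) comp_lfun0l.
Qed.

Lemma ext1_zero_pow_r U Y n : ext1_zero U Y -> ext1_zero U (pow_mod Y n).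
Proof.
move=> UY; elim: n => [|n IHn]; first exact/ext1_zero0r/(@zero_mod_zero _ A).
exact: ext1_zero_extr (sum_ses _ _) UY IHn.
Qed.

Lemma ext1_zero_inj_r U I : injective_mod I -> ext1_zero U I.
Proof.
move=> Iinj; have [B [V [i [p [Vp ip]]]]] := free_ses U.
have [iA _ i0 _ _] := (short_exactP i p).1 ip.
by apply: (ext1_zero_of_proj Vp ip) => f fA; apply: injective_extend.
Qed.

End Coinduced.

(** * Acyclic objects and exactness of Hom complexes *)

Section Complexes.
Variables (k : fieldType) (A : fdalg k).
Implicit Types M N X Y U V B W P : fdmod A.

(* Ext^i(U, Y) = 0 for 1 <= i <= m, by dimension shifting along cosyzygies of Y *)
Definition acyclic m U Y :=
  forall i, (i < m)%N -> ext1_zero U (iter i (@cosyz k A) Y).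

Lemma acyclicS m U Y :
  acyclic m.+1 U Y <-> ext1_zero U Y /\ acyclic m U (cosyz Y).
Proof.
split=> [H|[H0 H] [|i] im //].
  by split=> [|i im]; [exact: (H 0%N) | rewrite -iterSr; apply: H].
by rewrite iterSr; apply: H.
Qed.

Lemma acyclic_leq m m' U Y : (m <= m')%N -> acyclic m' U Y -> acyclic m U Y.
Proof. by move=> mm H i im; apply: H; apply: leq_trans mm. Qed.

Lemma acyclic_proj m P Y : projective P -> acyclic m P Y.
Proof. by move=> Pp i _; apply: ext1_zero_proj. Qed.

Lemma acyclic_add m W U Y : in_add W U -> acyclic m W Y -> acyclic m U Y.
Proof. by move=> WU H i im; apply: ext1_zero_add WU (H i im). Qed.

Lemma acyclic_extl m U B V Y (i : 'Hom(B, V)) (p : 'Hom(V, U)) :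
  short_exact i p -> acyclic m B Y -> acyclic m U Y -> acyclic m V Y.
Proof. by move=> ip HB HU j jm; apply: ext1_zero_extl ip (HB j jm) (HU j jm). Qed.

Variables (K : nat -> fdmod A) (D : forall i, 'Hom(K i.+1, K i)).
Hypothesis DA : forall i, D i \in HomA (K i.+1) (K i).

(* Exactness of Hom_A(K, Y) at Hom_A(K_j, Y) *)
Definition hom_exact_at Y j := forall f, f \in HomA (K j) Y ->
  (f \o D j)%VF = 0 ->
  match j return 'Hom(K j, Y) -> Prop with
  | 0 => fun f => f = 0
  | i.+1 => fun f => exists2 g, g \in HomA (K i) Y & f = (g \o D i)%VF
  end f.

Lemma exact_surj n : exact_upto D n.+1 -> forall y, exists x, D 0 x = y.
Proof. by move=> [D0 _]; apply/limg_fullP/D0. Qed.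

Lemma exact_at n i : exact_upto D n -> (i.+1 < n)%N ->
  (D i \o D i.+1)%VF = 0 /\ forall y, D i y = 0 -> exists x, D i.+1 x = y.
Proof. by move=> [_ De] lt_in; apply/limg_lkerP/De. Qed.

Lemma exact_upto_leq n n' : (n <= n')%N -> exact_upto D n' -> exact_upto D n.
Proof.
move=> nn [D0 De]; split=> [n0|i lt_in]; first by apply: D0; apply: leq_trans nn.
by apply: De; apply: leq_trans nn.
Qed.

Lemma hom_exact_at0 n Y : exact_upto D n.+1 -> hom_exact_at Y 0.
Proof.
move=> /exact_surj D0 f _ /comp_eq0P fD; apply/lfunP => y.
by have [x <-] := D0 y; rewrite fD lfunE.
Qed.

(** Dimension shifting: a cocycle into Y extends along the differential to the coinduced module, and
    its image in the cosyzygy is a cocycle one degree lower. If that one bounds, vanishing of Ext^1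
    lifts the bounding map and corrects the extension. Each shift uses up one Ext group, and the
    last one needs none, whence [j.-1]. *)
Lemma acyclic_hom_exact j Y : exact_upto D j.+1 ->
  (forall i, (i <= j)%N -> acyclic j.-1 (K i) Y) -> hom_exact_at Y j.
Proof.
elim: j Y => [|i IHi] Y De acy; first exact: hom_exact_at0 De.
move=> f fA fD; have [_ kerD] := exact_at De (leqnn _).
have uA := coind_unitP Y; have qA := cosyz_projP Y.
have [|g gA gE] := coind_injective (DA i) (HomA_comp uA fA).
  move=> x /kerD[y <-]; rewrite comp_lfunE.
  by move/comp_eq0P: fD => ->; rewrite linear0.
have qgD : (cosyz_proj Y \o g \o D i)%VF = 0.
  rewrite -comp_lfunA gE comp_lfunA.
  by rewrite [X in (X \o _)%VF]coker_proj_comp comp_lfun0l.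
have {IHi} := IHi (cosyz Y) (exact_upto_leq (leqnSn _) De) _ _
  (HomA_comp qA gA) qgD.
case: i De acy f fA fD kerD g gA gE qgD => [|i] De acy f fA fD kerD g gA gE qgD.
  (* Here the required acyclicity is [acyclic 0], which is vacuous. *)
  move=> /(_ (fun _ _ _ H => False_ind _ (notF H))) qg0.
  have [b bA bE] := factor_ker (cosyz_ses Y) gA qg0.
  exists b => //; apply/lfunP => x; apply/subr0_eq/(@coind_unit_inj _ _ Y).
  move/lfunP: gE => /(_ x); rewrite !comp_lfunE linearB /= => <-.
  by rewrite -bE comp_lfunE subrr.
case=> [l li|h hA qg].
  by have /acyclicS[] := acy l (leqW li).
have /acyclicS[ext _] := acy i (leqW (leqnSn _)).
have [t tA tE] := ext h hA.
have gtA : g - (t \o D i)%VF \in HomA (K i.+1) (coind_mod A Y).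
  by rewrite memvB // HomA_comp.
have [|b bA bE] := factor_ker (cosyz_ses Y) gtA.
  by rewrite comp_lfunDr comp_lfunNr comp_lfunA tE qg subrr.
exists b => //; apply/lfunP => x; apply/subr0_eq/(@coind_unit_inj _ _ Y).
move/lfunP: gE => /(_ x); rewrite !comp_lfunE linearB /= => <-.
rewrite -[coind_unit Y (b _)]comp_lfunE bE add_lfunE opp_lfunE comp_lfunE.
have [/comp_eq0P -> _] := exact_at De (leqnSn _).
by rewrite linear0 subr0 subrr.
Qed.

(** K_1, K_2, ... is the start of a projective resolution of K_0, so Ext^i(K_0, Y) sits in degree i
    + 1 of the Hom complex. Induction on m replaces Y by its cosyzygy. *)
Lemma hom_exact_acyclic m Y : exact_upto D m.+2 ->
  (forall i, (0 < i <= m.+1)%N -> projective (K i)) ->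
  (forall j, (2 <= j <= m.+1)%N -> hom_exact_at Y j) -> acyclic m (K 0) Y.
Proof.
elim: m Y => [//|m IHm] Y De Kp Kex.
have uA := coind_unitP Y; have qA := cosyz_projP Y.
(* A cocycle into the cosyzygy lifts to a map [w] into the coinduced module. The failure of [w] to
   be a cocycle is a cocycle [b] into Y one degree higher; subtracting a map that bounds [b] makes
   [w] extend along [D j]. *)
have lift j (f : 'Hom(K j.+1, cosyz Y)) : (j <= m)%N ->
    f \in HomA (K j.+1) (cosyz Y) -> (f \o D j.+1)%VF = 0 ->
    exists2 e, e \in HomA (K j) (coind_mod A Y)
      & f = (cosyz_proj Y \o e \o D j)%VF.
  move=> jm fA fD.
  have [|w wA wE] := cosyz_lift (Kp j.+1 _) fA; first by rewrite /= ltnS leqW.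
  have [|b bA bE] := factor_ker (cosyz_ses Y) (HomA_comp wA (DA j.+1)).
    by rewrite comp_lfunA wE.
  have uinj (x : Y) : coind_unit Y x = 0 -> x = 0 by apply: coind_unit_inj.
  have DD : (D j.+1 \o D j.+2)%VF = 0 by apply: (exact_at De _).1.
  have bD : (b \o D j.+2)%VF = 0.
    apply/comp_eq0P => x; apply: uinj; rewrite -[_ (b _)]comp_lfunE bE comp_lfunE.
    by move/comp_eq0P: DD => ->; rewrite linear0.
  have [|g gA gE] := Kex j.+2 _ b bA bD; first by rewrite /= !ltnS.
  have wgA : w - (coind_unit Y \o g)%VF \in HomA (K j.+1) (coind_mod A Y).
    by rewrite memvB // HomA_comp.
  have [|e eA eE] := coind_injective (DA j) wgA.
    have lt_j : (j.+1 < m.+3)%N by rewrite !ltnS leqW.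
    move=> x /((exact_at De lt_j).2)[y <-].
    rewrite add_lfunE opp_lfunE -!comp_lfunE -comp_lfunA -bE gE.
    by rewrite subrr.
  exists e => //; rewrite -comp_lfunA eE comp_lfunDr comp_lfunNr wE comp_lfunA.
  by rewrite [X in (X \o _)%VF]coker_proj_comp comp_lfun0l subr0.
apply/acyclicS; split=> [f fA|].
  have D0 := exact_surj De.
  have [|||e eA eE] := lift 0 (f \o D 0)%VF; rewrite ?HomA_comp //.
    by rewrite -comp_lfunA (exact_at De _).1 ?comp_lfun0r.
  exists e => //; apply/lfunP => x; have [y <-] := D0 x.
  by move/lfunP/(_ y): eE; rewrite !comp_lfunE => ->.
apply: IHm => [|i /andP[i0 im]|j /andP[j2 jm]].
- exact: exact_upto_leq De.
- by apply: Kp; rewrite i0 leqW.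
- case: j j2 jm => [//|j] _ jm f fA fD; have [e eA ->] := lift j f jm fA fD.
  by exists (cosyz_proj Y \o e)%VF; rewrite ?HomA_comp.
Qed.

End Complexes.

(** * The functor Hom_A(P, -) and filtered modules *)

Section HomFunctor.
Variables (k : fieldType) (A : fdalg k) (P : fdmod A).
Implicit Types M N X Y U V B W : fdmod A.

Local Notation H := (hom_mod P).
Local Notation Hf := (hom_map P).

Lemma hom_map_comp M N X (g : 'Hom(N, X)) (f : 'Hom(M, N)) :
  g \in HomA N X -> f \in HomA M N -> Hf (g \o f)%VF = (Hf g \o Hf f)%VF.
Proof.
move=> gA fA; apply/lfunP => u; apply: subvs_inj.
by rewrite comp_lfunE !hom_mapE ?HomA_comp // comp_lfunA.
Qed.

Lemma hom_map1 M : Hf (\1%VF : 'Hom(M, M)) = \1%VF.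
Proof.
by apply/lfunP => u; apply: subvs_inj; rewrite hom_mapE ?HomA1 // comp_lfun1l id_lfunE.
Qed.

Lemma hom_map0 M N : Hf (0 : 'Hom(M, N)) = 0.
Proof.
apply/lfunP => u; apply: subvs_inj.
by rewrite hom_mapE ?HomA0 // comp_lfun0l lfunE.
Qed.

Lemma hom_mapD M N (f g : 'Hom(M, N)) :
  f \in HomA M N -> g \in HomA M N -> Hf (f + g) = Hf f + Hf g.
Proof.
move=> fA gA; apply/lfunP => u; apply: subvs_inj.
by rewrite add_lfunE hom_mapE ?memvD // comp_lfunDl linearD /= !hom_mapE.
Qed.

Lemma hom_mapB M N (f g : 'Hom(M, N)) :
  f \in HomA M N -> g \in HomA M N -> Hf (f - g) = Hf f - Hf g.
Proof.
move=> fA gA; apply/lfunP => u; apply: subvs_inj.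
by rewrite add_lfunE opp_lfunE hom_mapE ?memvB // comp_lfunDl comp_lfunNl
  linearB /= !hom_mapE.
Qed.

Lemma hom_map_vsproj M N (f : 'Hom(M, N)) u :
  f \in HomA M N -> u \in HomA P M ->
  Hf f (vsproj (HomA P M) u) = vsproj (HomA P N) (f \o u)%VF.
Proof.
move=> fA uA; apply: subvs_inj.
by rewrite hom_mapE // !vsprojK ?HomA_comp.
Qed.

Lemma hom_map_eq0 M N (f : 'Hom(M, N)) : f \in HomA M N ->
  Hf f = 0 <-> forall u, u \in HomA P M -> (f \o u)%VF = 0.
Proof.
move=> fA; split=> [f0 u uA|f0].
  move/lfunP: f0 => /(_ (vsproj _ u)); rewrite hom_map_vsproj // lfunE.
  by move/(congr1 vsval); rewrite vsprojK ?HomA_comp.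
by apply/lfunP => u; apply: subvs_inj; rewrite hom_mapE // f0 ?subvsP // lfunE.
Qed.

Lemma hom_map_surjP M N (g : 'Hom(M, N)) : g \in HomA M N ->
  (forall y, exists x, Hf g x = y) <->
  (forall u, u \in HomA P N -> exists2 v, v \in HomA P M & (g \o v)%VF = u).
Proof.
move=> gA; split=> [gs u uA|gs u].
  have [v vE] := gs (vsproj _ u); exists (vsval v); first exact: subvsP.
  by rewrite -hom_mapE // vE vsprojK.
have [v vA vE] := gs (vsval u) (subvsP u); exists (vsproj _ v).
by apply: subvs_inj; rewrite hom_mapE // vsprojK.
Qed.

Lemma hom_map_kerP X M N (f : 'Hom(X, M)) (g : 'Hom(M, N)) :
  f \in HomA X M -> g \in HomA M N ->
  (forall y, Hf g y = 0 -> exists x, Hf f x = y) <->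
  (forall u, u \in HomA P M -> (g \o u)%VF = 0 ->
     exists2 v, v \in HomA P X & (f \o v)%VF = u).
Proof.
move=> fA gA; split=> [fg u uA gu|fg u gu].
  have [|v vE] := fg (vsproj _ u).
    by rewrite hom_map_vsproj // gu linear0.
  exists (vsval v); first exact: subvsP.
  by rewrite -hom_mapE // vE vsprojK.
have [||v vA vE] := fg (vsval u); first exact: subvsP.
  by rewrite -hom_mapE // gu.
by exists (vsproj _ v); apply: subvs_inj; rewrite hom_mapE // vsprojK.
Qed.

Lemma hom_map_faithful M N (f : 'Hom(M, N)) :
  in_add P M -> f \in HomA M N -> Hf f = 0 -> f = 0.
Proof.
move=> /in_addP PM fA /hom_map_eq0-/(_ fA) f0.
suff E Y (e : 'Hom(Y, M)) : factors (eq P) e -> (f \o e)%VF = 0.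
  by rewrite -[f]comp_lfun1r E.
elim=> [|Z i p e' PZ]; first by rewrite comp_lfun0r.
case: _ / PZ i p => i p iA pA _ IH.
by rewrite comp_lfunDr IH comp_lfunA f0 // comp_lfun0l addr0.
Qed.

Lemma hom_map_inj M N (f g : 'Hom(M, N)) :
  in_add P M -> f \in HomA M N -> g \in HomA M N -> Hf f = Hf g -> f = g.
Proof.
move=> PM fA gA fg; apply/subr0_eq/hom_map_faithful => //; first exact: memvB.
by rewrite hom_mapB // fg subrr.
Qed.

(** Yoneda: each leg p : P -> M of a factorisation of the identity of M is an element of H M, and
    its image under [h] is the corresponding leg of the preimage of [h]. Linearity over End_A(P)^op
    enters because p o (i o u) is p acted on by i o u. *)
Lemma hom_map_full M X (h : 'Hom(H M, H X)) :
  in_add P M -> h \in HomA (H M) (H X) ->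
  exists2 f, f \in HomA M X & Hf f = h.
Proof.
move=> /in_addP PM hA.
suff E Y (e : 'Hom(Y, M)) : factors (eq P) e -> e \in HomA Y M /\
    exists2 f, f \in HomA Y X & Hf f = (h \o Hf e)%VF.
  have [_ [f fA fE]] := E _ _ PM; exists f => //.
  by rewrite fE hom_map1 comp_lfun1r.
elim=> [|Z i p e' PZ].
  by split; rewrite ?HomA0 //; exists 0; rewrite ?HomA0 // !hom_map0 comp_lfun0r.
case: _ / PZ i p => i p iA pA _ [eA [f fA fE]].
have piA : (p \o i)%VF \in HomA Y M by rewrite HomA_comp.
split; first by rewrite memvD.
pose hp := h (vsproj (HomA P M) p).
have hpA : (vsval hp \o i)%VF \in HomA Y X by rewrite HomA_comp ?subvsP.
exists ((vsval hp \o i) + f)%VF; first by rewrite memvD.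
rewrite !hom_mapD // comp_lfunDr -fE; congr (_ + _); apply/lfunP => u.
apply: subvs_inj; rewrite hom_mapE // comp_lfunE.
pose r : opp_alg (end_alg P) := vsproj (HomA P P) (i \o vsval u)%VF.
have rE : vsval r = (i \o vsval u)%VF by rewrite vsprojK // HomA_comp ?subvsP.
have -> : Hf (p \o i)%VF u = mact (r : opp_alg _) (vsproj (HomA P M) p : H M).
  apply: subvs_inj; rewrite hom_compE hom_mapE // rE vsprojK //.
  by rewrite comp_lfunA.
by rewrite HomA_act // hom_compE rE comp_lfunA.
Qed.

Lemma factors_HomA S M N (f : 'Hom(M, N)) : factors S f -> f \in HomA M N.
Proof.
elim=> [|Y i p f' _ iA pA _ IH]; first exact: HomA0.
by rewrite memvD // HomA_comp.
Qed.

Lemma factors_hom (S : fdmod A -> Prop) S' M N (f : 'Hom(M, N)) :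
  (forall Y, S Y -> S' (H Y)) -> factors S f -> factors S' (Hf f).
Proof.
move=> SS; elim=> [|Y i p f' SY iA pA Sf IH].
  by rewrite hom_map0; apply: factors0.
rewrite hom_mapD ?HomA_comp ?(factors_HomA Sf) // hom_map_comp //.
by apply: factorsD => //; [apply: SS | apply: hom_mapP..].
Qed.

Lemma in_add_hom W M : in_add W M -> in_add (H W) (H M).
Proof.
move=> /in_addP WM; apply/in_addP; rewrite -hom_map1.
by apply: factors_hom WM => _ <-.
Qed.

Lemma hom_mod_reg :
  (\1%VF : 'Hom(H P, reg_mod (opp_alg (end_alg P)))) \in HomA (H P) (reg_mod _) /\
  (\1%VF : 'Hom(reg_mod (opp_alg (end_alg P)), H P)) \in HomA (reg_mod _) (H P).
Proof. by split; apply/mem_HomA => a x; rewrite !id_lfunE. Qed.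

Lemma in_add_hom_reg : in_add (H P) (reg_mod (opp_alg (end_alg P))).
Proof.
have [fA gA] := hom_mod_reg; apply: (in_add_iso fA gA) (in_add_refl _).
exact: comp_lfun1l.
Qed.

Lemma hom_mod_projective M : in_add P M -> projective (H M).
Proof.
move=> PM; have [fA gA] := hom_mod_reg.
apply: in_add_trans (in_add_hom PM).
apply: (in_add_iso gA fA) (in_add_refl _); exact: comp_lfun1l.
Qed.

Lemma hom_mod_zero M : is_zero_mod M -> is_zero_mod (H M).
Proof.
move=> M0 u; apply: subvs_inj; apply/lfunP => x.
by rewrite linear0 lfunE (M0 (_ x)).
Qed.

Lemma hom_map_ses B V U (i : 'Hom(B, V)) (p : 'Hom(V, U)) :
  ext1_zero P B -> short_exact i p -> short_exact (Hf i) (Hf p).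
Proof.
move=> PB ip; have [iA pA i0 [pi _] _] := (short_exactP i p).1 ip.
apply/short_exactP; split; rewrite ?hom_mapP //.
- move=> u iu; apply: subvs_inj; rewrite linear0; apply/lfunP => x; rewrite lfunE.
  by apply: i0; rewrite -comp_lfunE -hom_mapE // iu linear0 lfunE.
- split; first by rewrite -hom_map_comp // pi hom_map0.
  apply/hom_map_kerP => // u uA pu; exact: factor_ker ip uA pu.
- by apply/hom_map_surjP => // u uA; apply: ext1_zero_lift PB ip uA.
Qed.

End HomFunctor.

Section Filtered.
Variables (k : fieldType) (A : fdalg k).
Implicit Types M N X Y U V B W : fdmod A.

(** Closure under extensions and zero modules already yields powers and isomorphic copies: an
    isomorphism is a short exact sequence with zero third term. *)
Lemma filtered_tensor_ind (I : Type) (S : I -> fdmod A) (p : I -> bool)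
    (C : fdmod A -> Prop) :
  (forall M, is_zero_mod M -> C M) ->
  (forall B V U (f : 'Hom(B, V)) (g : 'Hom(V, U)),
     short_exact f g -> C B -> C U -> C V) ->
  (forall l, p l -> C (S l)) ->
  forall M, filtered (tensor_class S p) M -> C M.
Proof.
move=> C0 Cext CS M; elim=> [N N0|M' N X f g _ CM' [l [n [pl XS]]] fg].
  exact: C0.
apply: (Cext _ _ _ _ _ fg CM'); case/mod_iso_sym: XS => h hA hb.
have Z0 := @zero_mod_zero _ A.
apply: (Cext _ _ _ _ _ (mod_iso_ses hA hb Z0) _ (C0 _ Z0)).
elim: n {h hA hb} => [|n IHn]; first exact: C0.
exact: (Cext _ _ _ _ _ (sum_ses _ _) (CS l pl) IHn).
Qed.

Lemma filtered_iso (Theta : fdmod A -> Prop) M N :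
  mod_iso M N -> filtered Theta M -> filtered Theta N.
Proof.
move=> /mod_isoP[h [h' [hA hA' hh' h'h]]] FM.
case: FM h h' hA hA' hh' h'h => [{}M M0|M' {}M X f g FM' TX fg] h h' hA hA' hh' h'h.
  apply: filtered_zero => x; move/lfunP: hh' => /(_ x).
  by rewrite comp_lfunE id_lfunE (M0 (h' x)) linear0.
apply: (filtered_step (f := (h \o f)%VF) (g := (g \o h')%VF) FM' TX).
have [fA gA f0 [gf kfg] gs] := (short_exactP f g).1 fg.
have hK x : h' (h x) = x by rewrite -comp_lfunE h'h id_lfunE.
have h'K x : h (h' x) = x by rewrite -comp_lfunE hh' id_lfunE.
apply/short_exactP; split; rewrite ?HomA_comp //.
- by move=> x; rewrite comp_lfunE => hx; apply: f0; rewrite -[f x]hK hx linear0.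
- split.
    by rewrite comp_lfunA -[(g \o h' \o h)%VF]comp_lfunA h'h comp_lfun1r.
  move=> y; rewrite comp_lfunE => /kfg[x xE].
  by exists x; rewrite comp_lfunE xE h'K.
- by move=> z; have [y yE] := gs z; exists (h y); rewrite comp_lfunE hK.
Qed.

(** A filtration grows only by one factor at the top, so the induction is on that of U: the
    extension is pulled back to the submodule N' of U, and the top factor of U is then put on the
    pullback. *)
Lemma filtered_ext (Theta : fdmod A -> Prop) B V U
    (f : 'Hom(B, V)) (g : 'Hom(V, U)) :
  short_exact f g -> filtered Theta B -> filtered Theta U -> filtered Theta V.
Proof.
move=> fg FB FU; elim: FU V f g fg => [N N0|N' N X i p FN' IH TX ip] V f g fg.
  have [fA gA f0 [gf kfg] gs] := (short_exactP f g).1 fg.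
  apply: filtered_iso FB; exists f => //.
  have fi : injective f.
    by move=> x y xy; apply/subr0_eq/f0; rewrite linearB /= xy subrr.
  have fs y : exists x, f x == y.
    by have [x <-] := kfg y (N0 _); exists x.
  exists (fun y => xchoose (fs y)) => x; last exact/eqP/(xchooseP (fs x)).
  by apply: fi; apply/eqP/(xchooseP (fs (f x))).
have [iA pA i0 [pi kip] ps] := (short_exactP i p).1 ip.
have [K [a [b [c [ab cA gc ca _]]]]] := pullback_ses fg iA.
have [aA bA a0 [ba kab] bs] := (short_exactP a b).1 ab.
have [fA gA f0 [gf kfg] gs] := (short_exactP f g).1 fg.
have {}gc z : g (c z) = i (b z) by rewrite -!comp_lfunE gc.
have {}ca x : c (a x) = f x by rewrite -ca comp_lfunE.
apply: (filtered_step (f := c) (g := (p \o g)%VF) (IH _ _ _ ab) TX).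
apply/short_exactP; split; rewrite ?HomA_comp //.
- move=> z cz; have [|x xE] := kab z; first by apply: i0; rewrite -gc cz linear0.
  by rewrite -xE (f0 x) ?linear0 // -ca xE.
- split=> [|y]; first apply/comp_eq0P => z.
    by rewrite comp_lfunE gc -comp_lfunE pi lfunE.
  rewrite comp_lfunE => /kip[n nE]; have [z zE] := bs n.
  have [|x xE] := kfg (y - c z).
    by rewrite linearB /= gc zE nE subrr.
  by exists (a x + z); rewrite linearD /= ca xE subrK.
- by move=> x; have [n <-] := ps x; have [y <-] := gs n; exists y; rewrite comp_lfunE.
Qed.

End Filtered.

(** * Universal extensions *)

Section UniversalExtension.
Variables (k : fieldType) (A : fdalg k).
Implicit Types M N X Y U V B W F P : fdmod A.

(** [augment] gives M index 0, so Ext^1 is exactness in degree 2, for which a resolution exact up to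
    3 suffices. *)
Lemma ext1_of_ext_zero M X : ext_zero 1 M X -> ext1_zero M X.
Proof.
move=> MX; have [c [cp cx]] := has_proj_resolution M.
refine (@hom_exact_acyclic _ _ (augment M (ch_obj c)) (ch_map c)
  (@ch_mapP _ _ _ c) 1 X (cx 3%N) _ _ 0%N isT); first by case=> // i _; apply: cp.
move=> [|[|[|j]]] // _ f fA fD.
by have := MX c (@conj _ _ cp cx) f (@conj _ _ fA fD).
Qed.

Lemma ext_zero_of_ext1 M X : ext1_zero M X -> ext_zero 1 M X.
Proof.
move=> MX c [cp cx] f [fA fD].
refine (@acyclic_hom_exact _ _ (augment M (ch_obj c)) (ch_map c)
  (@ch_mapP _ _ _ c) 2 X (cx 3%N) _ f fA fD) => -[_|i _] l l1.
  by case: l l1.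
exact/ext1_zero_proj/cp.
Qed.

(** X is the pullback of the coresolution of M along an approximation Y^n -> cosyz M. Every class in
    Ext^1(Y, M) comes from a map Y -> cosyz M; this map factors through the approximation, so the
    class dies in X. Classes that do not come from M are excluded by Ext^1(Y, Y^n) = 0. *)
Lemma universal_extension Y M : ext1_zero Y Y ->
  exists n X (f : 'Hom(M, X)) (g : 'Hom(X, pow_mod Y n)),
    short_exact f g /\ ext1_zero Y X.
Proof.
move=> YY; have [p [pA pE]] := add_approximation Y (cosyz M).
set n := size _ in p pA pE.
have [X [j [b [a [jb aA qa aj lift]]]]] := pullback_ses (cosyz_ses M) pA.
exists n, X, j, b; split=> //.
have [K [P [i [q [Pp iq]]]]] := free_ses Y.
apply: (ext1_zero_of_proj Pp iq) => f fA.
have [jA bA _ [bj _] _] := (short_exactP j b).1 jb.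
have [iA qA _ [qi _] _] := (short_exactP i q).1 iq.
have [s sA si] := ext1_zero_extend (ext1_zero_pow_r (n := n) YY) iq (HomA_comp bA fA).
have [t tA bt] := ses_projective_lift Pp jb sA.
have ftA : f - (t \o i)%VF \in HomA K X by rewrite memvB // HomA_comp.
have [|m mA jm] := factor_ker jb ftA.
  by rewrite comp_lfunDr comp_lfunNr comp_lfunA bt si subrr.
have uA := coind_unitP M; have cA := cosyz_projP M.
have iinj : forall x, i x = 0 -> x = 0 by case/short_exactP: iq.
have [w wA wi] := injective_extend (coind_injective (V := M)) iA
  (HomA_comp uA mA) iinj.
have [|h hA hq] := factor_coker iq (HomA_comp cA wA).
  rewrite -comp_lfunA wi comp_lfunA.
  by rewrite [X in (X \o _)%VF]coker_proj_comp comp_lfun0l.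
have [v vA pv] := pE h hA.
have [|z [zA az bz]] := lift P w (v \o q)%VF wA (HomA_comp vA qA).
  by rewrite -hq -pv comp_lfunA.
exists (t + z); first by rewrite memvD.
suff zi : (z \o i)%VF = (j \o m)%VF.
  by rewrite comp_lfunDl zi jm addrC subrK.
apply/lfunP => y; rewrite !comp_lfunE; apply/subr0_eq.
have [_ _ _ [_ kb] _] := (short_exactP j b).1 jb.
have [|m' m'E] := kb (z (i y) - j (m y)).
  rewrite linearB /= -!comp_lfunE bz bj -comp_lfunA qi comp_lfun0r.
  by rewrite comp_lfun0l !lfunE /= subrr.
rewrite -m'E (coind_unit_inj (x := m')) ?linear0 // -aj comp_lfunE m'E.
by rewrite linearB /= -!comp_lfunE az wi aj comp_lfunE subrr.
Qed.

(** Third isomorphism theorem, used to filter the quotient after stacking universal extensions. *)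
Lemma ses_trans M X Y U V (f : 'Hom(M, X)) (g : 'Hom(X, U))
    (f' : 'Hom(X, Y)) (g' : 'Hom(Y, V)) :
  short_exact f g -> short_exact f' g' ->
  exists (W : fdmod A) (p : 'Hom(Y, W)) (a : 'Hom(U, W)) (b : 'Hom(W, V)),
    short_exact (f' \o f)%VF p /\ short_exact a b.
Proof.
move=> fg fg'; have [fA gA f0 [gf kg] gs] := (short_exactP f g).1 fg.
have [fA' gA' f0' [gf' kg'] gs'] := (short_exactP f' g').1 fg'.
have ffA := HomA_comp fA' fA; pose p := coker_proj ffA.
have pA : p \in HomA _ _ by apply: coker_projP.
have ffp : short_exact (f' \o f)%VF p.
  by apply: coker_ses => x; rewrite comp_lfunE => /f0'/f0.
have [_ _ _ [pff kp] ps] := (short_exactP _ _).1 ffp.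
have [|a aA aE] := factor_coker fg (HomA_comp pA fA'); first by rewrite -comp_lfunA.
have [|b bA bE] := factor_coker ffp gA'; first by rewrite comp_lfunA gf' comp_lfun0l.
have aE' x : a (g x) = p (f' x) by rewrite -!comp_lfunE aE.
have bE' x : b (p x) = g' x by rewrite -comp_lfunE bE.
exists (coker_mod ffA), p, a, b; split=> //; apply/short_exactP; split=> //.
- move=> u au; have [x xE] := gs u; have [|m mE] := kp (f' x).
    by rewrite -aE' xE au.
  have /f0' : f' (f m - x) = 0 by rewrite linearB /= -comp_lfunE mE subrr.
  by move/subr0_eq=> mx; rewrite -xE -mx -comp_lfunE gf lfunE.
- split=> [|w bw].
    apply/comp_eq0P => u; have [x <-] := gs u.
    by rewrite aE' bE' -comp_lfunE gf' lfunE.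
  have [y yE] := ps w; have [|x xE] := kg' y; first by rewrite -bE' yE bw.
  by exists (g x); rewrite aE' xE.
- by move=> v; have [y yE] := gs' v; exists (p y); rewrite bE'.
Qed.

(** W is the cokernel of (i, -f) from B to the direct sum of P and X. *)
Lemma pushout_ses B P M X V (i : 'Hom(B, P)) (p : 'Hom(P, M))
    (f : 'Hom(B, X)) (g : 'Hom(X, V)) :
  short_exact i p -> short_exact f g ->
  exists (W : fdmod A) (a : 'Hom(X, W)) (b : 'Hom(W, M))
         (c : 'Hom(P, W)) (d : 'Hom(W, V)), short_exact a b /\ short_exact c d.
Proof.
move=> ip fg; have [fA gA f0 [gf kg] gs] := (short_exactP f g).1 fg.
have [iA pA i0 [pi kp] ps] := (short_exactP i p).1 ip.
have nfA : - f \in HomA B X by rewrite memvN.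
have [e eA eE] := sum_pair iA nfA.
have ses_eq : short_exact e (coker_proj eA).
  by apply: coker_ses => x; rewrite eE => -[/i0].
have [_ qA _ [qe kq] qs] := (short_exactP _ _).1 ses_eq.
set W := coker_mod eA in qA qs *; set q := coker_proj eA in ses_eq qA qe kq qs.
have [t tA tE] := sum_copair pA (HomA0 X M).
have [r rA rE] := sum_copair (HomA0 P V) gA.
have {}tE z : t z = p z.1 by rewrite tE lfunE addr0.
have {}rE z : r z = g z.2 by rewrite rE lfunE add0r.
have [|b bA bE] := factor_coker ses_eq tA.
  by apply/comp_eq0P => x; rewrite eE tE /= -comp_lfunE pi lfunE.
have [|d dA dE] := factor_coker ses_eq rA.
  apply/comp_eq0P => x; rewrite eE rE /= opp_lfunE linearN /= -comp_lfunE.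
  by rewrite gf lfunE oppr0.
have {}bE z : b (q z) = p z.1 by rewrite -tE -bE comp_lfunE.
have {}dE z : d (q z) = g z.2 by rewrite -rE -dE comp_lfunE.
have aA := HomA_comp qA (sum_inrP P X); have cA := HomA_comp qA (sum_inlP P X).
exists W, (q \o sum_inr P X)%VF, b, (q \o sum_inl P X)%VF, d.
have qD x y : q (x, y) = q (x, 0) + q (0, y).
  by rewrite -linearD; congr (q _); congr pair; rewrite /= ?addr0 ?add0r.
have qe' x : q (i x, - f x) = 0 by rewrite -[- _]opp_lfunE -eE -comp_lfunE qe lfunE.
split; apply/short_exactP; split=> //.
- move=> x; rewrite comp_lfunE sum_inrE => /kq[n]; rewrite eE => -[/i0 ->].
  by rewrite opp_lfunE linear0 oppr0.
- split=> [|w bw].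
    by apply/comp_eq0P => x; rewrite comp_lfunE sum_inrE bE linear0.
  have [[x y] xyE] := qs w; have [|n nE] := kp x; first by rewrite -[x]/(x, y).1 -bE xyE.
  exists (y + f n); rewrite comp_lfunE sum_inrE -xyE -nE; apply/subr0_eq.
  rewrite -linearB -[RHS]oppr0 -(qe' n) -linearN; congr (q _).
  by congr pair; rewrite /= ?sub0r // addrC addKr opprK.
- by move=> m; have [x xE] := ps m; exists (q (x, 0)); rewrite bE.
- move=> x; rewrite comp_lfunE sum_inlE => /kq[n]; rewrite eE opp_lfunE => -[<-].
  by move/eqP; rewrite oppr_eq0 => /eqP/f0 ->; rewrite linear0.
- split=> [|w bw].
    by apply/comp_eq0P => x; rewrite comp_lfunE sum_inlE dE linear0.
  have [[x y] xyE] := qs w; have [|n nE] := kg y; first by rewrite -[y]/(x, y).2 -dE xyE.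
  exists (x + i n); rewrite comp_lfunE sum_inlE -xyE -nE; apply/subr0_eq.
  rewrite -linearB -(qe' n); congr (q _).
  by congr pair; rewrite /= ?sub0r // addrC addKr.
- by move=> m; have [x xE] := gs m; exists (q (0, x)); rewrite dE.
Qed.

End UniversalExtension.

(** * Split quasi-hereditary algebras *)

Section SplitQuasiHereditary.
Variables (k : fieldType) (A : fdalg k).
Implicit Types M N X Y U V B W F P : fdmod A.

Lemma filtered_sub (Th Th' : fdmod A -> Prop) M :
  (forall X, Th X -> Th' X) -> filtered Th M -> filtered Th' M.
Proof.
move=> TT; elim=> [N N0|M' N X f g _ IH TX fg]; first exact: filtered_zero.
exact: filtered_step IH (TT X TX) fg.
Qed.

Lemma filtered_one (Th : fdmod A -> Prop) X : Th X -> filtered Th X.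
Proof.
move=> TX; have Z0 := @zero_mod_zero _ A.
apply: (filtered_step (f := 0 : 'Hom(zero_mod A, X)) (g := \1%VF)
  (filtered_zero _ Z0) TX).
apply/short_exactP; split; rewrite ?HomA0 ?HomA1 //.
- split=> [|y]; first exact: comp_lfun0r.
  by rewrite id_lfunE => ->; exists 0; rewrite linear0.
- by move=> z; exists z; rewrite id_lfunE.
Qed.

Lemma ext1_zero0l U Y : is_zero_mod U -> ext1_zero U Y.
Proof. by move=> U0; apply/ext1_zero_proj/in_add_zero. Qed.

Lemma filtered_ext1_zero (I : Type) (S : I -> fdmod A) (p : I -> bool) X M :
  (forall l, p l -> ext1_zero (S l) X) -> filtered (tensor_class S p) M ->
  ext1_zero M X.
Proof.
move=> SX FM.
refine (filtered_tensor_ind (C := fun N => ext1_zero N X) _ _ SX FM)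
  => [N|B V U f g fg].
  exact: ext1_zero0l.
exact: ext1_zero_extl fg.
Qed.

Lemma tensor_class_pow (I : Type) (S : I -> fdmod A) (p : I -> bool) l n :
  p l -> tensor_class S p (pow_mod (S l) n).
Proof. by move=> pl; exists l, n; split=> //; apply: mod_iso_refl. Qed.

Lemma mod_iso_pow1 M : mod_iso M (pow_mod M 1).
Proof.
exists (sum_inl M (zero_mod A)); first exact: sum_inlP.
exists (fun z => z.1) => [x|[x y]]; rewrite sum_inlE //.
by congr pair; rewrite (@zero_mod_zero _ _ y).
Qed.

Lemma filtered_tensor (I : Type) (S : I -> fdmod A) (p : I -> bool) l :
  p l -> filtered (tensor_class S p) (S l).
Proof.
move=> pl; apply: filtered_one; exists l, 1%N.
by split; [|apply: mod_iso_pow1].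
Qed.

Lemma filtered_pow (I : Type) (S : I -> fdmod A) (p : I -> bool) M n :
  filtered (tensor_class S p) M -> filtered (tensor_class S p) (pow_mod M n).
Proof.
move=> FM; elim: n => [|n IHn]; first exact/filtered_zero/(@zero_mod_zero _ A).
exact: filtered_ext (sum_ses _ _) FM IHn.
Qed.

(** The members of [s] are treated from the head on. Once Ext^1(S l, -) has been killed, the later
    extensions add only factors S x with r l x, and these do not revive it. *)
Lemma universal_extensions (I : eqType) (S : I -> fdmod A) (r : rel I) s M :
  (forall x, ext1_zero (S x) (S x)) ->
  (forall x y, r x y -> ext1_zero (S x) (S y)) -> pairwise r s ->
  exists X F (f : 'Hom(M, X)) (g : 'Hom(X, F)),
    [/\ short_exact f g, filtered (tensor_class S (fun x => x \in s)) F
      & forall x, x \in s -> ext1_zero (S x) X].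
Proof.
move=> Sid Sr; elim: s M => [|l s IHs] M /=.
  move=> _; exists M, (zero_mod A), \1%VF, 0.
  have Z0 := @zero_mod_zero _ A; split=> //; last exact: filtered_zero.
  apply: mod_iso_ses Z0; first exact: HomA1.
  by exists id => x; rewrite id_lfunE.
case/andP=> /allP ls sp; have [n [M1 [f [g [fg lM1]]]]] := universal_extension M (Sid l).
have [X [F [f' [g' [fg' FF sX]]]]] := IHs M1 sp.
have [W [p [a [b [fp ab]]]]] := ses_trans fg fg'.
exists X, W, (f' \o f)%VF, p; split=> // [|x].
  apply: filtered_ext ab _ _.
    by apply/filtered_one/tensor_class_pow; rewrite inE eqxx.
  apply: filtered_sub FF => Y [x [m [xs Yx]]].
  by exists x, m; split=> //; rewrite inE; apply/orP; right.
rewrite inE => /predU1P[->|/sX//]; apply: ext1_zero_extr fg' lM1 _.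
refine (filtered_tensor_ind (C := ext1_zero (S l)) _ _ _ FF)
  => [N|B V U h h' hh|y /ls/Sr//].
  exact: ext1_zero0r.
exact: ext1_zero_extr hh.
Qed.

Variables (d : Order.disp_t) (L : finPOrderType d) (Delta : L -> fdmod A).
Hypothesis Dqh : split_quasi_hereditary Delta.

Lemma standard_hom l m (f : 'Hom(Delta l, Delta m)) :
  f \in HomA (Delta l) (Delta m) -> f != 0 -> (l <= m)%O.
Proof.
move=> fA f0; case: Dqh => Dh _ _; apply: Dh; apply: contra_neq f0 => D0.
by move: fA; rewrite D0 memv0 => /eqP.
Qed.

(** Every map C(l) -> Delta(m) is zero: a factor Delta(m') of C(l) has l < m', and a nonzero map to
    Delta(m) would force m' <= m. *)
Lemma ext1_standard l m : ~~ (l < m)%O -> ext1_zero (Delta l) (Delta m).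
Proof.
move=> lm; have [_ _ [Pr [Pp Cs _]]] := Dqh.
have [C [f [g [fg FC]]]] := Cs l.
apply: (ext1_zero_of_proj (Pp l) fg) => h hA.
suff -> : h = 0 by exists 0; rewrite ?HomA0 // comp_lfun0l.
move: h hA; refine (filtered_tensor_ind (C := fun C => forall h : 'Hom(C, Delta m),
  h \in HomA C (Delta m) -> h = 0) _ _ _ FC) => [M M0 h _|B V U i p ip HB HU h hA|].
- exact: is_zero_mod_hom (or_introl M0).
- have [iA _ _ _ _] := (short_exactP i p).1 ip.
  have [u uA <-] := factor_coker ip hA (HB _ (HomA_comp hA iA)).
  by rewrite (HU u uA) comp_lfun0l.
- move=> m' lm' h hA; apply/eqP; apply: contraNT lm => h0.
  exact: Order.POrderTheory.lt_le_trans lm' (standard_hom hA h0).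
Qed.

Lemma standard_extension (p : pred L) M :
  exists X F (f : 'Hom(M, X)) (g : 'Hom(X, F)),
    [/\ short_exact f g, filtered (tensor_class Delta p) F
      & forall l, p l -> ext1_zero (Delta l) X].
Proof.
(* Counting the elements above l and sorting increasingly puts larger weights first: x < y implies h
   y < h x, so no x precedes a y with x < y. *)
pose h (l : L) := #|[set m : L | (l < m)%O]|.
pose s := sort (fun x y => h x <= h y)%N [seq l <- enum L | p l].
have sE l : (l \in s) = p l by rewrite mem_sort mem_filter mem_enum andbT.
have [|||X [F [f [g [fg FF sX]]]]] :=
    @universal_extensions _ Delta (fun x y => ~~ (x < y)%O) s M.
- by move=> x; apply: ext1_standard; rewrite Order.POrderTheory.ltxx.
- exact: ext1_standard.
- apply: (@sub_pairwise _ (fun x y => h x <= h y)%N) => [x y|].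
    rewrite leqNgt; apply: contra => xy; apply/proper_card/properP; split.
      by apply/subsetP => z; rewrite !inE; apply: Order.POrderTheory.lt_trans.
    by exists y; rewrite !inE ?Order.POrderTheory.ltxx.
  rewrite -sorted_pairwise; last by move=> x y z; apply: leq_trans.
  by apply: sort_sorted => x y; apply: leq_total.
exists X, F, f, g; split=> // [|l pl]; last by apply: sX; rewrite sE.
apply: filtered_sub FF => Y [x [m [xs Yx]]]; exists x, m; split=> //.
by rewrite -sE.
Qed.

(** Salce's trick: for a projective P with kernel B over M, B is embedded in an X with
    Ext^1(Delta(l), X) = 0 and quotient F in F(Delta~). The pushout W is then an extension of M by X
    and also of F by P, and P lies in F(Delta~). *)
Lemma standard_precover M :
  exists X W (f : 'Hom(X, W)) (g : 'Hom(W, M)),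
    [/\ short_exact f g, filt_class Delta W
      & forall l, ext1_zero (Delta l) X].
Proof.
have [_ _ [Pr [Pp Cs [_ gen]]]] := Dqh.
have FP l : filt_class Delta (Pr l).
  have [C [f [g [fg FC]]]] := Cs l; apply: filtered_ext fg _ _.
    by apply: filtered_sub FC => Y [x [m [_ Yx]]]; exists x, m.
  exact: filtered_tensor.
have [n [p pA /limg_fullP ps]] := gen M.
have [B [i ip]] := ker_ses pA ps.
have [X [F [f [g [fg FF lX]]]]] := standard_extension xpredT B.
have [W [a [b [c [e [ab ce]]]]]] := pushout_ses ip fg.
exists X, W, a, b; split=> // [|l]; last exact: lX.
apply: filtered_ext ce _ FF; apply: filtered_pow.
elim: (enum L) => [|l s IHs] /=; first exact/filtered_zero/(@zero_mod_zero _ A).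
exact: filtered_ext (sum_ses _ _) (FP l) IHs.
Qed.

End SplitQuasiHereditary.

(** * Duality between A and A^op *)

Section Pairings.
Variable k : fieldType.
Implicit Types U V W : vectType k.

Lemma linear_map0 U V (f : U -> V) : linear f -> f 0 = 0.
Proof. by move=> fL; rewrite -(linfun_linearE fL) linear0. Qed.

Lemma linear_mapB U V (f : U -> V) x y : linear f -> f (x - y) = f x - f y.
Proof. by move=> fL; rewrite -!(linfun_linearE fL) linearB. Qed.

(** Only non-degeneracy on both sides is asked; in finite dimension it already represents every
    functional, see [perfect_repr]. *)
Definition perfect U V (b : U -> V -> k^o) :=
  [/\ forall v, linear (b^~ v), forall u, linear (b u),
      forall u, (forall v, b u v = 0) -> u = 0
    & forall v, (forall u, b u v = 0) -> v = 0].

Lemma perfect_flip U V (b : U -> V -> k^o) :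
  perfect b -> perfect (fun v u => b u v).
Proof. by case. Qed.

Fact dim_dual U : \dim (fullv : {vspace 'Hom(U, k^o)}) = \dim (fullv : {vspace U}).
Proof. by rewrite !dimvf /dim /= muln1. Qed.

Lemma perfect_dim U V (b : U -> V -> k^o) : perfect b ->
  (\dim (fullv : {vspace V}) <= \dim (fullv : {vspace U}))%N.
Proof.
case=> bl br _ b0; rewrite -(dim_dual U).
pose t (v : V) : 'Hom(U, k^o) := linfun (b^~ v).
have tE v u : t v u = b u v by rewrite linfun_linearE.
have tL : linear t.
  move=> c x y; apply/lfunP => u.
  by rewrite add_lfunE scale_lfunE !tE br.
rewrite -(@limg_dim_eq _ _ _ (linfun t) fullv).
  exact/dimvS/subvf.
apply/eqP; rewrite -subv0; apply/subvP => v; rewrite memv_cap memv_ker => /andP[_].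
rewrite linfun_linearE // memv0 => /eqP/lfunP t0; apply/eqP/b0 => u.
by rewrite -tE t0 lfunE.
Qed.

Lemma perfect_repr U V (b : U -> V -> k^o) (phi : 'Hom(U, k^o)) :
  perfect b -> exists v, forall u, b u v = phi u.
Proof.
move=> pb; have [bl br _ b0] := pb.
pose t (v : V) : 'Hom(U, k^o) := linfun (b^~ v).
have tE v u : t v u = b u v by rewrite linfun_linearE.
have tL : linear t.
  move=> c x y; apply/lfunP => u.
  by rewrite add_lfunE scale_lfunE !tE br.
have : limg (linfun t) = fullv.
  apply/eqP; rewrite eqEdim subvf /= limg_dim_eq.
    by rewrite dim_dual (perfect_dim (perfect_flip pb)).
  apply/eqP; rewrite -subv0; apply/subvP => v; rewrite memv_cap memv_ker => /andP[_].
  rewrite linfun_linearE // memv0 => /eqP/lfunP t0; apply/eqP/b0 => u.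
  by rewrite -tE t0 lfunE.
move/limg_fullP/(_ phi) => [v vE]; exists v => u.
by rewrite -vE (linfun_linearE tL) tE.
Qed.

Lemma perfect_adjoint U V U' V' (b : U -> V -> k^o) (b' : U' -> V' -> k^o)
    (f : 'Hom(U, U')) : perfect b -> perfect b' ->
  exists g : 'Hom(V', V), forall u v, b' (f u) v = b u (g v).
Proof.
move=> pb [bl' br' _ _]; have [bl br _ b0] := pb.
have rep v : exists w : V,
    linfun (b^~ w : U -> k^o) == linfun ((b'^~ v : U' -> k^o) \o f).
  have L : linear ((b'^~ v : U' -> k^o) \o f) by move=> c x y; rewrite /= linearP bl'.
  have [w wE] := perfect_repr (linfun ((b'^~ v : U' -> k^o) \o f)) pb.
  by exists w; apply/eqP/lfunP => u; rewrite linfun_linearE // wE.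
pose g v := xchoose (rep v).
have gE u v : b' (f u) v = b u (g v).
  have L : linear ((b'^~ v : U' -> k^o) \o f) by move=> c x y; rewrite /= linearP bl'.
  by have /eqP/lfunP/(_ u) := xchooseP (rep v); rewrite !linfun_linearE.
have gL : linear g.
  move=> c x y; apply/subr0_eq/b0 => u.
  rewrite (linear_mapB _ _ (br u)) br -!gE.
  by rewrite br' subrr.
by exists (linfun g) => u v; rewrite linfun_linearE.
Qed.

(** Injectivity is non-degeneracy; preimages are vectors representing functionals built with a
    pseudo-inverse of [f] or [g]. *)
Lemma perfect_ses U1 U2 U3 V1 V2 V3
    (b1 : U1 -> V1 -> k^o) (b2 : U2 -> V2 -> k^o) (b3 : U3 -> V3 -> k^o)
    (f : 'Hom(U1, U2)) (g : 'Hom(U2, U3)) (f' : 'Hom(V2, V1)) (g' : 'Hom(V3, V2)) :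
  perfect b1 -> perfect b2 -> perfect b3 ->
  (forall u v, b2 (f u) v = b1 u (f' v)) ->
  (forall u v, b3 (g u) v = b2 u (g' v)) ->
  (forall x, f x = 0 -> x = 0) ->
  ((g \o f)%VF = 0 /\ (forall y, g y = 0 -> exists x, f x = y)) ->
  (forall z, exists y, g y = z) ->
  [/\ forall x, g' x = 0 -> x = 0,
      (f' \o g')%VF = 0 /\ (forall y, f' y = 0 -> exists x, g' x = y)
    & forall z, exists y, f' y = z].
Proof.
move=> p1 p2 p3 ff gg f0 [/comp_eq0P gf kg] gs.
have [l1 r1 nl1 nr1] := p1; have [l2 r2 nl2 nr2] := p2; have [l3 r3 nl3 nr3] := p3.
have z1 u : b1 u 0 = 0 by apply: linear_map0.
have z2 u : b2 u 0 = 0 by apply: linear_map0.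
have z3 v : b3 0 v = 0 by apply: (linear_map0 (l3 v)).
have z2' v : b2 0 v = 0 by apply: (linear_map0 (l2 v)).
split=> [v g'v||v].
- by apply: nr3 => u; have [u' <-] := gs u; rewrite gg g'v z2.
- split=> [|v f'v]; first by apply/comp_eq0P => v; apply: nr1 => u; rewrite -ff -gg gf z3.
  pose phi := (linfun (b2^~ v) \o g^-1)%VF.
  have [w wE] := perfect_repr phi p3; exists w.
  apply/subr0_eq/nr2 => u.
  rewrite (linear_mapB _ _ (r2 u)) -gg wE comp_lfunE linfun_linearE //.
  rewrite -(linear_mapB _ _ (l2 v)).
  have [|x xE] := kg ((g^-1)%VF (g u) - u).
    by rewrite linearB /= limg_lfunVK ?subrr // memv_img ?memvf.
  by rewrite -xE ff f'v z1.
- pose phi := (linfun (b1^~ v) \o f^-1)%VF.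
  have [w wE] := perfect_repr phi p2; exists w; apply/subr0_eq/nr1 => u.
  rewrite (linear_mapB _ _ (r1 u)) -ff wE comp_lfunE linfun_linearE //.
  rewrite lker0_lfunK ?subrr //.
  exact/eqP/lker_eq0P.
Qed.

End Pairings.

Section ModuleDuality.
Variables (k : fieldType) (A : fdalg k).
Implicit Types M N : fdmod A.
Implicit Types X Y : fdmod (opp_alg A).

(* A double dual is a module over opp_alg (opp_alg A), which is not convertible
   to A; pairings between A-modules and A^op-modules avoid double duals. *)
Definition dual_pair M X (b : M -> X -> k^o) :=
  perfect b /\ forall (a : A) x y, b (mact a x) y = b x (mact (a : opp_alg A) y).

Fact functionals_separate (V : vectType k) (x : V) :
  (forall f : 'Hom(V, k^o), f x = 0) -> x = 0.
Proof.
move=> fx; rewrite (coord_vbasis (memvf x)); apply: big1 => i _.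
have := fx (linfun (coord (vbasis fullv) i : V -> k^o)).
by rewrite linfun_linearE => [->|c y z]; rewrite ?scale0r ?linearP.
Qed.

Lemma dual_mod_pair M : dual_pair (fun (x : M) (f : dual_mod M) => f x).
Proof.
split; last by move=> a x f; rewrite /= comp_lfunE lfunE.
split=> [f c x y|x c f g|x /functionals_separate//|f f0].
- exact: linearP.
- by rewrite add_lfunE scale_lfunE.
- by apply/lfunP => x; rewrite f0 lfunE.
Qed.

Fact act_linfunE X (a : opp_alg A) (x : X) :
  linfun (@mact k (opp_alg A) X a) x = mact a x.
Proof. exact: (linfun_linearE (@mact_linear_r k (opp_alg A) X a)). Qed.

Definition codual_mod X : fdmod A.
Proof.
refine (@FDMod k A 'Hom(X, k^o)
  (fun (a : A) f => (f \o linfun (@mact k (opp_alg A) X (a : opp_alg A)))%VF) _ _ _ _).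
- by move=> f; apply/lfunP=> x; rewrite comp_lfunE act_linfunE (@mact1 k (opp_alg A)).
- move=> a b f; apply/lfunP=> x; rewrite !comp_lfunE !act_linfunE.
  by rewrite -(@mactM k (opp_alg A)).
- by move=> a c f g; rewrite comp_lfunDl -comp_lfunZl.
- move=> f c a b; apply/lfunP=> x; rewrite add_lfunE scale_lfunE !comp_lfunE.
  by rewrite !act_linfunE (@mact_linear_l k (opp_alg A)) linearP.
Defined.

Lemma codual_mod_pair X : dual_pair (fun (f : codual_mod X) (x : X) => f x).
Proof.
split; last by move=> a f x; rewrite /= comp_lfunE act_linfunE.
split=> [x c f g|f c x y|f f0|x /functionals_separate//].
- by rewrite add_lfunE scale_lfunE.
- exact: linearP.
- by apply/lfunP => x; rewrite f0 lfunE.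
Qed.

Section Adjoints.
Variables (M N : fdmod A) (X Y : fdmod (opp_alg A)).
Variables (b : M -> X -> k^o) (c : N -> Y -> k^o).
Hypotheses (pb : dual_pair b) (pc : dual_pair c).

Lemma dual_pair_adjoint (f : 'Hom(M, N)) : f \in HomA M N ->
  exists2 g : 'Hom(Y, X), g \in HomA Y X & forall x y, c (f x) y = b x (g y).
Proof.
move=> fA; have [[bl br bn0 b0] ba] := pb; have [_ ca] := pc.
have [g gE] := perfect_adjoint f pb.1 pc.1; exists g => //.
apply/mem_HomA => a y; apply/subr0_eq/b0 => x.
by rewrite (linear_mapB _ _ (br x)) -gE -ca -ba -gE HomA_act // subrr.
Qed.

Lemma dual_pair_coadjoint (g : 'Hom(Y, X)) : g \in HomA Y X ->
  exists2 f : 'Hom(M, N), f \in HomA M N & forall x y, c (f x) y = b x (g y).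
Proof.
move=> gA; have [_ ba] := pb; have [[cl cr c0 _] ca] := pc.
have [f fE] := perfect_adjoint g (perfect_flip pc.1) (perfect_flip pb.1).
exists f => //; apply/mem_HomA => a x; apply/subr0_eq/c0 => y.
by rewrite (linear_mapB _ _ (cl y)) -fE ca -fE ba HomA_act // subrr.
Qed.

End Adjoints.

Lemma dual_ses M1 M2 M3 X1 X2 X3 (b1 : M1 -> X1 -> k^o) (b2 : M2 -> X2 -> k^o)
    (b3 : M3 -> X3 -> k^o) (f : 'Hom(M1, M2)) (g : 'Hom(M2, M3)) :
  dual_pair b1 -> dual_pair b2 -> dual_pair b3 -> short_exact f g ->
  exists (f' : 'Hom(X2, X1)) (g' : 'Hom(X3, X2)),
    [/\ short_exact g' f', forall x y, b2 (f x) y = b1 x (f' y)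
      & forall x y, b3 (g x) y = b2 x (g' y)].
Proof.
move=> p1 p2 p3 fg; have [fA gA f0 kfg gs] := (short_exactP f g).1 fg.
have [f' fA' ff'] := dual_pair_adjoint p1 p2 fA.
have [g' gA' gg'] := dual_pair_adjoint p2 p3 gA.
exists f', g'; split=> //; apply/short_exactP.
by have [? ? ?] := perfect_ses p1.1 p2.1 p3.1 ff' gg' f0 kfg gs.
Qed.

Lemma codual_ses M1 M2 M3 X1 X2 X3 (b1 : M1 -> X1 -> k^o) (b2 : M2 -> X2 -> k^o)
    (b3 : M3 -> X3 -> k^o) (f : 'Hom(X1, X2)) (g : 'Hom(X2, X3)) :
  dual_pair b1 -> dual_pair b2 -> dual_pair b3 -> short_exact f g ->
  exists (f' : 'Hom(M2, M1)) (g' : 'Hom(M3, M2)),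
    [/\ short_exact g' f', forall x y, b1 (f' x) y = b2 x (f y)
      & forall x y, b2 (g' x) y = b3 x (g y)].
Proof.
move=> p1 p2 p3 fg; have [fA gA f0 kfg gs] := (short_exactP f g).1 fg.
have [f' fA' ff'] := dual_pair_coadjoint p2 p1 fA.
have [g' gA' gg'] := dual_pair_coadjoint p3 p2 gA.
exists f', g'; split=> //; apply/short_exactP.
have [q1 q2 q3] := And3 (perfect_flip p1.1) (perfect_flip p2.1) (perfect_flip p3.1).
by have [] := perfect_ses q1 q2 q3 (fun u v => esym (ff' v u))
  (fun u v => esym (gg' v u)) f0 kfg gs.
Qed.

Lemma dual_pair_iso M N X (b : M -> X -> k^o) (c : N -> X -> k^o) :
  dual_pair b -> dual_pair c -> mod_iso M N.
Proof.
move=> pb pc; have [f fA fE] := dual_pair_coadjoint pb pc (HomA1 X).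
have [g gA gE] := dual_pair_coadjoint pc pb (HomA1 X).
have [[[bl _ b0 _] _] [[cl _ c0 _] _]] := (pb, pc).
apply/mod_isoP; exists f, g; split=> //; apply/lfunP => x; apply/subr0_eq.
  by apply: c0 => y; rewrite (linear_mapB _ _ (cl y)) comp_lfunE fE id_lfunE
    gE !id_lfunE subrr.
by apply: b0 => y; rewrite (linear_mapB _ _ (bl y)) comp_lfunE gE id_lfunE
  fE !id_lfunE subrr.
Qed.

Lemma dual_pair_zero M X (b : M -> X -> k^o) :
  dual_pair b -> is_zero_mod X -> is_zero_mod M.
Proof.
move=> [[_ br b0 _] _] X0 x; apply: b0 => y.
by rewrite (X0 y) (linear_map0 (br x)).
Qed.

(** Duality turns extending a map along the kernel of a projective presentation of M into lifting
    its transpose along a surjection with kernel X. *)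
Lemma dual_pair_ext1 M N X Y (b : M -> X -> k^o) (c : N -> Y -> k^o) :
  dual_pair b -> dual_pair c -> ext1_zero Y X -> ext1_zero M N.
Proof.
move=> pb pc YX; have [B [V [i [p [Vp ip]]]]] := free_ses M.
apply: (ext1_zero_of_proj Vp ip) => f fA.
have [pB pV] := (dual_mod_pair B, dual_mod_pair V).
have [i' [p' [pi' iE _]]] := dual_ses pB pV pb ip.
have [f' fA' fE] := dual_pair_adjoint pB pc fA.
have [g' gA' gE] := ext1_zero_lift YX pi' fA'.
have [g gA gE'] := dual_pair_coadjoint pV pc gA'.
exists g => //; have [[cl _ c0 _] _] := pc.
apply/lfunP => x; apply/subr0_eq/c0 => y.
by rewrite (linear_mapB _ _ (cl y)) fE comp_lfunE gE' iE -gE comp_lfunE subrr.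
Qed.

Lemma filtered_codual (I : Type) (S : I -> fdmod A) (p : I -> bool) X :
  filtered (tensor_class (fun l => dual_mod (S l)) p) X ->
  forall M (b : M -> X -> k^o), dual_pair b -> filtered (tensor_class S p) M.
Proof.
move=> FX; refine (filtered_tensor_ind (C := fun X => forall M (b : M -> X -> k^o),
  dual_pair b -> filtered (tensor_class S p) M) _ _ _ FX).
- by move=> Y Y0 M b pb; apply/filtered_zero/(dual_pair_zero pb).
- move=> X1 X2 X3 f g fg H1 H3 M b pb.
  have [p1 p3] := (codual_mod_pair X1, codual_mod_pair X3).
  have [f' [g' [gf _ _]]] := codual_ses p1 pb p3 fg.
  exact: filtered_ext gf (H3 _ _ p3) (H1 _ _ p1).
- move=> l pl M b pb; apply: (@filtered_iso _ _ _ (S l)).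
    exact: dual_pair_iso (dual_mod_pair _) pb.
  exact: filtered_tensor.
Qed.

Variables (d : Order.disp_t) (L : finPOrderType d) (Nabla : L -> fdmod A).
Hypothesis Nqh : split_quasi_hereditary (fun l => dual_mod (Nabla l)).

Lemma costandard_hom l m (f : 'Hom(Nabla l, Nabla m)) :
  f \in HomA (Nabla l) (Nabla m) -> f != 0 -> (m <= l)%O.
Proof.
move=> fA f0; have [p q] := (dual_mod_pair (Nabla l), dual_mod_pair (Nabla m)).
have [g gA gE] := dual_pair_adjoint p q fA.
apply: (standard_hom Nqh gA); apply: contra_neq f0 => g0.
apply/lfunP => x; rewrite lfunE; apply/functionals_separate => y.
by rewrite gE g0 !lfunE.
Qed.

Lemma costandard_end l (f : 'Hom(Nabla l, Nabla l)) :
  f \in HomA (Nabla l) (Nabla l) -> exists c, f = c *: \1%VF.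
Proof.
move=> fA; have p := dual_mod_pair (Nabla l).
have [g gA gE] := dual_pair_adjoint p p fA.
have [_ /(_ l)[phi [/bij_inj phi_inj phi1 _]] _] := Nqh.
pose c : k := phi (vsproj _ g : end_alg (dual_mod (Nabla l))).
exists c; apply/lfunP => x; apply/subr0_eq/functionals_separate => y.
have gc : g = c *: \1%VF.
  have E : vsproj _ g = c *: aone (end_alg (dual_mod (Nabla l))).
    apply: phi_inj; rewrite linearZ /= phi1.
    by transitivity (c * 1 : k); [rewrite mulr1|].
  move/(congr1 vsval): E; rewrite linearZ /= !vsprojK //.
  exact: (HomA1 (dual_mod (Nabla l))).
have gy : g y = c *: y by rewrite gc scale_lfunE id_lfunE.
rewrite linearB [X in X - _](gE x y) gy scale_lfunE [in X in _ - X]scale_lfunE.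
by rewrite id_lfunE linearZ subrr.
Qed.

(** Extending D Nabla(l) universally by the D Nabla(m) with m < l kills Ext^1 from these. For any
    other m nothing arises: a nonzero Ext^1 from D Nabla(m) to D Nabla(l), or to an added factor D
    Nabla(m') with m' < l, would force m < l. *)
Lemma costandard_coextension l :
  exists (K Y : fdmod A) (i : 'Hom(K, Y)) (p : 'Hom(Y, Nabla l)),
    [/\ short_exact i p, filtered (tensor_class Nabla (fun m => (m < l)%O)) K
      & forall m, ext1_zero Y (Nabla m)].
Proof.
have [X [F [f [g [fg FF lX]]]]] :=
  standard_extension Nqh (fun m => (m < l)%O) (dual_mod (Nabla l)).
have [pN pX pF] := And3 (dual_mod_pair (Nabla l)) (codual_mod_pair X)
  (codual_mod_pair F).
have [f' [g' [gf _ _]]] := codual_ses pN pX pF fg.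
exists (codual_mod F), (codual_mod X), g', f'; split=> // [|m].
  exact: filtered_codual FF _ _ pF.
apply: dual_pair_ext1 pX (dual_mod_pair _) _.
case: (boolP (m < l)%O) => [/lX//|ml].
apply: ext1_zero_extr fg (ext1_standard Nqh ml) _.
refine (filtered_tensor_ind (C := ext1_zero (dual_mod (Nabla m))) _ _ _ FF).
- by move=> N; apply: ext1_zero0r.
- by move=> B V U h h' hh; apply: ext1_zero_extr hh.
- move=> m' m'l; apply: (ext1_standard Nqh); apply: contra ml => mm'.
  exact: Order.POrderTheory.lt_trans mm' m'l.
Qed.

End ModuleDuality.

(** * The Ringel dual *)

Section Retracts.
Variables (k : fieldType) (A : fdalg k).
Implicit Types M N X Y U V B W P K : fdmod A.

Lemma in_add_retract M N (i : 'Hom(M, N)) (p : 'Hom(N, M)) :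
  i \in HomA M N -> p \in HomA N M -> (p \o i)%VF = \1%VF -> in_add N M.
Proof. by move=> iA pA pi; apply/in_addP/(factors_retract _ iA pA pi). Qed.

Lemma in_add_bigsum (I : eqType) (F : I -> fdmod A) s l :
  l \in s -> in_add (bigsum_mod [seq F x | x <- s]) (F l).
Proof.
elim: s => //= x s IHs; rewrite inE => /predU1P[->|/IHs Fl].
  apply: in_add_retract (sum_inlP _ _) (sum_fstP _ _) _.
  by apply/lfunP => z; rewrite comp_lfunE sum_inlE sum_fstE id_lfunE.
apply: in_add_trans Fl; apply: in_add_retract (sum_inrP _ _) (sum_sndP _ _) _.
by apply/lfunP => z; rewrite comp_lfunE sum_inrE sum_sndE id_lfunE.
Qed.

Lemma end_alg_ground M : \1%VF != 0 :> 'Hom(M, M) ->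
  (forall f, f \in HomA M M -> exists c, f = c *: \1%VF) ->
  alg_iso (end_alg M) (ground_alg k).
Proof.
move=> M0 Mc.
have id0 : hom_id M != 0.
  apply: contra M0 => /eqP/(congr1 vsval).
  by rewrite linear0 vsprojK ?HomA1 // => ->.
pose E := subvs_of (HomA M M).
have ex (e : E) : exists c : k, e == c *: hom_id M.
  have [c cE] := Mc _ (subvsP e); exists c; apply/eqP/subvs_inj.
  by rewrite linearZ /= vsprojK ?HomA1.
pose f (e : E) : k := xchoose (ex e).
have fE (e : E) : e = f e *: hom_id M by apply/eqP/(xchooseP (ex e)).
have inj (a b : k) : a *: hom_id M = b *: hom_id M -> a = b.
  move/eqP; rewrite -subr_eq0 -scalerBl scaler_eq0 (negPf id0) orbF subr_eq0.
  by move/eqP.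
have fL : linear (f : E -> k^o).
  move=> c x y; apply: inj; rewrite -fE {1}[x]fE {1}[y]fE scalerA -scalerDl.
  by [].
have fV (c : k) : f (c *: hom_id M) = c by apply: inj; rewrite -fE.
exists (linfun (f : E -> k^o)); split.
- exists (fun c : k => c *: hom_id M) => x; rewrite (linfun_linearE fL).
    by rewrite -fE.
  by rewrite fV.
- by rewrite (linfun_linearE fL); apply: inj; rewrite -fE scale1r.
move=> a b; rewrite !(linfun_linearE fL); apply: inj.
rewrite -fE.
suff E1 : hom_comp (f a *: hom_id M) (f b *: hom_id M) =
    f a *: (f b *: hom_id M).
  by rewrite {1}[a]fE {1}[b]fE [LHS]E1 scalerA.
by apply: subvs_inj; rewrite hom_compE !linearZ /= -comp_lfunZl comp_lfunZr
    vsprojK ?HomA1 // comp_lfun1l.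
Qed.

(** The stretch Hom(U, V) -> Hom(U, W) -> Ext^1(U, B) -> Ext^1(U, V) of the long exact sequence. *)
Lemma ext1_zero_ker U B V W (i : 'Hom(B, V)) (p : 'Hom(V, W)) :
  short_exact i p -> ext1_zero U V ->
  (forall f, f \in HomA U W -> exists2 g, g \in HomA U V & (p \o g)%VF = f) ->
  ext1_zero U B.
Proof.
move=> ip UV lift; have [K [P [j [q [Pp jq]]]]] := free_ses U.
apply: (ext1_zero_of_proj Pp jq) => f fA.
have [iA pA i0 [pi _] _] := (short_exactP i p).1 ip.
have [jA qA _ [qj _] _] := (short_exactP j q).1 jq.
have [g gA gj] := ext1_zero_extend UV jq (HomA_comp iA fA).
have [|u uA uq] := factor_coker jq (HomA_comp pA gA).
  by rewrite -comp_lfunA gj comp_lfunA pi comp_lfun0l.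
have [h hA ph] := lift u uA.
have ghA : g - (h \o q)%VF \in HomA P V by rewrite memvB // HomA_comp.
have [|b bA ib] := factor_ker ip ghA.
  by rewrite comp_lfunDr comp_lfunNr comp_lfunA ph uq subrr.
exists b => //; apply/lfunP => x; apply/subr0_eq/i0.
rewrite linearB /= -!comp_lfunE comp_lfunA ib comp_lfunDl comp_lfunNl gj.
by rewrite -comp_lfunA qj comp_lfun0r subr0 subrr.
Qed.

End Retracts.

Section RingelDual.
Variables (k : fieldType) (A : fdalg k).
Implicit Types M N X Y U V B W P K : fdmod A.
Variables (d : Order.disp_t) (L : finPOrderType d).
Variables (Delta Nabla : L -> fdmod A) (T : fdmod A).
Hypothesis Delta_qh : split_quasi_hereditary Delta.
Hypothesis Nabla_co : costandard Delta Nabla.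
Hypothesis T_tilting : characteristic_tilting Delta Nabla T.

Local Notation H := (hom_mod T).
Local Notation Hf := (hom_map T).

Lemma costandard_ext1 M X :
  filt_class Delta M -> filt_class Nabla X -> ext1_zero M X.
Proof.
move=> FM FX; have [_ /(_ X)[/(_ FX) MX _] _ _] := Nabla_co.
exact/ext1_of_ext_zero/MX.
Qed.

Lemma costandard_class X : (forall l, ext1_zero (Delta l) X) -> filt_class Nabla X.
Proof.
move=> lX; have [_ /(_ X)[_ FX] _ _] := Nabla_co; apply: FX => M FM.
apply/ext_zero_of_ext1/filtered_ext1_zero/FM => l _; exact: lX.
Qed.

Lemma standard_class l : filt_class Delta (Delta l).
Proof. exact: filtered_tensor. Qed.

Lemma tilting_standard Y : in_add T Y -> filt_class Delta Y.
Proof. by case: T_tilting => _ TP /TP[]. Qed.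

Lemma tilting_costandard Y : in_add T Y -> filt_class Nabla Y.
Proof. by case: T_tilting => _ TP /TP[]. Qed.

Lemma tilting_ext1 Y X : in_add T Y -> filt_class Nabla X -> ext1_zero Y X.
Proof. by move=> /tilting_standard; apply: costandard_ext1. Qed.

(* The indecomposable summand T(l) is not singled out: Y is a direct sum of
   T(l) and other tilting modules. *)
Lemma costandard_tilting_cover l :
  exists Y K (i : 'Hom(K, Y)) (p : 'Hom(Y, Nabla l)),
    [/\ short_exact i p, filtered (tensor_class Nabla (fun m => (m < l)%O)) K
      & in_add T Y].
Proof.
have [Nqh _ _ _] := Nabla_co.
have [K [Y [i [p [ip FK lY]]]]] := costandard_coextension Nqh l.
exists Y, K, i, p; split=> //.
have FN : filt_class Nabla Y.
  apply: filtered_ext ip _ (filtered_tensor _ _) => //.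
  by apply: filtered_sub FK => Z [m [n [_ Zm]]]; exists m, n.
have [X [W [f [g [fg FW lX]]]]] := standard_precover Delta_qh Y.
have FX := costandard_class lX.
have [_ TP] := T_tilting.
have TW : in_add T W by apply/TP; split=> //; apply: filtered_ext fg FX FN.
have YX : ext1_zero Y X.
  refine (filtered_tensor_ind (C := ext1_zero Y) _ _ _ FX) => //.
    by move=> N; apply: ext1_zero0r.
  by move=> B V U h h' hh; apply: ext1_zero_extr hh.
have [s sA gs] := ext1_zero_lift YX fg (HomA1 Y).
apply: in_add_trans TW _; apply: in_add_retract sA _ gs.
by have [] := (short_exactP f g).1 fg.
Qed.

(** * Generating tilting modules from covers of the costandard modules *)

Section Generation.
Variable S : fdmod A -> Prop.
Hypothesis S_tilting : forall Y, S Y -> in_add T Y.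
Hypothesis S_cover : forall l, exists Y K (i : 'Hom(K, Y)) (p : 'Hom(Y, Nabla l)),
  [/\ short_exact i p, filt_class Nabla K & S Y].

Lemma factors_tilting W : factors S (\1%VF : 'Hom(W, W)) -> in_add T W.
Proof.
move=> SW; apply/in_addP/(factors_trans _ SW) => Y /S_tilting; exact: (in_addP T Y).1.
Qed.

(** Lifting of maps from every Delta(l) replaces the condition that the kernel of [p] lie in
    F(Nabla~): it passes through extensions, and [ext1_zero_ker] recovers the kernel condition from
    it. *)
Definition covered X := exists W (p : 'Hom(W, X)),
  [/\ p \in HomA W X, forall x, exists w, p w = x,
      factors S (\1%VF : 'Hom(W, W))
    & forall l u, u \in HomA (Delta l) X ->
      exists2 v, v \in HomA (Delta l) W & (p \o v)%VF = u].

Lemma costandard_cover X : filt_class Nabla X ->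
  exists K W (i : 'Hom(K, W)) (p : 'Hom(W, X)),
    [/\ short_exact i p, filt_class Nabla K & factors S (\1%VF : 'Hom(W, W))].
Proof.
move=> FX; suff [W [p [pA ps SW lift]]] : covered X.
  have [K [i ip]] := ker_ses pA ps; exists K, W, i, p; split=> //.
  apply: costandard_class => l; apply: ext1_zero_ker ip _ (lift l).
  exact: costandard_ext1 (standard_class l) (tilting_costandard (factors_tilting SW)).
suff [] : filt_class Nabla X /\ covered X by [].
refine (filtered_tensor_ind (C := fun X => filt_class Nabla X /\ covered X)
  _ _ _ FX) => {X FX}.
- move=> X X0; split; first exact: filtered_zero.
  exists X, \1%VF; split=> [|x||l u uA]; first exact: HomA1.
  + by exists x; rewrite id_lfunE.
  + rewrite is_zero_mod_id //; exact: factors0.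
  + by exists u; rewrite ?comp_lfun1l.
- move=> X1 X X2 f g fg [F1 [W1 [p1 [pA1 ps1 SW1 lift1]]]].
  move=> [F2 [W2 [p2 [pA2 ps2 SW2 lift2]]]].
  have [fA gA f0 [gf kg] gs] := (short_exactP f g).1 fg.
  split; first exact: filtered_ext fg F1 F2.
  (* Horseshoe argument: [p2] lifts to X since Ext^1(W2, X1) = 0, so the sum of W1 and W2 covers
     X. *)
  have [t tA gt] := ext1_zero_lift (tilting_ext1 (factors_tilting SW2) F1) fg pA2.
  have [p pA pE] := sum_copair (HomA_comp fA pA1) tA.
  exists (sum_mod W1 W2), p; split=> // [x||l u uA].
  + have [w2 w2E] := ps2 (g x); have [|x1 x1E] := kg (x - t w2).
      by rewrite linearB /= -[g (t _)]comp_lfunE gt w2E subrr.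
    have [w1 w1E] := ps1 x1; exists (w1, w2).
    by rewrite pE /= comp_lfunE w1E x1E subrK.
  + rewrite -sum_decomp; apply: factors_add.
      rewrite -[sum_inl _ _]comp_lfun1r.
      by apply: factors_comp; rewrite ?sum_inlP ?sum_fstP.
    rewrite -[sum_inr _ _]comp_lfun1r.
    by apply: factors_comp; rewrite ?sum_inrP ?sum_sndP.
  + have [v2 vA2 v2E] := lift2 l _ (HomA_comp gA uA).
    have utA : u - (t \o v2)%VF \in HomA (Delta l) X by rewrite memvB // HomA_comp.
    have [|u1 uA1 u1E] := factor_ker fg utA.
      by rewrite comp_lfunDr comp_lfunNr comp_lfunA gt v2E subrr.
    have [v1 vA1 v1E] := lift1 l _ uA1.
    have [v vA vE] := sum_pair vA1 vA2.
    exists v => //; apply/lfunP => x; rewrite comp_lfunE vE pE /=.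
    by rewrite -!comp_lfunE -comp_lfunA v1E u1E add_lfunE opp_lfunE subrK.
- move=> l _; split; first exact: filtered_tensor.
  have [Y [K [i [p [ip FK SY]]]]] := S_cover l.
  have [iA pA _ _ ps] := (short_exactP i p).1 ip.
  exists Y, p; split=> // [|m u uA]; first exact: factors_id.
  by apply: ext1_zero_lift ip uA; apply: costandard_ext1 FK; apply: standard_class.
Qed.

(** T lies in F(Nabla~), so it is covered by sums of summands from S with kernel in F(Nabla~); Ext^1
    from T to that kernel vanishes and the cover splits. This takes the place of decomposing T into
    the T(l). *)
Lemma tilting_factors : factors S (\1%VF : 'Hom(T, T)).
Proof.
have TT := in_add_refl T.
have [K [W [i [p [ip FK SW]]]]] := costandard_cover (tilting_costandard TT).
have [s sA ps] := ext1_zero_lift (tilting_ext1 TT FK) ip (HomA1 T).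
have [_ pA _ _ _] := (short_exactP i p).1 ip.
by rewrite -ps -[p]comp_lfun1r; apply: factors_comp.
Qed.

End Generation.

Lemma costandard_presentation X : filt_class Nabla X ->
  exists K W (i : 'Hom(K, W)) (p : 'Hom(W, X)),
    [/\ short_exact i p, filt_class Nabla K & in_add T W].
Proof.
move=> FX; have [||K [W [i [p [ip FK SW]]]]] :=
  @costandard_cover (in_add T) _ _ X FX => //.
  move=> l; have [Y [K [i [p [ip FK TY]]]]] := costandard_tilting_cover l.
  exists Y, K, i, p; split=> //.
  by apply: filtered_sub FK => Z [m [n [_ Zm]]]; exists m, n.
exists K, W, i, p; split=> //; exact: factors_tilting SW.
Qed.

Lemma hom_costandard_faithful X Y (f : 'Hom(X, Y)) :
  filt_class Nabla X -> f \in HomA X Y -> Hf f = 0 -> f = 0.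
Proof.
move=> /costandard_presentation[K [W [i [p [ip _ TW]]]]] fA f0.
have [_ pA _ _ ps] := (short_exactP i p).1 ip.
have /comp_eq0P fp : (f \o p)%VF = 0.
  apply: hom_map_faithful TW _ _; rewrite ?HomA_comp //.
  by rewrite hom_map_comp // f0 comp_lfun0l.
by apply/lfunP => x; have [w <-] := ps x; rewrite fp lfunE.
Qed.

(** For a presentation K -> W -> X with W in add T, fullness on add T realises h o H p by some g : W
    -> Y. As H is faithful on F(Nabla~), g kills K; the induced map has image h since H p is onto,
    by Ext^1(T, K) = 0. *)
Lemma hom_costandard_full X Y (h : 'Hom(H X, H Y)) :
  filt_class Nabla X -> h \in HomA (H X) (H Y) ->
  exists2 f, f \in HomA X Y & Hf f = h.
Proof.
move=> FX hA; have [K [W [i [p [ip FK TW]]]]] := costandard_presentation FX.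
have [iA pA _ [pi _] _] := (short_exactP i p).1 ip.
have [g gA gE] := hom_map_full TW (HomA_comp hA (hom_mapP T pA)).
have [|f fA fp] := factor_coker ip gA.
  apply: (hom_costandard_faithful FK); rewrite ?HomA_comp //.
  by rewrite hom_map_comp // gE -comp_lfunA -hom_map_comp // pi hom_map0 comp_lfun0r.
exists f => //; apply/lfunP => u.
have Hip := hom_map_ses (tilting_ext1 (in_add_refl T) FK) ip.
have [_ _ _ _ Hps] := (short_exactP _ _).1 Hip; have [w <-] := Hps u.
by rewrite -!comp_lfunE -gE -hom_map_comp // fp.
Qed.

Lemma hom_costandard_filtered (p : L -> bool) X :
  filtered (tensor_class Nabla p) X ->
  filtered (tensor_class (fun l => H (Nabla l)) p) (H X).
Proof.
move=> FX; suff [] : filt_class Nabla X /\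
  filtered (tensor_class (fun l => H (Nabla l)) p) (H X) by [].
refine (filtered_tensor_ind (C := fun X => filt_class Nabla X /\
  filtered (tensor_class (fun l => H (Nabla l)) p) (H X)) _ _ _ FX) => {X FX}.
- by move=> X X0; split; apply: filtered_zero => //; apply: hom_mod_zero.
- move=> B V U f g fg [FB HB] [FU HU]; split; first exact: filtered_ext fg FB FU.
  exact: filtered_ext (hom_map_ses (tilting_ext1 (in_add_refl T) FB) fg) HB HU.
- by move=> l pl; split; apply: filtered_tensor.
Qed.

Lemma ringel_dual_split_quasi_hereditary :
  @split_quasi_hereditary k (ringel_dual T) _ (Order.dual L)
    (fun l => H (Nabla l)).
Proof.
have [Nqh _ N1 _] := Nabla_co.
have FN l : filt_class Nabla (Nabla l) by apply: filtered_tensor.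
split=> [l m Hlm|l|].
- have [h hA h0] : exists2 h, h \in HomA (H (Nabla l)) (H (Nabla m)) & h != 0.
    exists (vpick (HomA (H (Nabla l)) (H (Nabla m)))); first exact: memv_pick.
    by rewrite vpick0.
  have [f fA fE] := hom_costandard_full (FN l) hA.
  (* A nonzero map Nabla(l) -> Nabla(m) gives m <= l in L, which is l <= m in the dual order. *)
  apply: (costandard_hom Nqh fA); apply: contra_neq h0 => f0.
  by rewrite -fE f0 hom_map0.
- apply: end_alg_ground => [|h hA].
    apply/eqP => id0.
    have N0 : \1%VF = 0 :> 'Hom(Nabla l, Nabla l).
      by apply: (hom_costandard_faithful (FN l) (HomA1 _)); rewrite hom_map1.
    have := N1 l; suff -> : HomA (Delta l) (Nabla l) = 0%VS by rewrite dimv0.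
    apply/eqP; rewrite -subv0; apply/subvP => f _.
    by rewrite -[f]comp_lfun1l N0 comp_lfun0l mem0v.
  have [f fA fE] := hom_costandard_full (FN l) hA.
  have [c cE] := costandard_end Nqh fA; exists c; rewrite -fE cE.
  apply/lfunP => u; apply: subvs_inj.
  by rewrite scale_lfunE id_lfunE linearZ hom_mapE -?cE // cE -comp_lfunZl comp_lfun1l.
have [Y YP] := fin_all_exists costandard_tilting_cover.
have TY l : in_add T (Y l) by have [K [i [p []]]] := YP l.
exists (fun l => H (Y l)); split=> [l|l|].
- exact: hom_mod_projective.
- have [K [i [p [ip FK _]]]] := YP l.
  exists (H K), (Hf i), (Hf p); split; last exact: hom_costandard_filtered FK.
  apply: hom_map_ses ip; apply: tilting_ext1 (in_add_refl T) _.
  by apply: filtered_sub FK => Z [m [n [_ Zm]]]; exists m, n.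
split.
  elim: (enum _) => [|l s IHs] /=; first exact/in_add_zero/(@zero_mod_zero _ _).
  by apply: in_add_sum IHs; apply: hom_mod_projective.
move=> M; set P := bigsum_mod _.
(* The progenerator property: T is a summand of sums of the Y(l), hence HT, and with it R, lies in
   the additive closure of the sum of the H Y(l). *)
have FT : factors (fun Z => exists l, Z = Y l) (\1%VF : 'Hom(T, T)).
  apply: tilting_factors => [Z [l ->]|l]; first exact: TY.
  have [K [i [p [ip FK _]]]] := YP l; exists (Y l), K, i, p; split=> //.
    by apply: filtered_sub FK => Z [m [n [_ Zm]]]; exists m, n.
  by exists l.
have PT : in_add P (H T).
  apply/in_addP; rewrite -hom_map1.
  apply: (@factors_trans _ _ (fun Z => exists l, Z = H (Y l))); last first.
    by apply: factors_hom FT => _ [l ->]; exists l.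
  by move=> _ [l ->]; apply/in_addP; apply: in_add_bigsum; rewrite mem_enum.
have Preg := in_add_trans PT (in_add_hom_reg T).
have [p pA ps] := free_cover M.
have [n [i [r [iA rA ri]]]] := in_add_trans Preg
  (in_add_pow _ (size (vbasis (fullv : {vspace M})))).
exists n, (p \o r)%VF; first exact: HomA_comp.
apply/limg_fullP => x; have [w <-] := (limg_fullP p).1 ps x.
by exists (i w); rewrite comp_lfunE -[r _]comp_lfunE ri id_lfunE.
Qed.

End RingelDual.

(** * Comparison of Ext groups *)

Section Cone.
Variables (k : fieldType) (C : fdalg k) (P M N : fdmod C) (m : nat).
Hypothesis Pproj : projective P.
Hypothesis Pbij : forall U, projective U -> hom_bij P U N.
Hypothesis Pacy : forall U, projective U -> acyclic m (hom_mod P U) (hom_mod P N).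

Local Notation F := (hom_mod P).
Local Notation Ff := (hom_map P).

Lemma hom_bij_faithful (U V : fdmod C) (f : 'Hom(U, V)) :
  hom_bij P U V -> f \in HomA U V -> Ff f = 0 -> f = 0.
Proof.
move=> UV fA f0; have [g [_ gu]] := UV 0 (HomA0 _ _).
by rewrite -(gu f) // -(gu 0) //; split; rewrite ?HomA0 ?hom_map0.
Qed.

Lemma hom_bij_inj (U V : fdmod C) (f g : 'Hom(U, V)) : hom_bij P U V ->
  f \in HomA U V -> g \in HomA U V -> Ff f = Ff g -> f = g.
Proof.
move=> UV fA gA fg; have [h [_ hu]] := UV _ (hom_mapP P fA).
by rewrite -(hu f) // -(hu g).
Qed.

Lemma hom_bij_full (U V : fdmod C) (h : 'Hom(F U, F V)) :
  hom_bij P U V -> h \in HomA (F U) (F V) ->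
  exists2 f, f \in HomA U V & Ff f = h.
Proof. by move=> UV hA; have [f [[fA fE] _]] := UV h hA; exists f. Qed.

Variables (c : chain M) (d : chain (F M)).
Variable phi : forall i, 'Hom(ch_obj d i, F (ch_obj c i)).
Hypotheses (cP : proj_resolution c) (dP : proj_resolution d).
Hypothesis phiP : comparison phi.

(* The mapping cone of phi : d -> F c is exact with acyclic terms, so that
   Hom(cone, F N) is exact in degrees at most m + 1: this says that phi induces
   isomorphisms on the cohomology of Hom(-, F N) in degrees at most m. *)
Definition cone_obj i : fdmod (opp_alg (end_alg P)) :=
  if i is j.+1 then sum_mod (F (ch_obj c j.+1)) (ch_obj d j) else F (ch_obj c 0).

Definition cone_pair j :
    'Hom(sum_mod (F (ch_obj c j.+1)) (ch_obj d j), F (ch_obj c j)) :=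
  ((Ff (ch_map c j.+1) \o sum_fst _ _) + (phi j \o sum_snd _ _))%VF.

Definition cone_map i : 'Hom(cone_obj i.+1, cone_obj i) :=
  match i return 'Hom(cone_obj i.+1, cone_obj i) with
  | 0 => cone_pair 0
  | j.+1 => ((sum_inl _ _ \o cone_pair j.+1) -
             (sum_inr _ _ \o ch_map d j.+1 \o sum_snd _ _))%VF
  end.

Let cA i : ch_map c i \in HomA _ _ := ch_mapP c i.
Let dA i : ch_map d i \in HomA _ _ := ch_mapP d i.
Let phiA i : phi i \in HomA _ _. Proof. by case: phiP. Qed.

Lemma cone_pairP j : cone_pair j \in HomA _ _.
Proof.
by rewrite memvD ?HomA_comp ?sum_fstP ?sum_sndP ?hom_mapP ?(cA j.+1).
Qed.

Lemma cone_pairE j z : cone_pair j z = Ff (ch_map c j.+1) z.1 + phi j z.2.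
Proof. by rewrite add_lfunE !comp_lfunE sum_fstE sum_sndE. Qed.

Lemma cone_mapP i : cone_map i \in HomA _ _.
Proof.
case: i => [|j]; first exact: cone_pairP.
by rewrite memvB ?HomA_comp ?cone_pairP ?sum_inlP ?sum_inrP ?sum_sndP ?(dA j.+1).
Qed.

Lemma cone_mapE j (z : cone_obj j.+2) :
  cone_map j.+1 z = (cone_pair j.+1 z, - ch_map d j.+1 z.2).
Proof.
rewrite add_lfunE opp_lfunE !comp_lfunE sum_inlE sum_inrE sum_sndE.
by congr pair; rewrite /= ?oppr0 ?addr0 ?add0r.
Qed.

Let cex i : (Ff (ch_map c i) \o Ff (ch_map c i.+1))%VF = 0 /\
  forall y, Ff (ch_map c i) y = 0 -> exists x, Ff (ch_map c i.+1) x = y.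
Proof.
case: cP => _ /(_ i.+2)[_ /(_ i (leqnn _)) ci].
have [cc _] := (limg_lkerP _ _).1 ci.
split; first by rewrite -hom_map_comp ?cA // cc hom_map0.
have ker_sub : (lker (ch_map c i) <= limg (ch_map c i.+1))%VS by rewrite ci.
have /subvP sub := hom_map_exact Pproj (cA i.+1) (cA i) ker_sub.
move=> y yE; have /memv_imgP[x _ ->] : y \in limg (Ff (ch_map c i.+1)).
  by apply: sub; rewrite memv_ker yE.
by exists x.
Qed.

Let dex0 y : exists x, ch_map d 0 x = y.
Proof. by case: dP => _ /(_ 1%N)[/(_ isT) /limg_fullP]. Qed.

Let dex i : (ch_map d i \o ch_map d i.+1)%VF = 0 /\
  forall y, ch_map d i y = 0 -> exists x, ch_map d i.+1 x = y.
Proof. by case: dP => _ /(_ i.+2)[_ /(_ i (leqnn _)) /limg_lkerP]. Qed.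

Let phi0 x : Ff (ch_map c 0) (phi 0 x) = ch_map d 0 x.
Proof. by case: phiP => _ <- _; rewrite comp_lfunE. Qed.

Let phiS i x : Ff (ch_map c i.+1) (phi i.+1 x) = phi i (ch_map d i.+1 x).
Proof. by case: phiP => _ _ /(_ i)/lfunP/(_ x); rewrite !comp_lfunE. Qed.

Let cone_pair0 j z : cone_pair j (cone_map j.+1 z) = 0.
Proof.
rewrite cone_pairE cone_mapE /= cone_pairE lfun_appD linearN /= phiS.
by have [/comp_eq0P -> _] := cex j.+1; rewrite add0r subrr.
Qed.

Let cone_pair_ker j z : cone_pair j z = 0 -> ch_map d j z.2 = 0 ->
  exists x, cone_map j.+1 x = z.
Proof.
case: z => x y; rewrite cone_pairE /= => xy dy.
have [_ /(_ _ dy)[y' y'E]] := dex j.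
have [_ cj] := cex j.+1.
have [|x' x'E] := cj (x + phi j.+1 y').
  by rewrite lfun_appD phiS y'E.
exists (x', - y'); rewrite cone_mapE cone_pairE /= x'E !linearN /= y'E.
by rewrite addrK opprK.
Qed.

Lemma cone_exact n : exact_upto cone_map n.
Proof.
split=> [_|i _].
  apply/limg_fullP => y; have [y0 y0E] := dex0 (Ff (ch_map c 0) y).
  have [_ /(_ (y - phi 0 y0))[|x xE]] := cex 0.
    by rewrite linearB /= phi0 y0E subrr.
  by exists (x, y0); rewrite cone_pairE /= xE subrK.
apply/limg_lkerP; case: i => [|i]; split.
- by apply/comp_eq0P => z; apply: cone_pair0.
- move=> z z0; apply: cone_pair_ker (z0) _.
  have := congr1 (Ff (ch_map c 0)) z0; rewrite [cone_map 0 z]cone_pairE.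
  rewrite lfun_appD phi0 linear0; have [/comp_eq0P -> _] := cex 0.
  by rewrite add0r.
- apply/comp_eq0P => z; rewrite cone_mapE cone_pair0 cone_mapE /=.
  rewrite linearN /=; have [/comp_eq0P -> _] := dex i.+1.
  by rewrite !oppr0.
- move=> z; rewrite cone_mapE => -[z1 z2]; apply: cone_pair_ker z1 _.
  by apply/eqP; rewrite -oppr_eq0; apply/eqP.
Qed.

(** The terms are sums of F c_i, acyclic up to m because c_i is projective, and of projectives d_i;
    degree j of [acyclic_hom_exact] needs j - 1 <= m Ext groups. *)
Lemma cone_hom_exact j : (j <= m.+1)%N -> hom_exact_at cone_map (F N) j.
Proof.
move=> jm; apply: acyclic_hom_exact (cone_exact _) _; first exact: cone_mapP.
case: cP dP => cp _ [dp _] i _; apply: (@acyclic_leq _ _ _ m).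
  by case: j jm.
case: i => [|i]; first exact/Pacy/cp.
apply: acyclic_extl (sum_ses _ _) (Pacy (cp _)) _.
exact/acyclic_proj/dp.
Qed.

(** If F f o phi = g o d, then (F f, g) is a cocycle on the cone. The F c-component of a map
    bounding it shows F f to be a coboundary, and full faithfulness on projectives carries this back
    to f. *)
Lemma cone_ext_inj j (f : 'Hom(ch_obj c j, N)) : (j <= m)%N ->
  cocycle f -> coboundary (Ff f \o phi j)%VF -> coboundary f.
Proof.
move=> jm [fA fD] fcob; have [cp _] := cP.
have FD : (Ff f \o Ff (ch_map c j.+1))%VF = 0.
  by rewrite -hom_map_comp ?(cA j.+1) // fD hom_map0.
case: j f fA fD FD jm fcob => [|j] f fA fD FD jm /= fcob.
  suff F0 : Ff f = 0 by exact: (hom_bij_faithful (Pbij (cp 0%N)) fA F0).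
  apply: (@cone_hom_exact 0 isT (Ff f) (hom_mapP P fA)).
  apply/comp_eq0P => z; rewrite [cone_map 0 z]cone_pairE lfun_appD.
  move/comp_eq0P: FD => ->; move/comp_eq0P: fcob => ->.
  by rewrite addr0.
have [g gA gE] := fcob.
have [h hA hE] := sum_copair (hom_mapP P fA) gA.
have [v vA vE] : exists2 v, v \in HomA (F (ch_obj c j)) (F N)
    & Ff f = (v \o Ff (ch_map c j.+1))%VF.
  have [|u uA uE] := @cone_hom_exact j.+1 (ltnW jm) h hA.
    apply/comp_eq0P => z; rewrite cone_mapE hE /= cone_pairE lfun_appD.
    move/comp_eq0P: FD => ->; rewrite -[Ff f _]comp_lfunE gE comp_lfunE.
    by rewrite linearN /= add0r subrr.
  have fE x : Ff f x = u (cone_map j (x, 0)).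
    by rewrite -comp_lfunE -uE hE /= linear0 addr0.
  clear h hA hE uE g gA gE fcob jm.
  case: j f fA fD FD u uA fE => [|j] f fA fD FD u uA fE.
    exists u => //; apply/lfunP => x; rewrite fE comp_lfunE.
    by rewrite [cone_map 0 _]cone_pairE /= linear0 addr0.
  exists (u \o sum_inl _ _)%VF; first by rewrite HomA_comp ?sum_inlP.
  apply/lfunP => x; rewrite fE !comp_lfunE sum_inlE cone_mapE /= linear0 oppr0.
  by rewrite cone_pairE /= linear0 addr0.
have [u uA uE] := hom_bij_full (Pbij (cp j)) vA.
exists u => //; apply: hom_bij_inj (Pbij (cp j.+1)) _ _ _ => //.
  by rewrite HomA_comp ?(cA j.+1).
by rewrite hom_map_comp ?(cA j.+1) // uE.
Qed.

(** The pair (0, g) is a cocycle on the cone. In a map bounding it, the component on F c_j is F f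
    for the desired f, and the component on d_{j-1} makes the difference a coboundary. *)
Lemma cone_ext_surj j (g : 'Hom(ch_obj d j, F N)) : (j <= m)%N ->
  cocycle g -> exists2 f : 'Hom(ch_obj c j, N),
    cocycle f & coboundary (g - (Ff f \o phi j)%VF).
Proof.
move=> jm [gA gD]; have [cp _] := cP.
have [h hA hE] := sum_copair (HomA0 (F (ch_obj c j.+1)) (F N)) gA.
have {}hE z : h z = g z.2 by rewrite hE lfunE add0r.
have [|u uA uE] := @cone_hom_exact j.+1 jm h hA.
  apply/comp_eq0P => z; rewrite cone_mapE hE /= linearN /=.
  by move/comp_eq0P: gD => ->; rewrite oppr0.
have {}uE z : u (cone_map j z) = g z.2 by rewrite -hE uE comp_lfunE.
have fP (v : 'Hom(F (ch_obj c j), F N)) : v \in HomA (F (ch_obj c j)) (F N) ->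
    (v \o Ff (ch_map c j.+1))%VF = 0 ->
    exists2 f : 'Hom(ch_obj c j, N), cocycle f & Ff f = v.
  move=> vA vD; have [f fA fE] := hom_bij_full (Pbij (cp j)) vA.
  exists f => //; split=> //; apply: hom_bij_faithful (Pbij (cp j.+1)) _ _.
    by rewrite HomA_comp ?(cA j.+1).
  by rewrite hom_map_comp ?(cA j.+1) // fE.
clear h hA hE jm.
case: j g gA gD u uA uE fP => [|j] g gA gD u uA uE fP.
  have [|f fc fE] := fP u uA.
    apply/comp_eq0P => x; have := uE (x, 0).
    by rewrite [cone_map 0 _]cone_pairE /= !linear0 addr0.
  exists f => //=; apply/subr0_eq; rewrite subr0; apply/lfunP => y.
  rewrite add_lfunE opp_lfunE comp_lfunE fE lfunE -(uE (0, y)).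
  by rewrite [cone_map 0 _]cone_pairE /= linear0 add0r subrr.
have uD x y : u (x, y) = u (x, 0) + u (0, y).
  by rewrite -linearD; congr (u _); congr pair; rewrite /= ?addr0 ?add0r.
have [||f fc fE] := fP (u \o sum_inl _ _)%VF; first by rewrite HomA_comp ?sum_inlP.
  apply/comp_eq0P => x; have := uE (x, 0).
  by rewrite cone_mapE comp_lfunE sum_inlE cone_pairE /= !linear0 addr0.
exists f => //=; exists (- (u \o sum_inr _ _)%VF).
  by rewrite memvN; apply: HomA_comp uA (sum_inrP _ _).
have uinl x : (u \o sum_inl _ _)%VF x = u (x, 0) by rewrite comp_lfunE sum_inlE.
have uinr x : (u \o sum_inr _ _)%VF x = u (0, x) by rewrite comp_lfunE sum_inrE.
apply/lfunP => y; rewrite add_lfunE opp_lfunE [(_ \o phi _)%VF y]comp_lfunE fE.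
rewrite [RHS]comp_lfunE opp_lfunE uinl uinr.
rewrite -[g y](uE (0, y)) cone_mapE cone_pairE /= linear0 add0r.
rewrite uD addrC addKr -[RHS]linearN; congr (u _); congr pair.
by rewrite /= oppr0.
Qed.

End Cone.

(** * Covers and relative presentations *)

Section CoverCriterion.
Variables (k : fieldType) (C : fdalg k) (P : fdmod C).
Implicit Types M N U V W X Y Z : fdmod C.

Local Notation F := (hom_mod P).
Local Notation Ff := (hom_map P).

Lemma ext_bij_acyclic M N m j :
  projective P -> (forall U, projective U -> hom_bij P U N) ->
  (forall U, projective U -> acyclic m (F U) (F N)) -> (j <= m)%N ->
  ext_bij P j M N.
Proof.
move=> Pp Pbij Pacy jm c d phi cP dP phiP; split=> [f fc fb|g gc].
  exact: (cone_ext_inj Pp Pbij Pacy cP dP phiP jm).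
exact: (cone_ext_surj Pp Pbij Pacy cP dP phiP jm).
Qed.

Lemma hom_bij_add W U N : in_add W U -> hom_bij P W N -> hom_bij P U N.
Proof.
move=> /in_addP WU WN h hA.
suff E Y (e : 'Hom(Y, U)) : factors (eq W) e ->
    (exists2 f, f \in HomA Y N & Ff f = (h \o Ff e)%VF) /\
    (forall f, f \in HomA U N -> Ff f = h ->
     forall g, g \in HomA U N -> Ff g = h -> ((f - g) \o e)%VF = 0).
  have [[f fA fE] funi] := E _ _ WU; exists f.
  have {}fE : Ff f = h by rewrite fE hom_map1 comp_lfun1r.
  split=> // g [gA gE]; apply/subr0_eq.
  by rewrite -[LHS]comp_lfun1r; apply: funi.
elim=> [|Z i p e' WZ].
  split; first by exists 0; rewrite ?HomA0 // !hom_map0 comp_lfun0r.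
  by move=> f _ _ g _ _; rewrite comp_lfun0r.
case: _ / WZ i p => i p iA pA We [[f fA fE] funi].
have [f1 fA1 f1E] := hom_bij_full WN (HomA_comp hA (hom_mapP P pA)).
split=> [|f' fA' fE' g gA gE].
  exists ((f1 \o i) + f)%VF; first by rewrite memvD // HomA_comp.
  rewrite !hom_mapD ?HomA_comp ?(factors_HomA We) // !hom_map_comp //.
  by rewrite comp_lfunDr fE f1E comp_lfunA.
rewrite comp_lfunDr funi // addr0 comp_lfunA.
suff -> : ((f' - g) \o p)%VF = 0 by rewrite comp_lfun0l.
apply: hom_bij_faithful WN _ _; first by rewrite HomA_comp ?memvB.
by rewrite hom_map_comp ?memvB // hom_mapB // fE' gE subrr comp_lfun0l.
Qed.

(** * From a relative presentation to full faithfulness and vanishing of Ext *)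

Section Presentation.
Variables (V : nat -> fdmod C) (D : forall i, 'Hom(V i.+1, V i)) (N : fdmod C).
Variable n : nat.
Hypothesis DA : forall i, D i \in HomA (V i.+1) (V i).
Hypothesis Vadd : forall i, (i < n.+2)%N -> in_add P (V i.+1).
Hypothesis Dex : exact_upto (fun i => Ff (D i)) n.+2.
Hypothesis Nex : forall j, (j < n.+2)%N -> hom_exact_at D N j.

Let DD i : (i < n.+1)%N -> (D i \o D i.+1)%VF = 0.
Proof.
move=> lt_in; apply: hom_map_faithful (Vadd _) _ _; rewrite ?HomA_comp //.
by rewrite hom_map_comp // (exact_at Dex _).1.
Qed.

(** Exactness of Hom(V, N) in degree 1 gives fullness and in degree 0 faithfulness, since F is fully
    faithful on maps out of the V_i with i > 0. *)
Lemma presentation_hom_bij : hom_bij P (V 0) N.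
Proof.
move=> h hA; have h0 := exact_surj Dex.
have [f1 fA1 f1E] := hom_map_full (Vadd (ltn0Sn _)) (HomA_comp hA (hom_mapP P (DA 0))).
have fD : (f1 \o D 1)%VF = 0.
  apply: hom_map_faithful (Vadd _) _ _; rewrite ?HomA_comp //.
  rewrite hom_map_comp // f1E -comp_lfunA -hom_map_comp // DD //.
  by rewrite hom_map0 comp_lfun0r.
have [//|g gA gE] := @Nex 1%N _ f1 fA1 fD.
have FgE : Ff g = h.
  apply/lfunP => y; have [x <-] := h0 y; rewrite -!comp_lfunE -f1E.
  by rewrite -hom_map_comp // -gE.
exists g; split=> // g' [gA' gE']; apply/subr0_eq.
apply: (@Nex 0%N isT); first exact: memvB.
apply: hom_map_faithful (Vadd _) _ _; rewrite ?HomA_comp ?memvB //.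
by rewrite hom_map_comp ?memvB // hom_mapB // FgE gE' subrr comp_lfun0l.
Qed.

(** F V is a projective resolution of F V_0 in the given range, and Hom(F V_i, F N) = Hom(V_i, N)
    for i > 0; degrees 2 to n + 1 give Ext^1 to Ext^n. *)
Lemma presentation_acyclic : acyclic n (F (V 0)) (F N).
Proof.
apply: (@hom_exact_acyclic _ _ (fun i => F (V i)) (fun i => Ff (D i))) => //.
- by move=> i; apply: hom_mapP.
- by move=> [//|i] /andP[_ i_n]; apply/hom_mod_projective/Vadd; apply: leqW.
move=> [|[|j]] // /andP[_ jn] f fA fD.
have [f' fA' fE] := hom_map_full (Vadd (leqW jn)) fA.
have [||g gA gE] := @Nex j.+2 _ f' fA'; first exact: jn.
  apply: hom_map_faithful (Vadd _) _ _; rewrite ?HomA_comp //.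
  by rewrite hom_map_comp // fE.
exists (Ff g); first exact: hom_mapP.
by rewrite -hom_map_comp // -gE.
Qed.

End Presentation.

(** * From comparison of Ext to exactness of Hom complexes *)

Section Converse.
Variables (M N : fdmod C) (e : chain M) (m : nat).
Hypothesis Pproj : projective P.
Hypothesis Mproj : projective M.
Hypothesis Padd : forall i, in_add P (ch_obj e i).
Hypothesis Fe0 : forall y, exists x, Ff (ch_map e 0) x = y.
Hypothesis Fe : forall i, (ch_map e i \o ch_map e i.+1)%VF = 0 /\
  forall y, Ff (ch_map e i) y = 0 -> exists x, Ff (ch_map e i.+1) x = y.
Hypothesis Pext : forall j, (j <= m)%N -> ext_bij P j M N.

Let eA i : ch_map e i \in HomA _ _ := ch_mapP e i.

Definition image_chain_obj i := F (ch_obj e i).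

(** The two branches look alike, but F (augment M _ i) and augment (F M) _ i agree only after a case
    on i. The chain is used for P = T, to pass to R, and for P = HQ, to pass on to E. *)
Definition image_chain_map i :
    'Hom(augment (F M) image_chain_obj i.+1, augment (F M) image_chain_obj i) :=
  match i return 'Hom(augment (F M) image_chain_obj i.+1,
                      augment (F M) image_chain_obj i) with
  | 0 => Ff (ch_map e 0)
  | j.+1 => Ff (ch_map e j.+1)
  end.

Lemma image_chain_mapP i : image_chain_map i \in HomA _ _.
Proof. by case: i => [|i]; apply: hom_mapP; [exact: (eA 0) | exact: (eA i.+1)]. Qed.

Definition image_chain := Chain image_chain_mapP.

Lemma image_chain_resolution : proj_resolution image_chain.
Proof.
split=> [i|n]; first exact/hom_mod_projective/Padd.
split=> [_|i _]; first exact/limg_fullP.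
apply/limg_lkerP; have [ee ke] := Fe i; case: i ee ke => [|i] ee ke.
  by split=> //; rewrite -[LHS]hom_map_comp ?(eA 0) ?(eA 1) // ee hom_map0.
by split=> //; rewrite -[LHS]hom_map_comp ?(eA i.+1) ?(eA i.+2) // ee hom_map0.
Qed.

(** F e is a projective resolution of F M, so [ext_bij] compares it with a resolution c of M, and
    Hom(c, N) is exact because M is projective. Degree 0 uses injectivity on Hom; degree j + 1 uses
    surjectivity on Ext^j, and faithfulness of F on add P returns from F e to e. *)
Lemma ext_bij_hom_exact j : (j <= m.+1)%N ->
  @hom_exact_at _ _ (augment M (ch_obj e)) (ch_map e) N j.
Proof.
move=> jm; have [c cP] := has_proj_resolution M; have dP := image_chain_resolution.
have [phi phiP] := has_comparison Pproj cP dP.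
have cA i : ch_map c i \in HomA _ _ := ch_mapP c i.
have [phiA phi0 phiS] := phiP.
have cex i : @hom_exact_at _ _ (augment M (ch_obj c)) (ch_map c) N i.
  apply: acyclic_hom_exact => [l||l _]; [exact: (ch_mapP c l)|exact: cP.2|].
  by apply: acyclic_proj; case: l => [|l] //; apply: cP.1.
have c0 y : exists x, ch_map c 0 x = y.
  by have [/(_ isT)/limg_fullP] := cP.2 1%N.
have cc i : (ch_map c i \o ch_map c i.+1)%VF = 0.
  by have [_ /(_ i (leqnn _))/limg_lkerP[]] := cP.2 i.+2.
case: j jm => [|j] jm f fA fe.
  have [inj _] := Pext (leq0n m) cP dP phiP.
  have f0A : (f \o ch_map c 0)%VF \in HomA (ch_obj c 0) N.
    by apply: HomA_comp fA (cA 0).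
  have f0c : cocycle (c := c) (j := 0%N) (f \o ch_map c 0)%VF.
    by split=> //; rewrite -comp_lfunA cc comp_lfun0r.
  have /comp_eq0P f0 : (f \o ch_map c 0)%VF = 0.
    apply: (inj _ f0c); rewrite /= hom_map_comp ?(cA 0) // -comp_lfunA phi0 /=.
    by rewrite -[LHS]hom_map_comp ?(eA 0) // fe hom_map0.
  by apply/lfunP => y; have [x <-] := c0 y; rewrite f0 lfunE.
have [_ surj] := Pext jm cP dP phiP.
have eA' i : ch_map e i.+1 \in HomA (ch_obj e i.+1) (ch_obj e i) := eA i.+1.
have [|f1 [fA1 f1c] f1E] := surj (Ff f).
  split; first exact: hom_mapP.
  by rewrite -[LHS]hom_map_comp ?eA' // fe hom_map0.
have [g1 gA1 f1g] := cex j.+1 f1 fA1 f1c.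
clear surj f1c jm.
case: j f fA fe f1 fA1 f1E g1 gA1 f1g => [|j] f fA fe f1 fA1 /= f1E g1 gA1 f1g.
  exists g1 => //; apply: hom_map_inj (Padd 0) fA _ _.
    by rewrite HomA_comp ?(eA 0).
  apply/subr0_eq; rewrite -[RHS]f1E f1g.
  rewrite [in RHS]hom_map_comp ?(cA 0) // -comp_lfunA phi0 /=.
  by rewrite hom_map_comp ?(eA 0).
have [w wA wE] := f1E.
have cA' i : ch_map c i.+1 \in HomA (ch_obj c i.+1) (ch_obj c i) := cA i.+1.
have gpA : (Ff g1 \o phi j)%VF \in HomA (F (ch_obj e j)) (F N).
  exact: HomA_comp (hom_mapP P gA1) (phiA j).
have [h hA hE] := hom_map_full (Padd j) (memvD wA gpA).
exists h => //; apply: hom_map_inj (Padd j.+1) fA _ _; first by rewrite HomA_comp ?eA'.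
rewrite hom_map_comp ?eA' // hE comp_lfunDl.
move/eqP: wE; rewrite subr_eq => /eqP ->.
rewrite f1g hom_map_comp ?cA' // -!comp_lfunA phiS.
by [].
Qed.

End Converse.

(** The cokernel of [D j] embeds in its own coinduced module, which gives a map out of K_j whose
    kernel is exactly the image of [D j]. *)
Lemma coind_exact (K : nat -> fdmod C) (D : forall i, 'Hom(K i.+1, K i)) n :
  (forall i, D i \in HomA (K i.+1) (K i)) ->
  (forall i, (i.+1 < n)%N -> (D i \o D i.+1)%VF = 0) ->
  (forall j W, (j < n)%N -> hom_exact_at D (coind_mod C W) j) -> exact_upto D n.
Proof.
move=> DA DD Dex.
have test j : (j < n)%N -> exists W (f : 'Hom(K j, coind_mod C W)),
    [/\ f \in HomA _ _, (f \o D j)%VF = 0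
      & forall y, f y = 0 -> exists x, D j x = y].
  move=> jn; pose q := coker_proj (DA j).
  exists (coker_mod (DA j)), (coind_unit _ \o q)%VF; split.
  - by rewrite HomA_comp ?coind_unitP ?coker_projP.
  - by rewrite -comp_lfunA coker_proj_comp comp_lfun0r.
  - by move=> y; rewrite comp_lfunE => /coind_unit_inj; apply: coker_proj_ker.
split=> [n0|i lt_in].
  have [W [f [fA fD kf]]] := test 0%N n0; have f0 := Dex 0%N W n0 f fA fD.
  by apply/limg_fullP => y; apply: kf; rewrite f0 lfunE.
apply/limg_lkerP; split=> [|y Dy]; first exact: DD.
have [W [f [fA fD kf]]] := test i.+1 lt_in.
have [g gA gE] := Dex i.+1 W lt_in f fA fD.
by apply: kf; rewrite gE comp_lfunE Dy linear0.
Qed.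

(** Exact under Hom(Q, -) by construction; the chain itself need not be exact, as the approximations
    need not be onto. *)
Lemma approximation_chain Q X : exists c : chain X,
  [/\ forall i, in_add Q (ch_obj c i),
      forall u, u \in HomA Q X ->
        exists2 v, v \in HomA Q (ch_obj c 0) & (ch_map c 0 \o v)%VF = u
    & forall i, (ch_map c i \o ch_map c i.+1)%VF = 0 /\
        forall u, u \in HomA Q (ch_obj c i) -> (ch_map c i \o u)%VF = 0 ->
        exists2 v, v \in HomA Q (ch_obj c i.+1) & (ch_map c i.+1 \o v)%VF = u].
Proof.
pose cov X := pow_mod Q (size (vbasis (HomA Q X))).
have sigE Z : {p : 'Hom(cov Z, Z) | p \in HomA (cov Z) Z
    & limg (hom_map Q p) = fullv}.
  have /sigW[p /andP[pA /eqP ps]] : exists p : 'Hom(cov Z, Z),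
      (p \in HomA (cov Z) Z) && (limg (hom_map Q p) == fullv).
    have [p [pA pE]] := add_approximation Q Z; exists p; rewrite pA /=; apply/eqP.
    by apply/limg_fullP/hom_map_surjP.
  by exists p.
pose cmap Z : 'Hom(cov Z, Z) := s2val (sigE Z).
have cmapA Z : cmap Z \in HomA _ _ by rewrite /cmap; case: (sigE Z).
have cmapE Z u : u \in HomA Q Z -> exists2 v, v \in HomA Q (cov Z) & (cmap Z \o v)%VF = u.
  move=> uA; have : limg (hom_map Q (cmap Z)) = fullv by rewrite /cmap; case: (sigE Z).
  by move/limg_fullP/(hom_map_surjP _ (cmapA Z)).1; apply.
pose syz Z := ker_mod (cmapA Z).
have sigI Z : {i : 'Hom(syz Z, cov Z) | i \in HomA (syz Z) (cov Z) &
    lker i = 0%VS /\ limg i = lker (cmap Z)}.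
  have /sigW[i /and3P[iA /eqP ik /eqP im]] :
      exists i : 'Hom(syz Z, cov Z), [&& i \in HomA (syz Z) (cov Z), lker i == 0%VS
        & limg i == lker (cmap Z)].
    by have [i iA [ik im]] := ker_mod_incl (cmapA Z); exists i; rewrite iA ik im !eqxx.
  by exists i.
pose incl Z : 'Hom(syz Z, cov Z) := s2val (sigI Z).
have inclA Z : incl Z \in HomA _ _ by rewrite /incl; case: (sigI Z).
have [incl0 inclE] : (forall Z x, incl Z x = 0 -> x = 0) /\
    (forall Z, limg (incl Z) = lker (cmap Z)).
  split=> Z; rewrite /incl; case: (sigI Z) => i ? [ik im] //.
  exact/lker_eq0P.
pose S i := iter i syz X.
pose d i : 'Hom(augment X (cov \o S) i.+1, augment X (cov \o S) i) :=
  match i return 'Hom(augment X (cov \o S) i.+1, augment X (cov \o S) i) with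
  | 0 => cmap X
  | j.+1 => (incl (S j) \o cmap (S j.+1))%VF
  end.
have dA i : d i \in HomA _ _.
  by case: i => [|i]; [apply: cmapA | apply: HomA_comp (inclA _) (cmapA _)].
exists (Chain dA); split=> [i|u uA|i] /=; first exact: in_add_pow.
  exact: cmapE.
have ci : (cmap (S i) \o incl (S i))%VF = 0 by case: ((limg_lkerP _ _).1 (inclE (S i))).
have ker u : u \in HomA Q (cov (S i)) -> (cmap (S i) \o u)%VF = 0 ->
    exists2 v, v \in HomA Q (cov (S i.+1)) & (incl (S i) \o cmap (S i.+1) \o v)%VF = u.
  move=> uA /comp_eq0P cu.
  have [|w wA wE] := factor_inj (inclA (S i)) uA (incl0 _).
    by move=> x; have [_] := (limg_lkerP _ _).1 (inclE (S i)); apply; apply: cu.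
  have [v vA vE] := cmapE (S i.+1) w wA.
  by exists v; rewrite // -comp_lfunA vE.
split.
  case: i ci {ker} => [|i] ci; first by rewrite comp_lfunA ci comp_lfun0l.
  by rewrite -comp_lfunA [X in (_ \o X)%VF]comp_lfunA ci comp_lfun0l comp_lfun0r.
move=> u uA du; apply: ker => //; case: i u uA du {ci} => [//|i] u uA /= du.
apply/comp_eq0P => x; apply: (incl0 (S i)); move/comp_eq0P: du => /(_ x).
by rewrite comp_lfunE.
Qed.

End CoverCriterion.

(** * Relative codominant dimension *)

Section Transfer.
Variables (k : fieldType) (A : fdalg k) (T Q : fdmod A).
Hypothesis TQ : in_add T Q.
Implicit Types M N X Y : fdmod A.

Local Notation H := (hom_mod T).
Local Notation Hf := (hom_map T).

(** As Q lies in add T, maps HQ -> HX are the images of unique maps Q -> X, so Hom_R(HQ, H -) is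
    Hom_A(Q, -). *)
Lemma transfer_surj M N (g : 'Hom(M, N)) : g \in HomA M N ->
  (forall y, exists x, hom_map Q g x = y) ->
  forall y, exists x, hom_map (H Q) (Hf g) x = y.
Proof.
move=> gA /(hom_map_surjP _ gA).1 gs.
apply/(hom_map_surjP _ (hom_mapP T gA)) => u uA.
have [u' uA' <-] := hom_map_full TQ uA; have [v vA vE] := gs u' uA'.
by exists (Hf v); rewrite ?hom_mapP // -hom_map_comp // vE.
Qed.

Lemma transfer_ker X M N (f : 'Hom(X, M)) (g : 'Hom(M, N)) :
  f \in HomA X M -> g \in HomA M N ->
  (forall y, hom_map Q g y = 0 -> exists x, hom_map Q f x = y) ->
  forall y, hom_map (H Q) (Hf g) y = 0 -> exists x, hom_map (H Q) (Hf f) x = y.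
Proof.
move=> fA gA /(hom_map_kerP _ fA gA).1 gf.
apply/(hom_map_kerP _ (hom_mapP T fA) (hom_mapP T gA)) => u uA.
have [u' uA' <-] := hom_map_full TQ uA; rewrite -hom_map_comp // => gu.
have [|v vA vE] := gf u' uA'.
  by apply: hom_map_faithful TQ _ gu; apply: HomA_comp.
by exists (Hf v); rewrite ?hom_mapP // -hom_map_comp // vE.
Qed.

Lemma alg_iso_opp (B C : fdalg k) :
  alg_iso B C -> alg_iso (opp_alg B) (opp_alg C).
Proof. by case=> f [fb f1 fM]; exists f; split=> // a b; apply: fM. Qed.

Lemma end_alg_hom : alg_iso (end_alg Q) (end_alg (H Q)).
Proof.
pose f (u : end_alg Q) : end_alg (H Q) := vsproj (HomA (H Q) (H Q)) (Hf (vsval u)).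
have fE u : vsval (f u) = Hf (vsval u) by rewrite vsprojK // hom_mapP // subvsP.
have fL : linear f.
  move=> c u v; apply: subvs_inj; rewrite fE linearP [RHS]linearP /= !fE.
  apply/lfunP => x; apply: subvs_inj.
  rewrite add_lfunE scale_lfunE linearP /= !hom_mapE ?subvsP //.
    by rewrite comp_lfunDl -comp_lfunZl.
  by rewrite memvD ?memvZ ?subvsP.
have fi : injective f.
  move=> u v /(congr1 vsval); rewrite !fE => uv; apply: subvs_inj.
  exact: hom_map_inj TQ (subvsP u) (subvsP v) uv.
have fs v : exists u, f u == v.
  have [u uA uE] := hom_map_full TQ (subvsP v); exists (vsproj _ u).
  by apply/eqP/subvs_inj; rewrite fE vsprojK.
exists (linfun f); split.
- exists (fun v => xchoose (fs v)) => u; rewrite (linfun_linearE fL).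
    by apply: fi; apply/eqP/(xchooseP (fs (f u))).
  exact/eqP/(xchooseP (fs u)).
- rewrite (linfun_linearE fL); apply: subvs_inj; rewrite fE /= !vsprojK ?hom_map1 //.
    exact: (HomA1 (H Q)).
  exact: HomA1.
move=> a b; rewrite !(linfun_linearE fL); apply: subvs_inj.
by rewrite fE !hom_compE !fE hom_map_comp ?subvsP.
Qed.

End Transfer.

Section RelativeCodominant.
Variables (k : fieldType) (A : fdalg k).
Variables (disp : Order.disp_t) (L : finPOrderType disp).
Variables (Delta Nabla : L -> fdmod A) (T Q : fdmod A).
Hypothesis Delta_qh : split_quasi_hereditary Delta.
Hypothesis Nabla_co : costandard Delta Nabla.
Hypothesis T_tilting : characteristic_tilting Delta Nabla T.
Hypothesis TQ : in_add T Q.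
Implicit Types M N X Y : fdmod A.

Local Notation H := (hom_mod T).
Local Notation Hf := (hom_map T).

(** F(Nabla~) is closed under cosyzygies: Ext^1(Delta(l), cosyz X) is Ext^2(Delta(l), X), which is
    Ext^1(C(l), X) = 0 because C(l) lies in F(Delta~). *)
Lemma standard_acyclic m M X :
  filt_class Delta M -> filt_class Nabla X -> acyclic m M X.
Proof.
elim: m X => [|m IHm] X FM FX //; apply/acyclicS; split.
  exact: (costandard_ext1 Nabla_co).
apply: IHm => //; apply: (costandard_class Nabla_co) => l.
have [_ _ [Pr [Pp Cs _]]] := Delta_qh; have [B [f [g [fg FB]]]] := Cs l.
have fA : f \in HomA B (Pr l) by case: fg.
apply: (ext1_zero_of_proj (Pp l) fg) => h hA.
have BX : ext1_zero B X.
  apply: (costandard_ext1 Nabla_co) FX.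
  by apply: filtered_sub FB => Z [m' [n [_ Zm]]]; exists m', n.
have [h1 hA1 h1E] := BX h hA.
have [|h2 hA2 h2E] := injective_extend (coind_injective (V := X)) fA hA1.
  by case/short_exactP: fg.
exists (cosyz_proj X \o h2)%VF; first by rewrite HomA_comp ?cosyz_projP.
by rewrite -comp_lfunA h2E.
Qed.

(** * From relative codominant dimension to the cover property *)

Section Forward.
Variables (c : chain T) (n : nat).
Hypothesis cQ : forall i, (i < n.+2)%N -> in_add Q (ch_obj c i).
Hypothesis cex : exact_upto (ch_map c) n.+2.
Hypothesis cexQ : exact_upto (fun i => hom_map Q (ch_map c i)) n.+2.

Local Notation K := (augment T (ch_obj c)).
Let cA i : ch_map c i \in HomA (K i.+1) (K i) := ch_mapP c i.

Let TK i : (i <= n.+2)%N -> in_add T (K i).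
Proof.
by case: i => [_|i i_n]; [apply: in_add_refl | apply: in_add_trans TQ (cQ i_n)].
Qed.

(* Exactness of Hom_R(H K, N) in degrees at most n + 1, where H = Hom_A(T, -) *)
Definition good (N : fdmod (ringel_dual T)) :=
  forall j, (j < n.+2)%N ->
  @hom_exact_at _ (ringel_dual T) (fun i => H (K i)) (fun i => Hf (ch_map c i)) N j.

Lemma good_costandard X : filt_class Nabla X -> good (H X).
Proof.
move=> FX j jn f fA fD; have [f' fA' fE] := hom_map_full (TK (ltnW jn)) fA.
have fD' : (f' \o ch_map c j)%VF = 0.
  apply: hom_map_faithful (TK jn) _ _; first exact: HomA_comp fA' (cA j).
  by rewrite hom_map_comp ?cA // fE.
have Kacy i : (i <= j)%N -> acyclic j.-1 (K i) X.
  move=> ij; apply: standard_acyclic FX; apply: (tilting_standard T_tilting).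
  exact/TK/(leq_trans ij)/ltnW.
have := @acyclic_hom_exact _ _ K (ch_map c) cA j X
  (exact_upto_leq jn cex) Kacy f' fA' fD'.
rewrite -{}fE; case: j jn {Kacy} f fA fD f' fA' fD' => [|j] jn f fA fD f' fA' fD'.
  by move=> ->; rewrite hom_map0.
by case=> g gA ->; exists (Hf g); rewrite ?hom_mapP // hom_map_comp ?(cA j).
Qed.

Lemma good_zero (N : fdmod (ringel_dual T)) : is_zero_mod N -> good N.
Proof.
move=> N0 [|j] jn f fA fD; first exact: is_zero_mod_hom (or_intror N0).
exists 0; rewrite ?HomA0 // comp_lfun0l; exact: is_zero_mod_hom (or_intror N0).
Qed.

(** The H K_j are projective over R, so Hom_R(H K, -) yields a short exact sequence of complexes in
    this range, and exactness of the outer two passes to the middle. *)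
Lemma good_ext (N1 N N2 : fdmod (ringel_dual T)) (i : 'Hom(N1, N)) (p : 'Hom(N, N2)) :
  short_exact i p -> good N1 -> good N2 -> good N.
Proof.
move=> ip G1 G2 j jn f fA fD; have [iA pA i0 [pi _] _] := (short_exactP i p).1 ip.
have HcA l : Hf (ch_map c l) \in HomA (H (K l.+1)) (H (K l)) by rewrite hom_mapP ?cA.
have pf := G2 j jn (p \o f)%VF (HomA_comp pA fA).
have sub1 (f1 : 'Hom(H (K j), N1)) (g : 'Hom(H (K j), N)) : (i \o f1)%VF = g ->
    (g \o Hf (ch_map c j))%VF = 0 -> (f1 \o Hf (ch_map c j))%VF = 0.
  move=> <- /comp_eq0P g0; apply/comp_eq0P => x; apply: i0.
  by rewrite -comp_lfunE g0.
case: j jn f fA fD pf sub1 => [|j] jn f fA fD pf sub1.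
  have [|f1 fA1 f1E] := factor_ker ip fA.
    by apply: pf; rewrite -comp_lfunA fD comp_lfun0r.
  by rewrite -f1E (G1 0%N jn f1 fA1) ?comp_lfun0r //; apply: sub1 f1E fD.
have [|h hA hE] := pf; first by rewrite -comp_lfunA fD comp_lfun0r.
have [h' hA' hE'] := ses_projective_lift (hom_mod_projective (TK (ltnW (ltnW jn)))) ip hA.
have fhA : f - (h' \o Hf (ch_map c j))%VF \in HomA (H (K j.+1)) N.
  by rewrite memvB // HomA_comp ?HcA.
have [|f1 fA1 f1E] := factor_ker ip fhA.
  by rewrite comp_lfunDr comp_lfunNr comp_lfunA hE' hE subrr.
have [|v vA vE] := G1 j.+1 jn f1 fA1.
  apply: sub1 f1E _; rewrite comp_lfunDl comp_lfunNl fD -comp_lfunA.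
  rewrite -hom_map_comp ?cA // (exact_at cex jn).1 hom_map0 comp_lfun0r.
  by rewrite subr0.
exists (h' + (i \o v)%VF); first by rewrite memvD // HomA_comp.
by rewrite comp_lfunDl -comp_lfunA -vE f1E addrC subrK.
Qed.

Lemma good_filtered (N : fdmod (ringel_dual T)) :
  filt_class (fun l => H (Nabla l)) N -> good N.
Proof.
move=> FN; refine (filtered_tensor_ind (C := good) good_zero _ _ FN).
  by move=> B V U f g fg; apply: good_ext fg.
by move=> l _; apply: good_costandard; apply: filtered_tensor.
Qed.

(** Serves the cover condition, where N is projective: R lies in add HT, HT is good since T lies in
    F(Nabla~), and goodness passes to powers and retracts. *)
Lemma good_projective (N : fdmod (ringel_dual T)) : projective N -> good N.
Proof.
move=> /(in_add_trans (in_add_hom_reg T))[m [i [p [iA pA pi]]]].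
have Gp : good (pow_mod (H T) m).
  elim: m {i p iA pA pi} => [|m IHm]; first exact/good_zero/(@zero_mod_zero _ _).
  apply: good_ext (sum_ses _ _) _ IHm; apply: good_costandard.
  exact: (tilting_costandard T_tilting) (in_add_refl T).
move=> j jn f fA fD.
have := Gp j jn (i \o f)%VF (HomA_comp iA fA); rewrite -comp_lfunA fD comp_lfun0r.
have fE : f = (p \o (i \o f))%VF by rewrite comp_lfunA pi comp_lfun1l.
move/(_ erefl); case: j jn f fA fD fE => [|j] jn f fA fD fE.
  by move=> f0; rewrite fE f0 comp_lfun0r.
case=> g gA gE; exists (p \o g)%VF; first exact: HomA_comp.
by rewrite fE gE comp_lfunA.
Qed.

(** The complex presents only HT, but every projective U lies in add HT, and both conclusions pass
    to additive closures. *)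
Lemma good_cover (N : fdmod (ringel_dual T)) : good N ->
  forall U : fdmod (ringel_dual T), projective U ->
  hom_bij (H Q) U N /\ acyclic n (hom_mod (H Q) U) (hom_mod (H Q) N).
Proof.
move=> GN U Up; have UT : in_add (H T) U by apply: in_add_trans (in_add_hom_reg T) Up.
have HcA l : Hf (ch_map c l) \in HomA (H (K l.+1)) (H (K l)) by rewrite hom_mapP ?cA.
have Vadd i : (i < n.+2)%N -> in_add (H Q) (H (K i.+1)).
  by move=> i_n; apply/in_add_hom/cQ.
have Dex : exact_upto (fun i => hom_map (H Q) (Hf (ch_map c i))) n.+2.
  split=> [_|i i_n].
    by apply/limg_fullP/(transfer_surj TQ (cA 0)); apply: exact_surj cexQ.
  apply/limg_lkerP; split.
    rewrite -hom_map_comp ?HcA // -hom_map_comp ?cA //.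
    by rewrite (exact_at cex i_n).1 !hom_map0.
  apply: (transfer_ker TQ (cA i.+1) (cA i)).
  by have [_] := exact_at cexQ i_n.
split.
  apply: hom_bij_add UT _.
  exact: (presentation_hom_bij (V := fun i => H (K i)) HcA Vadd Dex GN).
apply: acyclic_add (in_add_hom (H Q) UT) _.
exact: (presentation_acyclic (V := fun i => H (K i)) HcA Vadd Dex GN).
Qed.

End Forward.

Lemma codomdim_cover n : codomdim_ge Q T n.+2 ->
  is_cover (H Q) (opp_alg (end_alg Q)) /\
  is_ext_cover n (filt_class (fun l => H (Nabla l))) (H Q).
Proof.
case=> m nm [c [cQ cex cexQ]].
have cQ' i : (i < n.+2)%N -> in_add Q (ch_obj c i).
  by move=> i_n; apply: cQ; apply: leq_trans nm.
have cov := good_cover cQ' (exact_upto_leq nm cex) (exact_upto_leq nm cexQ).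
have HQp := hom_mod_projective TQ.
split.
  split=> //; first exact/alg_iso_opp/end_alg_hom.
  move=> M N Mp Np; apply: (cov N _ M Mp).1.
  exact: (good_projective cQ' (exact_upto_leq nm cex) Np).
move=> j M N jn FM FN.
have GN := good_filtered cQ' (exact_upto_leq nm cex) FN.
by apply: ext_bij_acyclic HQp _ _ jn => U Up; have [] := cov N GN U Up.
Qed.

Lemma cover_codomdim n :
  is_ext_cover n (filt_class (fun l => H (Nabla l))) (H Q) ->
  codomdim_ge Q T n.+2.
Proof.
move=> ext; have [c [cQ cT cE]] := approximation_chain Q T.
pose K := augment T (ch_obj c).
have cA i : ch_map c i \in HomA (K i.+1) (K i) := ch_mapP c i.
have TK i : in_add T (K i).
  by case: i => [|i]; [apply: in_add_refl | apply: in_add_trans TQ (cQ i)].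
have Q0 : forall y, exists x, hom_map Q (ch_map c 0) x = y.
  exact/(hom_map_surjP _ (cA 0)).
have Qe i : (ch_map c i \o ch_map c i.+1)%VF = 0 /\
    forall y, hom_map Q (ch_map c i) y = 0 -> exists x, hom_map Q (ch_map c i.+1) x = y.
  have [cc ck] := cE i; split=> //; apply/(hom_map_kerP _ (cA i.+1) (cA i)).
  exact: ck.
exists n.+2 => //; exists c; split=> [i _||]; first exact: cQ.
- apply: coind_exact => [|i _|j W jn]; [exact: cA|by have [] := Qe i|].
  (* Coinduced modules are injective, hence in F(Nabla~), so that their images under H lie in
     F(Delta~_R), where the cover hypothesis applies. *)
  have FX : filt_class Nabla (coind_mod A W).
    apply: (costandard_class Nabla_co) => l; apply: ext1_zero_inj_r.
    exact: coind_injective.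
  have TT := in_add_refl T; have FT := tilting_costandard T_tilting TT.
  have ex := @ext_bij_hom_exact _ (ringel_dual T) (H Q) (H T) (H (coind_mod A W))
    (image_chain T c) n (hom_mod_projective TQ) (hom_mod_projective TT)
    (fun i => in_add_hom T (cQ i)) (transfer_surj TQ (cA 0) Q0) _ _ j jn.
  have {}ex : hom_exact_at (ch_map (image_chain T c)) (H (coind_mod A W)) j.
    apply: ex => [i|l ln].
      have [cc ck] := Qe i; have HTe := transfer_ker TQ (cA i.+1) (cA i) ck.
      have HT0 : (Hf (ch_map c i) \o Hf (ch_map c i.+1))%VF = 0.
        by rewrite -hom_map_comp ?cA // cc hom_map0.
      by case: i {cc ck} HTe HT0.
    by apply: ext => //; apply: (hom_costandard_filtered Nabla_co T_tilting).
  move=> f fA fD; have fD' : (Hf f \o Hf (ch_map c j))%VF = 0.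
    by rewrite -hom_map_comp ?cA // fD hom_map0.
  have fA' := hom_mapP T fA.
  have inj := hom_map_inj (TK j) fA.
  case: j {jn} f fA fD fD' fA' inj ex => [|j] f fA fD fD' fA' inj ex.
    by apply: inj; rewrite ?HomA0 // hom_map0; apply: ex.
  have [g gA gE] : exists2 g, g \in HomA (H (K j)) (H (coind_mod A W))
      & Hf f = (g \o Hf (ch_map c j))%VF.
    (* The differential of [image_chain] becomes [Hf (ch_map c j)] only after a case on j. *)
    by have := ex (Hf f) fA' fD'; move: (Hf f); clear; case: j.
  have [g' gA' g'E] := hom_map_full (TK j) gA.
  exists g' => //; apply: inj; first by rewrite HomA_comp ?cA.
  by rewrite hom_map_comp ?cA // g'E.
- split=> [_|i _]; first exact/limg_fullP.
  apply/limg_lkerP; have [cc ck] := Qe i; split=> //.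
  by rewrite -hom_map_comp ?cA // cc hom_map0.
Qed.

End RelativeCodominant.

Theorem corollary5p3p4 (k : fieldType) (A : fdalg k)
    (disp : Order.disp_t) (L : finPOrderType disp)
    (Delta Nabla : L -> fdmod A) (T Q : fdmod A) (n : nat)
    (Delta_qh : split_quasi_hereditary Delta)
    (Nabla_costandard : costandard Delta Nabla)
    (T_tilting : characteristic_tilting Delta Nabla T)
    (Q_add : in_add T Q)
    (n_ge2 : (2 <= n)%N) :
  codomdim_ge Q T n <->
  split_qh_ext_cover (C := ringel_dual T) (L := Order.dual L)
    (fun l => hom_mod T (Nabla l)) (n - 2)%N (hom_mod T Q)
    (opp_alg (end_alg Q)).
Proof.
case: n n_ge2 => [|[|n]] // _; rewrite subn2 /=; split=> [Tn|[_ _ ext]].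
  have [cov ext] := codomdim_cover Delta_qh Nabla_costandard T_tilting Q_add Tn.
  split=> //; exact: ringel_dual_split_quasi_hereditary T_tilting.
exact: (cover_codomdim Nabla_costandard T_tilting Q_add ext).
Qed.
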